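(* Let smooth initial data (M) for a Moutard net $f$ in $\mathbb{R}^N$ and smooth initial data (MT) for a Moutard transform $f^+$ of $f$ be given. Let $f^\epsilon$ be the canonical discrete M-nets for (M) and $(f^\epsilon)^+$ their canonical discrete Moutard transforms for (MT). Then for some $r>0$ the discrete M-nets $(f^\epsilon)^+:\mathcal{B}^\epsilon(r)\to\mathbb{R}^N$ (defined for all sufficiently small $\epsilon>0$) converge, as $\epsilon\to0$, to the unique Moutard transform $f^+:\mathcal{B}(r)\to\mathbb{R}^N$ of $f$ with the initial data (MT). The convergence is with the order $O(\epsilon)$ in $C^\infty(\mathcal{B}(r))$.
   Context: Put $\mathcal{B}_1=\mathbb{R}\times\{0\}$, $\mathcal{B}_2=\{0\}\times\mathbb{R}$, $\mathcal{B}(r)=[0,r]^2$, $\mathcal{B}^\epsilon(r)=(\epsilon\mathbb{Z})^2\cap[0,r]^2$, $\mathcal{B}_i^\epsilon=\mathcal{B}_i\cap(\epsilon\mathbb{Z})^2$. On $(\epsilon\mathbb{Z})^2$: $(\tau_i f)(u)=f(u+\epsilon e_i)$, $\delta_i=\epsilon^{-1}(\tau_i-1)$, $\delta^\alpha=\delta_1^{\alpha_1}\delta_2^{\alpha_2}$. An M-net satisfies $\partial_1\partial_2 f=q_{12}f$, $q_{12}$ a real function. Initial data (M): two smooth curves $f|_{\mathcal{B}_1}$, $f|_{\mathcal{B}_2}$ in $\mathbb{R}^N$ with a common point $f(0)$, and a smooth function $q_{12}:\mathbb{R}^2\to\mathbb{R}$; $f$ is the M-net with these data. The canonical discrete M-nets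 for (M) are the solutions $f^\epsilon:(\epsilon\mathbb{Z})^2\to\mathbb{R}^N$ of $\tau_1\tau_2f^\epsilon+f^\epsilon=a^\epsilon_{12}(\tau_1f^\epsilon+\tau_2f^\epsilon)$ with $f^\epsilon=f$ on $\mathcal{B}_i^\epsilon$ and $a_{12}^\epsilon=1+\frac12\epsilon^2q_{12}$ on $(\epsilon\mathbb{Z})^2$. Moutard transform of $f$: an M-net $f^+$ with $\partial_1f^++\partial_1f=p_1(f^+-f)$, $\partial_2f^+-\partial_2f=p_2(f^++f)$, where the real functions $p_1,p_2$ satisfy $\partial_1p_2=\partial_2p_1=-q_{12}+p_1p_2$ (then $q_{12}^+=-q_{12}+2p_1p_2$). Initial data (MT): a point $f^+(0)\in\mathbb{R}^N$ and smooth real functions $p_1|_{\mathcal{B}_1}$, $p_2|_{\mathcal{B}_2}$ of one variable. Discrete Moutard transform of $f^\epsilon$: a discrete M-net $(f^\epsilon)^+$, with coefficient $a_{12}^+$, such that (dropping $\epsilon$) $\tau_1f^+-f=b_1(f^+-\tau_1f)$, $\tau_2f^++f=b_2(f^++\tau_2f)$, where $\dfrac{\tau_2b_1}{b_1}=\dfrac{\tau_1b_2}{b_2}=\dfrac{a_{12}^+}{a_{12}}=\dfrac{1}{(b_1+b_2)a_{12}-b_1b_2}$. The canonical one for (MT) has $(f^\epsilon)^+(0)=f^+(0)$ and $b_i^\epsilon(u)=1+\epsilon p_i(u)$ for $u\in\mathcal{B}_i^\epsilon$, $i=1,2$. Convergence $g^\epsilon\to g$ with the order $O(\epsilon)$ in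 $C^\infty(\mathcal{B}(r))$ means: for every multi-index $\alpha$ there is $c_\alpha$ such that $|\delta^\alpha(g^\epsilon-g)(u)|\le c_\alpha\epsilon$ for all sufficiently small $\epsilon>0$ and all $u\in\mathcal{B}^\epsilon(r)$ at which this difference quotient is defined on $\mathcal{B}^\epsilon(r)$. *)

(* Defs.v *)
From HB Require Import structures.
From mathcomp Require Import all_boot all_order all_algebra.
From mathcomp Require Import all_classical all_reals all_analysis.

Set Implicit Arguments.
Unset Strict Implicit.
Unset Printing Implicit Defensive.

Import Order.TTheory GRing.Theory Num.Theory.
Import numFieldNormedType.Exports.

Local Open Scope classical_set_scope.
Local Open Scope ring_scope.

Definition smooth1 (R : realType) (V : normedModType R) (f : R -> V) : Prop :=
  forall n x, derivable (derive1n n f) x 1.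

Definition derivable1 (R : realType) (V : normedModType R) (f : R * R -> V)
    (u : R * R) : Prop :=
  derivable (fun s : R => f (s, u.2)) u.1 1.

Definition derivable2 (R : realType) (V : normedModType R) (f : R * R -> V)
    (u : R * R) : Prop :=
  derivable (fun t : R => f (u.1, t)) u.2 1.

Definition partial1 (R : realType) (V : normedModType R) (f : R * R -> V)
    (u : R * R) : V :=
  derive1 (fun s : R => f (s, u.2)) u.1.

Definition partial2 (R : realType) (V : normedModType R) (f : R * R -> V)
    (u : R * R) : V :=
  derive1 (fun t : R => f (u.1, t)) u.2.

Fixpoint Cn_on (R : realType) (V : normedModType R) (n : nat)
    (U : set (R * R)) (f : R * R -> V) : Prop :=
  (forall u, U u -> {for u, continuous f}) /\
  match n with
  | 0%N => True
  | m.+1 => [/\ forall u, U u -> derivable1 f u /\ derivable2 f u,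
                Cn_on m U (partial1 f) & Cn_on m U (partial2 f)]
  end.

(* Smoothness on an arbitrary set A (typically the closed square B(r)) is
   smoothness on some open neighbourhood of A.  On a closed square with
   nonempty interior the partial derivatives of such a function at points of
   the square depend only on its values on the square. *)
Definition smooth_on (R : realType) (V : normedModType R) (A : set (R * R))
    (f : R * R -> V) : Prop :=
  exists U : set (R * R), [/\ open U, A `<=` U & forall n, Cn_on n U f].

Definition square (R : realType) (r : R) : set (R * R) :=
  [set u | 0 <= u.1 <= r /\ 0 <= u.2 <= r].

Definition is_Mnet (R : realType) (N : nat) (A : set (R * R))
    (q : R * R -> R) (f : R * R -> 'rV[R]_N) : Prop :=
  smooth_on A f /\
  forall u, A u -> partial1 (partial2 f) u = q u *: f u.

Definition Mnet_with_data (R : realType) (N : nat) (f1 f2 : R -> 'rV[R]_N)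
    (q : R * R -> R) (f : R * R -> 'rV[R]_N) : Prop :=
  [/\ is_Mnet setT q f,
      forall x, f (x, 0) = f1 x &
      forall y, f (0, y) = f2 y].

Definition is_Moutard_transform (R : realType) (N : nat) (A : set (R * R))
    (q : R * R -> R) (f : R * R -> 'rV[R]_N) (p1 p2 : R * R -> R)
    (fp : R * R -> 'rV[R]_N) : Prop :=
  [/\ exists qp : R * R -> R, is_Mnet A qp fp,
      smooth_on A p1 /\ smooth_on A p2,
      forall u, A u ->
        partial1 fp u + partial1 f u = p1 u *: (fp u - f u) /\
        partial2 fp u - partial2 f u = p2 u *: (fp u + f u) &
      forall u, A u ->
        partial1 p2 u = partial2 p1 u /\
        partial2 p1 u = - q u + p1 u * p2 u].

Definition Moutard_transform_with_data (R : realType) (N : nat) (r : R)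
    (q : R * R -> R) (f : R * R -> 'rV[R]_N)
    (fp0 : 'rV[R]_N) (p10 p20 : R -> R) (fp : R * R -> 'rV[R]_N) : Prop :=
  exists p1 p2 : R * R -> R,
    [/\ is_Moutard_transform (square r) q f p1 p2 fp,
        fp (0, 0) = fp0,
        forall x, square r (x, 0) -> p1 (x, 0) = p10 x &
        forall y, square r (0, y) -> p2 (0, y) = p20 y].

(* A function on (eps Z)^2 is encoded by its values at the integer indices
   (i, j), which stand for the lattice point (eps i, eps j). *)
Definition lpoint (R : realType) (eps : R) (u : int * int) : R * R :=
  (eps * u.1%:~R, eps * u.2%:~R).

Definition lsquare (R : realType) (eps r : R) : set (int * int) :=
  [set u | square r (lpoint eps u)].

Definition tau1 (T : Type) (g : int * int -> T) (u : int * int) : T :=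
  g (u.1 + 1, u.2).

Definition tau2 (T : Type) (g : int * int -> T) (u : int * int) : T :=
  g (u.1, u.2 + 1).

Definition delta1 (R : realType) (V : lmodType R) (eps : R)
    (g : int * int -> V) (u : int * int) : V :=
  eps^-1 *: (tau1 g u - g u).

Definition delta2 (R : realType) (V : lmodType R) (eps : R)
    (g : int * int -> V) (u : int * int) : V :=
  eps^-1 *: (tau2 g u - g u).

Definition edge1 (D : set (int * int)) : set (int * int) :=
  [set u | D u /\ D (u.1 + 1, u.2)].

Definition edge2 (D : set (int * int)) : set (int * int) :=
  [set u | D u /\ D (u.1, u.2 + 1)].

Definition face (D : set (int * int)) : set (int * int) :=
  [set u | [/\ D u, D (u.1 + 1, u.2), D (u.1, u.2 + 1)
             & D (u.1 + 1, u.2 + 1)]].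

Definition is_dMnet (R : realType) (N : nat) (D : set (int * int))
    (a : int * int -> R) (g : int * int -> 'rV[R]_N) : Prop :=
  forall u, face D u ->
    tau1 (tau2 g) u + g u = a u *: (tau1 g u + tau2 g u).

Definition canonical_a (R : realType) (eps : R) (q : R * R -> R)
    (u : int * int) : R :=
  1 + 2^-1 * eps ^+ 2 * q (lpoint eps u).

Definition canonical_dMnet (R : realType) (N : nat) (D : set (int * int))
    (eps : R) (f1 f2 : R -> 'rV[R]_N) (q : R * R -> R)
    (g : int * int -> 'rV[R]_N) : Prop :=
  [/\ is_dMnet D (canonical_a eps q) g,
      forall i : int, D (i, 0) -> g (i, 0) = f1 (eps * i%:~R) &
      forall j : int, D (0, j) -> g (0, j) = f2 (eps * j%:~R)].

(* Since x / 0 = 0 in the library, the denominators are explicitly required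
   to be nonzero. *)
Definition is_dMoutard_transform (R : realType) (N : nat)
    (D : set (int * int)) (a : int * int -> R) (g : int * int -> 'rV[R]_N)
    (b1 b2 : int * int -> R) (gp : int * int -> 'rV[R]_N) : Prop :=
  exists ap : int * int -> R,
  [/\ is_dMnet D ap gp,
      forall u, edge1 D u -> tau1 gp u - g u = b1 u *: (gp u - tau1 g u),
      forall u, edge2 D u -> tau2 gp u + g u = b2 u *: (gp u + tau2 g u) &
      forall u, face D u ->
        [/\ b1 u != 0, b2 u != 0, a u != 0
          & (b1 u + b2 u) * a u - b1 u * b2 u != 0] /\
        [/\ tau2 b1 u / b1 u = tau1 b2 u / b2 u,
            tau1 b2 u / b2 u = ap u / a u
          & ap u / a u = ((b1 u + b2 u) * a u - b1 u * b2 u)^-1]].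

Definition canonical_dMoutard_transform (R : realType) (N : nat)
    (D : set (int * int)) (eps : R) (q : R * R -> R)
    (g : int * int -> 'rV[R]_N) (fp0 : 'rV[R]_N) (p10 p20 : R -> R)
    (gp : int * int -> 'rV[R]_N) : Prop :=
  exists b1 b2 : int * int -> R,
    [/\ is_dMoutard_transform D (canonical_a eps q) g b1 b2 gp,
        gp (0, 0) = fp0,
        forall i : int, D (i, 0) -> b1 (i, 0) = 1 + eps * p10 (eps * i%:~R) &
        forall j : int, D (0, j) -> b2 (0, j) = 1 + eps * p20 (eps * j%:~R)].

(* The difference quotient delta^(m, n) at u involves exactly the points
   u + eps (k, l) with k <= m and l <= n; it is defined on the lattice square
   iff the two opposite corners u and u + eps (m, n) belong to it. *)
Definition Cinfty_converges_Oeps (R : realType) (N : nat) (r : R)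
    (geps : R -> int * int -> 'rV[R]_N) (g : R * R -> 'rV[R]_N) : Prop :=
  forall m n : nat, exists c : R,
    \forall eps \near (0 : R)^'+, forall u : int * int,
      lsquare eps r u -> lsquare eps r (u.1 + m%:Z, u.2 + n%:Z) ->
      `| iter m (delta1 eps) (iter n (delta2 eps)
           (fun v => geps eps v - g (lpoint eps v))) u | <= c * eps.

Definition quadrant : set (int * int) := [set u | 0 <= u.1 /\ 0 <= u.2].

(* Main.v *)
Require Import Defs.
From mathcomp Require Import all_boot all_order all_algebra.
From mathcomp Require Import all_classical all_reals all_analysis.
From mathcomp Require Import ring lra.

(** Writing [p_i = - d_i log th], the nonlinear system for [p1, p2] becomes the
    linear Goursat problem [d1 d2 th = q th] with [th] prescribed on the axes,
    and [h = th * f+] is the potential of a closed one-form that is bilinear in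
    [(th, f)]:
      [d1 h = (d1 th) f - th (d1 f)],  [d2 h = th (d2 f) - (d2 th) f].
    The same substitution [b_i = th / tau_i th] linearises the discrete
    transform, with exactly the same formulas for the difference quotients.
    Hence it suffices to compare solutions of linear Goursat problems and then
    to integrate; the transform exists as long as [th] does not vanish, which
    fixes [r].  Difference quotients of all orders are controlled by a discrete
    Gronwall estimate followed by repeated use of the equation. *)

Set Implicit Arguments.
Unset Strict Implicit.
Unset Printing Implicit Defensive.
Import Order.TTheory GRing.Theory Num.Theory.
Import numFieldNormedType.Exports.
Local Open Scope classical_set_scope.
Local Open Scope ring_scope.

(** * Primitives on the line *)

(** The substitution works on both levels because [th] and [f] solve the same equation. In the
    smooth case closedness of the one-form is the cancellation of the two terms in [q]; on the
    lattice the common coefficient [a] plays this part, and the equation of [th] turns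
    [(b1 + b2) a - b1 b2] into [th * tau1 tau2 th / (tau1 th * tau2 th)]. Uniqueness needs another
    device, since a competing pair [p1], [p2] is known only near the square and only through its
    equations: [w_i = th p_i + d_i th] satisfies [d2 w1 = p1 w2], [d1 w2 = p2 w1] and vanishes on
    the axes, hence everywhere. The radius comes from [th (0, 0) = 1]: on a box of size [r1] one has
    [th > 1 / 2], and [r = r1 / 2] is taken because the lattice estimates hold on squares strictly
    inside that box. The error of order eps has three sources: forward differences in place of
    derivatives, the mean over two neighbours in the discrete equation, and the one-step recursion
    for [th] on the axes. The axis values of [f] are exact. *)

Section MeanValue.
Variable R : realType.
Implicit Types (G g : R -> R) (a b x : R).

Lemma derive_ge0_le G g a b : a <= b ->
  (forall t, a <= t <= b -> is_derive t 1 G (g t)) ->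
  (forall t, a <= t <= b -> 0 <= g t) -> G a <= G b.
Proof.
move=> ab dG g0.
have [||c cab E] := @MVT_segment R G g a b ab.
- by move=> x; rewrite in_itv/= => /andP[/ltW ax /ltW xb]; apply: dG; rewrite ax.
- apply: derivable_within_continuous => x; rewrite in_itv/= => xab.
  by case: (dG x xab).
- rewrite -subr_ge0 E mulr_ge0 ?subr_ge0//; apply: g0.
  by move: cab; rewrite in_itv.
Qed.

(** Monotonicity of [h - G] and [h + G] gives a mean value inequality with a variable majorant [dh].
    Exponential majorants are what the weighted estimates below require. *)
Lemma derive_norm_le G g (h dh : R -> R) a b : a <= b ->
  (forall t, a <= t <= b -> is_derive t 1 G (g t)) ->
  (forall t, a <= t <= b -> is_derive t 1 h (dh t)) ->
  (forall t, a <= t <= b -> `|g t| <= dh t) -> `|G b - G a| <= h b - h a.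
Proof.
move=> ab dG dh' gh.
have H1 : (h - G) a <= (h - G) b.
  apply: (@derive_ge0_le _ (dh \- g)) => // t tab.
    by have ? := dG t tab; have ? := dh' t tab; exact: is_deriveB.
  by rewrite subr_ge0; apply: le_trans (gh t tab); exact: ler_norm.
have H2 : (h + G) a <= (h + G) b.
  apply: (@derive_ge0_le _ (dh \+ g)) => // t tab.
    by have ? := dG t tab; have ? := dh' t tab; exact: is_deriveD.
  have := gh t tab; rewrite ler_norml => /andP[]; rewrite /=; lra.
rewrite ler_norml.
have {}H1 : h a - G a <= h b - G b := H1.
have {}H2 : h a + G a <= h b + G b := H2.
by apply/andP; split; lra.
Qed.

Lemma is_derive_idM (K x : R) : is_derive x 1 (fun t : R => K * t) K.
Proof. by apply: is_derive_eq; rewrite /GRing.scale/= mulr1. Qed.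

Lemma derive_norm_leM G g K a b : a <= b ->
  (forall t, a <= t <= b -> is_derive t 1 G (g t)) ->
  (forall t, a <= t <= b -> `|g t| <= K) -> `|G b - G a| <= K * (b - a).
Proof.
move=> ab dG gK; rewrite mulrBr.
by apply: (@derive_norm_le _ g (fun t => K * t) (cst K)) => // t _; exact: is_derive_idM.
Qed.

Lemma derive0_eq G a b : a <= b ->
  (forall t, a <= t <= b -> is_derive t 1 G 0) -> G b = G a.
Proof.
move=> ab dG; apply/eqP; rewrite -subr_eq0 -normr_le0.
by rewrite -(mul0r (b - a)); apply: (derive_norm_leM ab dG) => t _; rewrite normr0.
Qed.

Lemma derive_unique G1 G2 g a : G1 a = G2 a ->
  (forall x, is_derive x 1 G1 (g x)) -> (forall x, is_derive x 1 G2 (g x)) ->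
  G1 =1 G2.
Proof.
move=> E d1 d2 x.
have dd (t : R) : is_derive t 1 (G1 - G2) (0 : R).
  by have ? := d1 t; have ? := d2 t; apply: is_derive_eq; rewrite subrr.
have /eqP : (G1 - G2) x = (G1 - G2) a.
  by have [ax|/ltW xa] := leP a x; [|symmetry]; apply: derive0_eq.
by rewrite fctE /= fctE E subrr subr_eq0 => /eqP.
Qed.

(* The interval of integration starts to the left of both 0 and x, so that a
   single application of the fundamental theorem covers negative arguments. *)
Definition prim_from (M : R) g x :=
  (\int[lebesgue_measure]_(t in `[M, x]) g t)%R.

Definition prim g x : R :=
  prim_from (- `|x| - 1) g x - prim_from (- `|x| - 1) g 0.

Lemma is_derive_prim_from M g x : continuous g -> M < x ->
  is_derive x 1 (prim_from M g) (g x).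
Proof.
move=> cg Mx.
have [] := @continuous_FTC1_closed R g M x (x + 1) _ _ _ (cg x).
- by rewrite ltrDl.
- apply: continuous_compact_integrable; first exact: segment_compact.
  exact: continuous_subspaceT.
- exact: Mx.
by move=> d e; apply: DeriveDef; [exact: d|rewrite -derive1E; exact: e].
Qed.

Lemma prim0 g : prim g 0 = 0.
Proof. by rewrite /prim subrr. Qed.

(** The base point in [prim] moves with [x]; freezing it makes [prim g] locally an integral from a
    fixed point minus a constant, which can be differentiated. Two integrals with different base
    points have the same derivative, so they differ by a constant. *)
Lemma prim_fromE M g x : continuous g -> M < - `|x| ->
  prim g x = prim_from M g x - prim_from M g 0.
Proof.
move=> cg Mx; rewrite /prim.
set M' := - `|x| - 1.
have H a b : a <= b -> M < a -> M' < a ->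
    prim_from M' g a - prim_from M g a = prim_from M' g b - prim_from M g b.
  move=> ab Ma Ma'; symmetry.
  apply: (@derive0_eq (prim_from M' g - prim_from M g)) => // t /andP[at_ tb].
  have ? : is_derive t 1 (prim_from M' g) (g t).
    by apply: is_derive_prim_from => //; exact: lt_le_trans at_.
  have ? : is_derive t 1 (prim_from M g) (g t).
    by apply: is_derive_prim_from => //; exact: lt_le_trans at_.
  by apply: is_derive_eq; rewrite subrr.
have x1 : - `|x| <= x by rewrite lerNl -normrN ler_norm.
have x2 : - `|x| <= 0 by rewrite oppr_le0.
have x3 : M' < - `|x| by rewrite /M' ltrBlDr ltrDl.
by have := H _ _ x1 Mx x3; have := H _ _ x2 Mx x3; lra.
Qed.

Lemma is_derive_prim g x : continuous g -> is_derive x 1 (prim g) (g x).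
Proof.
move=> cg; pose M := - `|x| - 1.
have Mx : M < x by rewrite /M; have := ler_norm (- x); rewrite normrN; lra.
have ? := is_derive_prim_from cg Mx.
have d : is_derive x 1 (prim_from M g - cst (prim_from M g 0)) (g x).
  by apply: is_derive_eq; rewrite subr0.
apply: near_eq_is_derive d.
have : \forall t \near x, `|t| < - M.
  apply: (@cvgr_norm_lt _ _ _ (nbhs x) _ id x); first exact: cvg_id.
  by rewrite /M opprD !opprK ltrDl.
apply: filterS => t tM /=; rewrite (@prim_fromE M)//; by rewrite ltrNr.
Qed.

Lemma prim_uniq G g : continuous g -> G 0 = 0 ->
  (forall x, is_derive x 1 G (g x)) -> G =1 prim g.
Proof.
move=> cg G0 dG; apply: (@derive_unique _ _ g 0) => //; first by rewrite prim0.
by move=> x; exact: is_derive_prim.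
Qed.

Lemma prim_fromB g x y : continuous g -> x <= y ->
  forall K, (forall t, x <= t <= y -> `|g t| <= K) ->
  `|prim g y - prim g x| <= K * (y - x).
Proof.
move=> cg xy K gK; apply: derive_norm_leM gK => // t _; exact: is_derive_prim.
Qed.

Lemma norm_prim_le g x K : continuous g ->
  (forall t, `|t| <= `|x| -> `|g t| <= K) -> `|prim g x| <= K * `|x|.
Proof.
move=> cg gK; have [x0|x0] := leP 0 x.
  have := @prim_fromB g 0 x cg x0 K; rewrite prim0 !subr0 (ger0_norm x0); apply.
  by move=> t /andP[t0 tx]; apply: gK; rewrite !ger0_norm.
have := @prim_fromB g x 0 cg (ltW x0) K; rewrite prim0 !sub0r normrN (ltr0_norm x0).
by apply=> t /andP[t0 tx]; apply: gK; rewrite (ltr0_norm x0) ler0_norm// lerN2.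
Qed.

Lemma primD g h x : continuous g -> continuous h ->
  prim (fun t => g t + h t) x = prim g x + prim h x.
Proof.
move=> cg ch; symmetry.
apply: (@prim_uniq (fun x => prim g x + prim h x)) => [t|| t].
- by apply: cvgD; [exact: cg|exact: ch].
- by rewrite !prim0 addr0.
- have ? := @is_derive_prim g t cg; have ? := @is_derive_prim h t ch.
  exact: is_deriveD.
Qed.

Lemma primB g h x : continuous g -> continuous h ->
  prim (fun t => g t - h t) x = prim g x - prim h x.
Proof.
move=> cg ch; symmetry.
apply: (@prim_uniq (fun x => prim g x - prim h x)) => [t|| t].
- by apply: cvgB; [exact: cg|exact: ch].
- by rewrite !prim0 subr0.
- have ? := @is_derive_prim g t cg; have ? := @is_derive_prim h t ch.
  exact: is_deriveB.
Qed.

Lemma is_derive_expM (K x : R) :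
  is_derive x 1 (fun t : R => expR (K * t)) (K * expR (K * x)).
Proof.
have ? := is_derive_idM K x.
by apply: is_derive_eq; rewrite mulrC.
Qed.

(** Integrating [expR (L * t)] gains a factor [1 / L]. This is the mechanism by which integral
    operators become contractions on boxes of any size. *)
Lemma exp_weight_le G g (K L : R) a b : a <= b -> 0 <= K -> 0 < L ->
  (forall t, a <= t <= b -> is_derive t 1 G (g t)) ->
  (forall t, a <= t <= b -> `|g t| <= K * expR (L * t)) ->
  `|G b - G a| <= K / L * expR (L * b).
Proof.
move=> ab K0 L0 dG gK.
have := @derive_norm_le G g (fun t => K / L * expR (L * t)) (fun t => K * expR (L * t)) a b ab dG _ gK.
move=> /(_ _)/le_trans; apply; last first.
  by rewrite lerBlDr lerDl mulr_ge0 ?expR_ge0// divr_ge0// ltW.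
move=> t _; have ? := is_derive_expM L t.
apply: is_derive_eq; rewrite /GRing.scale/=.
by field; rewrite gt_eqF.
Qed.

Lemma prim_exp_le g (K L x : R) : continuous g -> 0 <= K -> 0 < L ->
  (forall t, `|t| <= `|x| -> `|g t| <= K * expR (L * `|t|)) ->
  `|prim g x| <= K / L * expR (L * `|x|).
Proof.
move=> cg K0 L0 gK; have [x0|x0] := leP 0 x.
  have -> : prim g x = prim g x - prim g 0 by rewrite prim0 subr0.
  rewrite (ger0_norm x0); apply: (@exp_weight_le _ g) => //.
    by move=> t _; exact: is_derive_prim.
  move=> t /andP[t0 tx]; by have := gK t; rewrite (ger0_norm t0) (ger0_norm x0); apply.
(* Negative arguments are reflected: [prim g (- t)] is estimated for [t] between [0] and [- x]. *)
have -> : prim g x = prim g (- - x) - prim g (- 0).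
  by rewrite opprK oppr0 prim0 subr0.
rewrite (ltr0_norm x0).
apply: (@exp_weight_le (fun t => prim g (- t)) (fun t => - g (- t))) => //.
- by rewrite oppr_ge0 ltW.
- move=> t _; have ? := @is_derive_prim g (- t) cg.
  by apply: is_derive_eq; rewrite ?mulrN1 ?mulN1r ?mulr1 ?scaleN1r.
- move=> t /andP[t0 tx]; rewrite normrN.
  by have := gK (- t); rewrite normrN (ger0_norm t0) (ltr0_norm x0); apply.
Qed.

End MeanValue.

(** * Partial primitives in the plane *)

Section Plane.
Variable R : realType.
Implicit Types (F G : R * R -> R) (x y t : R) (u : R * R).

(** Differentiability as a first-order expansion, the form in which remainders under an integral
    sign can be estimated without dividing by [h]. *)
Lemma is_derive_estimate (f : R -> R) (x d : R) :
  (forall e : R, 0 < e ->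
    \forall h \near (0 : R), `|f (x + h) - f x - h * d| <= e * `|h|) ->
  is_derive x 1 f d.
Proof.
move=> H.
have c : h^-1 *: (f (h *: (1 : R) + x) - f x) @[h --> (0 : R)^'] --> d.
  apply/cvgrPdist_le => /= e e0.
  have := H e e0; rewrite /nbhs/= /within /=; apply: filterS => h hE h0.
  have -> : d - h^-1 *: (f (h *: (1 : R) + x) - f x) =
      - (h^-1 * (f (x + h) - f x - h * d)).
    by rewrite /GRing.scale/= mulr1 (addrC h x); field.
  rewrite normrN normrM normfV mulrC ler_pdivrMr ?normr_gt0//.
apply: DeriveDef; first by apply: cvgP c.
exact: cvg_lim c.
Qed.

Lemma continuous_slice1 (V : topologicalType) (F : R * R -> V) y :
  continuous F -> continuous (fun s => F (s, y)).
Proof.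
move=> cF s; apply: (@continuous_comp _ _ _ (fun s : R => (s, y)) F); last exact: cF.
by apply: (@cvg_pair _ _ _ _ (nbhs s) (nbhs y)); [exact: cvg_id|exact: cvg_cst].
Qed.

Lemma continuous_slice2 (V : topologicalType) (F : R * R -> V) x :
  continuous F -> continuous (fun t => F (x, t)).
Proof.
move=> cF s; apply: (@continuous_comp _ _ _ (fun s : R => (x, s)) F); last exact: cF.
by apply: (@cvg_pair _ _ _ _ (nbhs x) (nbhs s)); [exact: cvg_cst|exact: cvg_id].
Qed.

Definition flip u : R * R := (u.2, u.1).

Lemma flip_continuous : continuous flip.
Proof.
exact: swap_continuous.
Qed.

Lemma continuous_flip F : continuous F -> continuous (F \o flip).
Proof.
by move=> cF u; apply: continuous_comp; [exact: flip_continuous|exact: cF].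
Qed.

Lemma box_bounded F (B : R) : continuous F ->
  exists2 K, 0 <= K & forall x y, `|x| <= B -> `|y| <= B -> `|F (x, y)| <= K.
Proof.
move=> cF.
have [B0|B0] := ltP B 0.
  by exists 0 => // x y xB; have := normr_ge0 x; lra.
pose A : set (R * R) := `[- B, B] `*` `[- B, B].
have cA : compact A by apply: compact_setX; exact: segment_compact.
have [||c _ cmax] := @compact_EVT_max _ R (fun u => `|F u|) A _ cA _.
- by exists (0, 0); split => /=; rewrite in_itv/=; apply/andP; split; lra.
- apply: continuous_subspaceT => u.
  by apply: (@continuous_comp _ _ _ F (fun z : R => `|z|)); [exact: cF|exact: norm_continuous].
exists `|F c| => // x y xB yB; apply: cmax; apply/mem_set.
by split => /=; rewrite in_itv/= -ler_norml.
Qed.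

(** Tube lemma: continuity in [y] is uniform over the compact segment of all [s], because the
    near-covering form of compactness glues the local neighbourhoods. It stands in for uniform
    continuity whenever a limit is taken under the integral. *)
Lemma slice_near F (B y0 e : R) : continuous F -> 0 < e ->
  \forall y \near y0, forall s, `|s| <= B -> `|F (s, y) - F (s, y0)| < e.
Proof.
move=> cF e0.
pose P := fun (y s : R) => `|F (s, y) - F (s, y0)| < e.
have H : \forall y \near y0, `[- B, B] `<=` P y.
  have nc := (@compact_near_coveringP _ _).1 (@segment_compact R (- B) B) R (nbhs y0) P (nbhs_filter y0).
  apply: nc => s _.
  have e2 : 0 < e / 2 by rewrite divr_gt0.
  have /cvgr_dist_lt /(_ _ e2) h1 := cF (s, y0).
  have /cvgr_dist_lt /(_ _ e2) h2 := continuous_slice1 cF (y := y0) (x := s).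
  have h2' : \forall z \near (s, y0), `|F (s, y0) - F (z.1, y0)| < e / 2.
    exists ([set x | `|F (s, y0) - F (x, y0)| < e / 2], setT) => /=.
      by split => //; exact: filterT.
    by move=> -[a b] [].
  have h : \forall z \near (s, y0), P z.2 z.1.
    apply: filterS2 h1 h2' => -[a b]/= k1 k2; rewrite /P.
    have -> : F (a, b) - F (a, y0) = (F (s, y0) - F (a, y0)) - (F (s, y0) - F (a, b)) by ring.
    by rewrite (le_lt_trans (ler_normB _ _))//; lra.
  case: h => -[X Y]/= [nX nY] XY.
  by exists (X, Y) => // -[a b] [Xa Yb]; exact: (XY (a, b)).
apply: filterS H => y yP s sB; apply: yP.
by rewrite /= in_itv/= -ler_norml.
Qed.

Definition I1 F u : R := prim (fun s => F (s, u.2)) u.1.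
Definition I2 F u : R := prim (fun t => F (u.1, t)) u.2.

Lemma is_derive_I1 F u : continuous F ->
  is_derive u.1 1 (fun s => I1 F (s, u.2)) (F u).
Proof.
move=> cF; rewrite [u in F u]surjective_pairing.
by apply: (@is_derive_prim _ (fun s => F (s, u.2))); apply: continuous_slice1.
Qed.

Lemma I1_continuous F : continuous F -> continuous (I1 F).
Proof.
move=> cF -[x0 y0]; apply/cvgrPdist_lt => /= e e0.
have [K K0 FK] := box_bounded (`|x0| + `|y0| + 1) cF.
(* [e1] controls the change of the slice, integrated over a length [|x0|]; [d] controls the moved
   end point, near which [F] is bounded by [K]. Each contributes at most [e / 2], and adding [1]
   keeps the denominators positive. *)
pose e1 := e / 2 / (`|x0| + 1).
have p1 : 0 < `|x0| + 1 by rewrite ltr_wpDl.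
have e1p : 0 < e1 by rewrite !divr_gt0.
have K1 : 0 < K + 1 by rewrite ltr_wpDl.
pose d := Num.min 1 (e / 2 / (K + 1)).
have dp : 0 < d by rewrite /d lt_min ltr01 !divr_gt0.
have hy := slice_near `|x0| y0 cF e1p.
have hy1 : \forall y \near y0, `|y0 - y| < 1.
  by apply: (@cvgr_dist_lt _ _ _ (nbhs y0) _ id y0) => //; exact: cvg_id.
have hx : \forall x \near x0, `|x0 - x| < d.
  by apply: (@cvgr_dist_lt _ _ _ (nbhs x0) _ id x0) => //; exact: cvg_id.
have : \forall z \near (x0, y0), `|x0 - z.1| < d /\
   (`|y0 - z.2| < 1 /\ forall s, `|s| <= `|x0| -> `|F (s, z.2) - F (s, y0)| < e1).
  exists ([set x | `|x0 - x| < d], [set y | `|y0 - y| < 1 /\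
     forall s, `|s| <= `|x0| -> `|F (s, y) - F (s, y0)| < e1]) => //=.
    by split => //; apply: filterI.
apply: filterS => -[x y]/= [xd [y1 hs]].
have cs z : continuous (fun s => F (s, z)) by exact: continuous_slice1.
have -> : I1 F (x0, y0) - I1 F (x, y) =
   - (prim (fun s => F (s, y)) x - prim (fun s => F (s, y)) x0)
   - (prim (fun s => F (s, y) - F (s, y0)) x0).
  by rewrite primB// /I1 /=; ring.
apply: le_lt_trans (ler_normB _ _) _; rewrite normrN.
have [xd1 xd2] : `|x0 - x| < 1 /\ `|x0 - x| < e / 2 / (K + 1).
  by move: xd; rewrite lt_min => /andP.
have ax0 := normr_ge0 x0; have ay0 := normr_ge0 y0.
have yB : `|y| <= `|x0| + `|y0| + 1.
  have -> : y = y0 - (y0 - y) by ring.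
  by apply: le_trans (ler_normB _ _) _; lra.
have A : `|prim (fun s => F (s, y)) x - prim (fun s => F (s, y)) x0| <= K * `|x0 - x|.
  have hK t : `|t - x0| <= `|x0 - x| -> `|F (t, y)| <= K.
    move=> tx; apply: FK => //.
    have -> : t = x0 + (t - x0) by ring.
    by apply: le_trans (ler_normD _ _) _; lra.
  have [xx|/ltW xx] := leP x x0.
    rewrite (ger0_norm (_ : 0 <= x0 - x)) ?subr_ge0// distrC.
    apply: prim_fromB => // t /andP[t1 t2]; apply: hK.
    by rewrite distrC !ger0_norm ?subr_ge0// lerD2l lerN2.
  rewrite (distrC x0) (ger0_norm (_ : 0 <= x - x0)) ?subr_ge0//.
  apply: prim_fromB => // t /andP[t1 t2]; apply: hK.
  by rewrite (distrC x0) !ger0_norm ?subr_ge0// lerD2r.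
have A2 : `|prim (fun s => F (s, y) - F (s, y0)) x0| <= e1 * `|x0|.
  apply: norm_prim_le; last by move=> t /hs/ltW.
  by move=> s; apply: cvgB; exact: cs.
have A1 : K * `|x0 - x| <= e / 2 / (K + 1) * K.
  by rewrite mulrC ler_wpM2r// ltW.
have A3 : e / 2 / (K + 1) * K <= e / 2.
  rewrite -mulrA ger_pMr ?divr_gt0// mulrC ler_pdivrMr// mul1r lerDl//.
have A4 : e1 * `|x0| < e / 2.
  by rewrite /e1 -mulrA gtr_pMr ?divr_gt0// mulrC ltr_pdivrMr// mul1r ltrDl.
lra.
Qed.

(** Differentiation under the integral sign. For each [s] the mean value inequality, applied to
    [F (s, t) - t * G (s, y)] in the variable [t], bounds the first-order remainder by [|h|] times
    the oscillation of [G (s, t)] for [t] within [|h|] of [y]; by [slice_near] this oscillation is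
    small uniformly in [s]. *)
Lemma is_derive_I1_2 F G u : continuous F -> continuous G ->
  (forall u, is_derive u.2 1 (fun t => F (u.1, t)) (G u)) ->
  is_derive u.2 1 (fun t => I1 F (u.1, t)) (I1 G u).
Proof.
case: u => x y cF cG dF /=; apply: is_derive_estimate => e e0.
have p1 : 0 < `|x| + 1 by rewrite ltr_wpDl.
have e1p : 0 < e / (`|x| + 1) by rewrite divr_gt0.
have := slice_near `|x| y cG e1p.
move=> /nbhs_ballP[d /= d0 hd]; apply/nbhs_ballP; exists d => //= h.
rewrite /ball/= sub0r normrN => hh.
have cs H z : continuous H -> continuous (fun s => (H : R * R -> R) (s, z)).
  by move=> ?; exact: continuous_slice1.
have cB : continuous (fun s => F (s, y + h) - F (s, y)).
  by move=> s; apply: cvgB; exact: cs.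
have chG : continuous (fun s => h * G (s, y)).
  by move=> s; apply: cvgM; [exact: cvg_cst|exact: cs].
have hE : h * I1 G (x, y) = prim (fun s => h * G (s, y)) x.
  apply: (@prim_uniq _ (fun x => h * I1 G (x, y))) => //.
    by rewrite /I1/= prim0 mulr0.
  move=> t; have ? := @is_derive_I1 G (t, y) cG.
  by apply: is_derive_eq.
have -> : I1 F (x, y + h) - I1 F (x, y) - h * I1 G (x, y) =
   prim (fun s => (F (s, y + h) - F (s, y)) - h * G (s, y)) x.
  by rewrite primB// primB ?hE//; exact: cs.
have := @norm_prim_le _ (fun s => (F (s, y + h) - F (s, y)) - h * G (s, y)) x
  (e / (`|x| + 1) * `|h|) _ _.
move=> /(_ _ _)/le_trans; apply.
- by move=> s; apply: cvgB; [exact: cB|exact: chG].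
- move=> s sx.
  have dd t : is_derive t 1 (fun t => F (s, t) - t * G (s, y)) (G (s, t) - G (s, y)).
    have ? := dF (s, t); apply: is_derive_eq => /=.
    by rewrite /GRing.scale/= mulr1 mulr0 add0r.
  have gb t : `|t - y| <= `|h| -> `|G (s, t) - G (s, y)| <= e / (`|x| + 1).
    move=> th; apply/ltW/hd => //.
    by rewrite /ball/= distrC; exact: le_lt_trans hh.
  have [h0|/ltW h0] := leP 0 h.
    have := @derive_norm_leM _ (fun t => F (s, t) - t * G (s, y)) _ (e / (`|x| + 1)) y (y + h) _ (fun t _ => dd t) _.
    have -> : y + h - y = h by ring.
    rewrite (ger0_norm h0).
    have -> : F (s, y + h) - (y + h) * G (s, y) - (F (s, y) - y * G (s, y)) =
       F (s, y + h) - F (s, y) - h * G (s, y) by ring.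
    apply; first by rewrite lerDl.
    move=> t /andP[t1 t2]; apply: gb; rewrite !ger0_norm ?subr_ge0//.
    by rewrite lerBlDl.
  have := @derive_norm_leM _ (fun t => F (s, t) - t * G (s, y)) _ (e / (`|x| + 1)) (y + h) y _ (fun t _ => dd t) _.
  have -> : y - (y + h) = - h by ring.
  rewrite (ler0_norm h0) distrC.
  have -> : F (s, y + h) - (y + h) * G (s, y) - (F (s, y) - y * G (s, y)) =
       F (s, y + h) - F (s, y) - h * G (s, y) by ring.
  apply; first by rewrite gerDl.
  move=> t /andP[t1 t2]; apply: gb; rewrite distrC ger0_norm ?subr_ge0// ler0_norm//.
  by move: t1; lra.
- rewrite mulrAC ler_wpM2r// -mulrA ger_pMr// mulrC ler_pdivrMr// mul1r lerDl//.
Qed.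

(** Exchanging the coordinates carries each result on [I1] over to [I2]. *)
Lemma I2E F : I2 F = I1 (F \o flip) \o flip.
Proof. by []. Qed.

Lemma I2_continuous F : continuous F -> continuous (I2 F).
Proof.
by move=> cF; rewrite I2E; apply: continuous_flip; apply: I1_continuous; exact: continuous_flip.
Qed.

Lemma is_derive_I2 F u : continuous F ->
  is_derive u.2 1 (fun t => I2 F (u.1, t)) (F u).
Proof.
move=> cF; rewrite [u in F u]surjective_pairing.
by apply: (@is_derive_prim _ (fun t => F (u.1, t))); apply: continuous_slice2.
Qed.

Lemma is_derive_I2_1 F G u : continuous F -> continuous G ->
  (forall u, is_derive u.1 1 (fun s => F (s, u.2)) (G u)) ->
  is_derive u.1 1 (fun s => I2 F (s, u.2)) (I2 G u).
Proof.
move=> cF cG dF.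
apply: (@is_derive_I1_2 (F \o flip) (G \o flip) (flip u)) => [||v].
- exact: continuous_flip.
- exact: continuous_flip.
- exact: (dF (flip v)).
Qed.

End Plane.

(** * Functions of class C^n *)

Section Smooth.
Variable R : realType.
Implicit Types (u : R * R) (U : set (R * R)) (n : nat).

Lemma derivable_is_derive (V : normedModType R) (f : R -> V) (x : R) :
  derivable f x 1 -> is_derive x 1 f (derive1 f x).
Proof. by move=> d; apply: DeriveDef => //; rewrite derive1E. Qed.

Lemma is_derive_derive1 (V : normedModType R) (f : R -> V) (x : R) d :
  is_derive x 1 f d -> derive1 f x = d.
Proof. by move=> [_ <-]; rewrite derive1E. Qed.

Lemma derivable_continuous (V : normedModType R) (f : R -> V) (x : R) :
  derivable f x 1 -> {for x, continuous f}.
Proof. by move=> /derivable1_diffP /differentiable_continuous. Qed.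

Lemma open_slice1 U u : open U -> U u -> \forall s \near u.1, U (s, u.2).
Proof.
move=> oU Uu; have [[X Y] [nX nY] XY] := open_nbhs_nbhs (conj oU Uu).
by apply: filterS nX => s Xs; apply: XY; split => //=; exact: nbhs_singleton.
Qed.

Lemma open_slice2 U u : open U -> U u -> \forall t \near u.2, U (u.1, t).
Proof.
move=> oU Uu; have [[X Y] [nX nY] XY] := open_nbhs_nbhs (conj oU Uu).
by apply: filterS nY => s Xs; apply: XY; split => //=; exact: nbhs_singleton.
Qed.

Section Vector.
Variable V : normedModType R.
Implicit Types F G : R * R -> V.

Lemma Cn_on_continuous n U F : Cn_on n U F -> forall u, U u -> {for u, continuous F}.
Proof. by case: n => [|n] []. Qed.

Lemma Cn_on_partial1 n U F u : Cn_on n.+1 U F -> U u ->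
  is_derive u.1 1 (fun s => F (s, u.2)) (partial1 F u).
Proof. by move=> [_ [d _ _]] /d[d1 _]; exact: derivable_is_derive. Qed.

Lemma Cn_on_partial2 n U F u : Cn_on n.+1 U F -> U u ->
  is_derive u.2 1 (fun t => F (u.1, t)) (partial2 F u).
Proof. by move=> [_ [d _ _]] /d[_ d1]; exact: derivable_is_derive. Qed.

Lemma Cn_on_eq n U F G : open U -> (forall u, U u -> F u = G u) ->
  Cn_on n U F -> Cn_on n U G.
Proof.
move=> oU; elim: n F G => [|n IH] F G FG [cF dF];
  have cG u (Uu : U u) : {for u, continuous G}.
- by rewrite /prop_for/continuous_at -FG//; apply: cvg_trans (cF u Uu);
    apply: near_eq_cvg; apply: filterS (open_nbhs_nbhs (conj oU Uu)) => v /FG.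
- by split.
- by rewrite /prop_for/continuous_at -FG//; apply: cvg_trans (cF u Uu);
    apply: near_eq_cvg; apply: filterS (open_nbhs_nbhs (conj oU Uu)) => v /FG.
have h1 u : U u -> is_derive u.1 1 (fun s => G (s, u.2)) (partial1 F u).
  move=> Uu; apply: near_eq_is_derive (Cn_on_partial1 (conj cF dF) Uu).
  by apply: filterS (open_slice1 oU Uu) => s /FG.
have h2 u : U u -> is_derive u.2 1 (fun t => G (u.1, t)) (partial2 F u).
  move=> Uu; apply: near_eq_is_derive (Cn_on_partial2 (conj cF dF) Uu).
  by apply: filterS (open_slice2 oU Uu) => s /FG.
case: dF => _ d1 d2.
split=> //; split.
- by move=> u Uu; have [? _] := h1 u Uu; have [? _] := h2 u Uu.
- by apply: IH d1 => u /h1 /is_derive_derive1 <-.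
- by apply: IH d2 => u /h2 /is_derive_derive1 <-.
Qed.

(** Introduction rule for regularity: the partial derivatives may be supplied by any functions [F1],
    [F2] that represent them on [U], whereas the definition insists on [partial1 F] and
    [partial2 F]. *)
Lemma Cn_on_S n U F F1 F2 : open U ->
  (forall u, U u -> {for u, continuous F}) ->
  (forall u, U u -> is_derive u.1 1 (fun s => F (s, u.2)) (F1 u)) ->
  (forall u, U u -> is_derive u.2 1 (fun t => F (u.1, t)) (F2 u)) ->
  Cn_on n U F1 -> Cn_on n U F2 -> Cn_on n.+1 U F.
Proof.
move=> oU cF h1 h2 C1 C2; split=> //; split.
- by move=> u Uu; have [? _] := h1 u Uu; have [? _] := h2 u Uu.
- by apply: Cn_on_eq C1 => // u /h1 /is_derive_derive1 <-.
- by apply: Cn_on_eq C2 => // u /h2 /is_derive_derive1 <-.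
Qed.

Lemma Cn_on_pred n U F : Cn_on n.+1 U F -> Cn_on n U F.
Proof.
elim: n F => [|n IH] F [cF [d C1 C2]]; first by split.
exact: (conj cF (And3 d (IH _ C1) (IH _ C2))).
Qed.

Lemma Cn_on_sub n U W F : W `<=` U -> Cn_on n U F -> Cn_on n W F.
Proof.
move=> WU; elim: n F => [|n IH] F [cF dF]; split => [u /WU|] //; [exact: cF|exact: cF|].
- case: dF => d d1 d2; split; [by move=> u /WU /d| exact: IH| exact: IH].
Qed.

Lemma Cn_on_cst n U (c : V) : open U -> Cn_on n U (cst c).
Proof.
move=> oU; elim: n c => [|n IH] c; first by split=> // u _; exact: cvg_cst.
apply: (Cn_on_S oU _ _ _ (IH 0) (IH 0)) => [u _|u _|u _].
- exact: cvg_cst.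
- exact: is_derive_cst.
- exact: is_derive_cst.
Qed.

Lemma Cn_onD n U F G : open U -> Cn_on n U F -> Cn_on n U G ->
  Cn_on n U (fun u => F u + G u).
Proof.
move=> oU; elim: n F G => [|n IH] F G CF CG.
  split=> // u Uu; apply: cvgD; [exact: CF.1| exact: CG.1].
have [cF [_ F1 F2]] := CF; have [cG [_ G1 G2]] := CG.
apply: (Cn_on_S oU _ _ _ (IH _ _ F1 G1) (IH _ _ F2 G2)) => u Uu.
- apply: cvgD; [exact: cF| exact: cG].
- have ? := Cn_on_partial1 CF Uu; have ? := Cn_on_partial1 CG Uu.
  exact: is_deriveD.
- have ? := Cn_on_partial2 CF Uu; have ? := Cn_on_partial2 CG Uu.
  exact: is_deriveD.
Qed.

End Vector.

Implicit Types F G : R * R -> R.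

Lemma Cn_onM n U F G : open U -> Cn_on n U F -> Cn_on n U G ->
  Cn_on n U (fun u => F u * G u).
Proof.
move=> oU; elim: n F G => [|n IH] F G CF CG.
  split=> // u Uu; apply: cvgM; [exact: CF.1| exact: CG.1].
have [cF [_ F1 F2]] := CF; have [cG [_ G1 G2]] := CG.
have /IH FF := Cn_on_pred CF; have /IH GG := Cn_on_pred CG.
apply: (Cn_on_S oU _ _ _ (Cn_onD oU (FF _ G1) (GG _ F1)) (Cn_onD oU (FF _ G2) (GG _ F2))) => u Uu.
- apply: cvgM; [exact: cF| exact: cG].
- have ? := Cn_on_partial1 CF Uu; have ? := Cn_on_partial1 CG Uu.
  by apply: is_derive_eq; rewrite /GRing.scale/= -surjective_pairing.
- have ? := Cn_on_partial2 CF Uu; have ? := Cn_on_partial2 CG Uu.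
  by apply: is_derive_eq; rewrite /GRing.scale/= -surjective_pairing.
Qed.

Lemma Cn_onN n U F : open U -> Cn_on n U F -> Cn_on n U (fun u => - F u).
Proof.
move=> oU CF; apply: Cn_on_eq (Cn_onM oU (Cn_on_cst n (-1 : R) oU) CF) => // u _.
by rewrite /= mulN1r.
Qed.

Lemma Cn_onB n U F G : open U -> Cn_on n U F -> Cn_on n U G ->
  Cn_on n U (fun u => F u - G u).
Proof. by move=> oU CF CG; apply: Cn_onD => //; exact: Cn_onN. Qed.

(** The derivative of [1 / F] is [- (1 / F) ^ 2 * F'], so the induction feeds on the lower
    regularity of [1 / F] itself. *)
Lemma Cn_onV n U F : open U -> (forall u, U u -> F u != 0) ->
  Cn_on n U F -> Cn_on n U (fun u => (F u)^-1).
Proof.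
move=> oU F0; elim: n F F0 => [|n IH] F F0 CF.
  by split=> // u Uu; apply: cvgV; [exact: F0|exact: CF.1].
have [cF [_ F1 F2]] := CF.
have /IH := Cn_on_pred CF => /(_ F0) FV.
have D H : Cn_on n U H -> Cn_on n U (fun u => - ((F u)^-1 * (F u)^-1) * H u).
  by move=> ?; apply: Cn_onM => //; apply: Cn_onN => //; apply: Cn_onM.
apply: (Cn_on_S oU _ _ _ (D _ F1) (D _ F2)) => u Uu.
- by apply: cvgV; [exact: F0|exact: cF].
- have F0' : F (u.1, u.2) != 0 by rewrite -surjective_pairing F0.
  have := @is_deriveV R (fun s => F (s, u.2)) _ _ _ F0' (Cn_on_partial1 CF Uu).
  move=> /is_derive_eq; apply.
  by rewrite /GRing.scale/= -surjective_pairing expr2 invfM.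
- have F0' : F (u.1, u.2) != 0 by rewrite -surjective_pairing F0.
  have := @is_deriveV R (fun t => F (u.1, t)) _ _ _ F0' (Cn_on_partial2 CF Uu).
  move=> /is_derive_eq; apply.
  by rewrite /GRing.scale/= -surjective_pairing expr2 invfM.
Qed.

Lemma smooth1_derive1 (a : R -> R) : smooth1 a -> smooth1 (derive1 a).
Proof.
move=> sa n x; have := sa n.+1 x.
suff -> : derive1n n.+1 a = derive1n n (derive1 a) by [].
by elim: n => [|n IH]; [rewrite derive1n1 derive1n0|rewrite derive1nS IH -derive1nS].
Qed.

Lemma smooth1_is_derive (a : R -> R) (x : R) : smooth1 a -> is_derive x 1 a (derive1 a x).
Proof. by move=> sa; apply: derivable_is_derive; exact: (sa 0%N). Qed.

Lemma smooth1_continuous (a : R -> R) : smooth1 a -> continuous a.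
Proof. by move=> sa x; apply: derivable_continuous; exact: (sa 0%N). Qed.

Lemma Cn_on_fst n U (a : R -> R) : open U -> smooth1 a -> Cn_on n U (fun u => a u.1).
Proof.
move=> oU; elim: n a => [|n IH] a sa; have ca := smooth1_continuous sa.
  by split=> // u _; apply: (@continuous_comp _ _ _ fst a); [exact: cvg_fst|exact: ca].
apply: (Cn_on_S oU _ _ _ (IH _ (smooth1_derive1 sa)) (Cn_on_cst n (0 : R) oU)) => u Uu.
- by apply: (@continuous_comp _ _ _ fst a); [exact: cvg_fst|exact: ca].
- exact: smooth1_is_derive.
- exact: (is_derive_cst (a u.1)).
Qed.

Lemma Cn_on_snd n U (a : R -> R) : open U -> smooth1 a -> Cn_on n U (fun u => a u.2).
Proof.
move=> oU; elim: n a => [|n IH] a sa; have ca := smooth1_continuous sa.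
  by split=> // u _; apply: (@continuous_comp _ _ _ snd a); [exact: cvg_snd|exact: ca].
apply: (Cn_on_S oU _ _ _ (Cn_on_cst n (0 : R) oU) (IH _ (smooth1_derive1 sa))) => u Uu.
- by apply: (@continuous_comp _ _ _ snd a); [exact: cvg_snd|exact: ca].
- exact: (is_derive_cst (a u.2)).
- exact: smooth1_is_derive.
Qed.

Lemma Cn_setT_continuous n F : Cn_on n setT F -> continuous F.
Proof. by move=> /Cn_on_continuous cF u; exact: cF. Qed.

(** The first partial derivative undoes [I1] and the second commutes with it; hence [I1 F] is at
    least as regular as [F]. *)
Lemma Cn_on_I1 n F : Cn_on n setT F -> Cn_on n setT (I1 F).
Proof.
elim: n F => [|n IH] F CF.
  by split=> // u _; exact: (I1_continuous (Cn_setT_continuous CF)).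
have [_ [_ F1 F2]] := CF.
apply: (Cn_on_S openT _ _ _ (Cn_on_pred CF) (IH _ F2)) => u _.
- exact: (I1_continuous (Cn_setT_continuous CF)).
- exact: is_derive_I1 (Cn_setT_continuous CF).
- apply: is_derive_I1_2 (Cn_setT_continuous CF) (Cn_setT_continuous F2) _ => v.
  exact: Cn_on_partial2 CF I.
Qed.

Lemma Cn_on_I2 n F : Cn_on n setT F -> Cn_on n setT (I2 F).
Proof.
elim: n F => [|n IH] F CF.
  by split=> // u _; exact: (I2_continuous (Cn_setT_continuous CF)).
have [_ [_ F1 F2]] := CF.
apply: (Cn_on_S openT _ _ _ (IH _ F1) (Cn_on_pred CF)) => u _.
- exact: (I2_continuous (Cn_setT_continuous CF)).
- apply: is_derive_I2_1 (Cn_setT_continuous CF) (Cn_setT_continuous F1) _ => v.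
  exact: Cn_on_partial1 CF I.
- exact: is_derive_I2 (Cn_setT_continuous CF).
Qed.

(** * Vector-valued functions, coordinate by coordinate *)

Section Coordinates.
Variable N : nat.
Implicit Type H : R * R -> 'rV[R]_N.

Lemma is_derive_coord (f : R -> 'rV[R]_N) (x : R) d (k : 'I_N) :
  is_derive x 1 f d -> is_derive x 1 (fun s => f s 0 k) (d 0 k).
Proof.
move=> [df fd]; apply: DeriveDef; first exact: ((derivable_mxP f x 1).1 df).
by rewrite -fd derive_mx// mxE.
Qed.

Lemma is_derive_row (f : R -> 'rV[R]_N) (x : R) (d : 'rV[R]_N) :
  (forall k, is_derive x 1 (fun s => f s 0 k) (d 0 k)) -> is_derive x 1 f d.
Proof.
move=> H.
have df : derivable f x 1.
  by apply/derivable_mxP => i j; rewrite (ord1 i); case: (H j).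
apply: DeriveDef => //; apply/rowP => k; rewrite derive_mx// mxE.
by case: (H k).
Qed.

Lemma continuous_coord H u (k : 'I_N) : {for u, continuous H} ->
  {for u, continuous (fun u => H u 0 k)}.
Proof.
move=> cH; apply: (@continuous_comp _ _ _ H (fun M : 'rV[R]_N => M 0 k)) => //.
exact: coord_continuous.
Qed.

Lemma continuous_row H u :
  (forall k, {for u, continuous (fun u => H u 0 k)}) -> {for u, continuous H}.
Proof.
move=> cH A [P /= nP PA].
have h : \forall v \near u, forall k, P 0 k (H v 0 k).
  apply: (@filter_forall _ 'I_N (fun k v => P 0 k (H v 0 k)) (nbhs u)) => k.
  by apply: cH; exact: nP.
by apply: filterS h => v h; apply: PA => i j; rewrite (ord1 i).
Qed.

Lemma Cn_on_coord n U H (k : 'I_N) : open U -> Cn_on n U H ->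
  Cn_on n U (fun u => H u 0 k).
Proof.
move=> oU; elim: n H => [|n IH] H CH.
  by split=> // u Uu; apply: continuous_coord; exact: (CH.1).
have [cH [_ F1 F2]] := CH.
apply: (Cn_on_S oU _ _ _ (IH _ F1) (IH _ F2)) => u Uu.
- by apply: continuous_coord; exact: cH.
- exact: (is_derive_coord _ (Cn_on_partial1 CH Uu)).
- exact: (is_derive_coord _ (Cn_on_partial2 CH Uu)).
Qed.

Lemma Cn_on_row n U H : open U ->
  (forall k, Cn_on n U (fun u => H u 0 k)) -> Cn_on n U H.
Proof.
move=> oU; elim: n H => [|n IH] H CH.
  by split=> // u Uu; apply: continuous_row => k; exact: (CH k).1.
have d1 : Cn_on n U (fun u => \row_k partial1 (fun u => H u 0 k) u).
  apply: IH => k; have [_ [_ F1 _]] := CH k.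
  by apply: Cn_on_eq F1 => // u _; rewrite mxE.
have d2 : Cn_on n U (fun u => \row_k partial2 (fun u => H u 0 k) u).
  apply: IH => k; have [_ [_ _ F1]] := CH k.
  by apply: Cn_on_eq F1 => // u _; rewrite mxE.
apply: (Cn_on_S oU _ _ _ d1 d2) => u Uu.
- by apply: continuous_row => k; have [+ _] := CH k; apply.
- by apply: is_derive_row => k; rewrite mxE; exact: (Cn_on_partial1 (CH k)).
- by apply: is_derive_row => k; rewrite mxE; exact: (Cn_on_partial2 (CH k)).
Qed.

End Coordinates.

End Smooth.

(** * The linear Goursat problem *)

Section Picard.
Variable R : realType.
Implicit Types (u : R * R) (F G q : R * R -> R).

Lemma half_pow_small (e C : R) : 0 < e -> 0 <= C ->
  exists n, C * 2^-1 ^+ n < e.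
Proof.
move=> e0 C0; have z1 : `|2^-1 : R| < 1 by rewrite ger0_norm; lra.
have /cvgr_dist_lt/(_ _ e0)[n _ hn] := cvg_geometric C z1.
exists n; have := hn n (leqnn n); rewrite sub0r normrN.
by apply: le_lt_trans; exact: ler_norm.
Qed.

Lemma eq0_half_pow (z C : R) : (forall n, `|z| <= C * 2^-1 ^+ n) -> z = 0.
Proof.
move=> H; apply/eqP; rewrite -normr_le0 leNgt; apply/negP => z0.
have C0 : 0 <= C by have := H 0%N; rewrite expr0 mulr1; apply: le_trans.
have [n] := half_pow_small z0 C0.
by rewrite ltNge H.
Qed.

Lemma series_half_pow (a : R^nat) (C : R) :
  (forall n, `|a n| <= C * 2^-1 ^+ n) ->
  forall n, `|limn (series a) - series a n| <= 2 * C * 2^-1 ^+ n.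
Proof.
move=> aC.
have C0 : 0 <= C by have := aC 0%N; rewrite expr0 mulr1; apply: le_trans.
have cvga : cvgn (series a).
  apply: normed_cvg; apply: (@series_le_cvg _ _ (geometric C 2^-1)) => [n|n|n|].
  - exact: normr_ge0.
  - by rewrite /geometric/= mulr_ge0// exprn_ge0// invr_ge0.
  - exact: aC.
  - by apply: is_cvg_geometric_series; rewrite ger0_norm; lra.
(* The right-hand side is the exact geometric sum of [C * 2^-1 ^+ l] over [n <= l < n + m], so the
   induction on [m] telescopes. *)
have tail n m : `|series a (n + m)%N - series a n| <=
    2 * C * 2^-1 ^+ n - 2 * C * 2^-1 ^+ (n + m)%N.
  elim: m => [|m IH]; first by rewrite addn0 !subrr normr0.
  rewrite addnS exprS seriesSr.
  have -> : series a (n + m)%N + a (n + m)%N - series a n =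
    (series a (n + m)%N - series a n) + a (n + m)%N by ring.
  apply: le_trans (ler_normD _ _) _.
  have := aC (n + m)%N; lra.
move=> n; apply/ler_addgt0Pr => e e0.
have /cvgr_dist_lt/(_ _ e0) [m _ hm] := cvga.
have -> : limn (series a) - series a n = (limn (series a) - series a (n + m)%N) +
   (series a (n + m)%N - series a n) by ring.
apply: le_trans (ler_normD _ _) _.
have := hm (n + m)%N (leq_addl _ _); have := tail n m.
have : 0 <= 2 * C * 2^-1 ^+ (n + m)%N by rewrite !mulr_ge0// exprn_ge0// invr_ge0.
rewrite /=; lra.
Qed.

Lemma prim_cst0 (x : R) : prim (fun _ => 0) x = 0.
Proof.
have c0 : continuous (fun _ : R => 0 : R) by move=> v; exact: cvg_cst.
symmetry; apply: (@prim_uniq _ (fun _ => 0) _ c0) => // t; exact: is_derive_cst.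
Qed.

Lemma eq_I1 F G : F =1 G -> I1 F =1 I1 G.
Proof. by move=> /funext ->. Qed.

Lemma eq_I2 F G : F =1 G -> I2 F =1 I2 G.
Proof. by move=> /funext ->. Qed.

Lemma I1D F G u : continuous F -> continuous G ->
  I1 (fun u => F u + G u) u = I1 F u + I1 G u.
Proof. by move=> cF cG; apply: primD; exact: continuous_slice1. Qed.

Lemma I1B F G u : continuous F -> continuous G ->
  I1 (fun u => F u - G u) u = I1 F u - I1 G u.
Proof. by move=> cF cG; apply: primB; exact: continuous_slice1. Qed.

Lemma I2D F G u : continuous F -> continuous G ->
  I2 (fun u => F u + G u) u = I2 F u + I2 G u.
Proof. by move=> cF cG; apply: primD; exact: continuous_slice2. Qed.

Lemma I2B F G u : continuous F -> continuous G ->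
  I2 (fun u => F u - G u) u = I2 F u - I2 G u.
Proof. by move=> cF cG; apply: primB; exact: continuous_slice2. Qed.

Lemma continuousM_fun F G : continuous F -> continuous G ->
  continuous (fun u => F u * G u).
Proof. by move=> cF cG u; apply: cvgM; [exact: cF|exact: cG]. Qed.

Lemma continuousB_fun F G : continuous F -> continuous G ->
  continuous (fun u => F u - G u).
Proof. by move=> cF cG u; apply: cvgB; [exact: cF|exact: cG]. Qed.

Lemma continuousD_fun F G : continuous F -> continuous G ->
  continuous (fun u => F u + G u).
Proof. by move=> cF cG u; apply: cvgD; [exact: cF|exact: cG]. Qed.

Section Iteration.
Variables (q w0 : R * R -> R).
Hypotheses (cq : continuous q) (cw0 : continuous w0).

(** With [w0] carrying the axis data, the Goursat problem is the fixed-point equation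
    [th = w0 + picard_step th], solved below by its Neumann series. *)
Definition picard_step F := I1 (I2 (fun u => q u * F u)).

Lemma picard_step_continuous F : continuous F -> continuous (picard_step F).
Proof.
by move=> cF; apply: I1_continuous; apply: I2_continuous; exact: continuousM_fun.
Qed.

Definition picard_term n := iter n picard_step w0.

Lemma picard_term_continuous n : continuous (picard_term n).
Proof. by elim: n => [//|n IH]; exact: picard_step_continuous. Qed.

(* The weight [expR (L * `|x|)] makes the iteration contract on every box. *)
Lemma picard_term_bound (B : R) : 0 <= B -> exists C, forall n x y,
  `|x| <= B -> `|y| <= B -> `|picard_term n (x, y)| <= C * 2^-1 ^+ n.
Proof.
move=> B0.
have [Q Q0 qQ] := box_bounded B cq; have [K K0 wK] := box_bounded B cw0.
(* Integration in [y] costs [Q * B] and the weighted integration in [x] gains [1 / L]; this [L]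
   makes the product [Q * B / L] less than [1 / 2]. *)
pose L := 2 * Q * B + 1.
have QB0 : 0 <= Q * B by rewrite mulr_ge0.
have L0 : 0 < L by rewrite /L; lra.
have H n x y : `|x| <= B -> `|y| <= B ->
    `|picard_term n (x, y)| <= K * 2^-1 ^+ n * expR (L * `|x|).
  elim: n x y => [|n IH] x y xB yB.
    rewrite expr0 mulr1; apply: le_trans (wK _ _ xB yB) _.
    by rewrite ler_peMr// -expR0 ler_expR mulr_ge0// ltW.
  set M := K * 2^-1 ^+ n; have M0 : 0 <= M by rewrite /M mulr_ge0// exprn_ge0// invr_ge0.
  have cF : continuous (fun u => q u * picard_term n u).
    by apply: continuousM_fun => //; exact: picard_term_continuous.
  have := @prim_exp_le _ (fun s => I2 (fun u => q u * picard_term n u) (s, y)) (Q * B * M) L x.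
  move=> /(_ _ _ L0 _)/le_trans; apply.
  - by apply: continuous_slice1; exact: I2_continuous.
  - by rewrite mulr_ge0.
  - move=> s sx; have sB := le_trans sx xB.
    have := @norm_prim_le _ (fun t => q (s, t) * picard_term n (s, t)) y (Q * (M * expR (L * `|s|))).
    move=> /(_ _ _)/le_trans; apply.
    + exact: (@continuous_slice2 _ _ (fun u => q u * picard_term n u)).
    + move=> t ty; have tB := le_trans ty yB.
      by rewrite normrM ler_pM// ?qQ// IH.
    + have -> : Q * B * M * expR (L * `|s|) = Q * (M * expR (L * `|s|)) * B by ring.
      by rewrite ler_wpM2l// !mulr_ge0// expR_ge0.
  - rewrite ler_wpM2r ?expR_ge0// ler_pdivrMr// exprS.
    have -> : K * (2^-1 * 2^-1 ^+ n) * L = Q * B * M + M / 2 by rewrite /M /L; field.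
    by rewrite lerDl divr_ge0.
exists (K * expR (L * B)) => n x y xB yB; apply: le_trans (H n x y xB yB) _.
rewrite mulrAC ler_wpM2r ?exprn_ge0 ?invr_ge0// ler_wpM2l// ler_expR.
by rewrite ler_wpM2l// ltW.
Qed.

Definition picard_sum n u := series (picard_term ^~ u) n.

Definition picard_limit u : R := limn (series (picard_term ^~ u)).

Lemma picard_limit_bound (B : R) : 0 <= B -> exists2 C, 0 <= C & forall n x y,
  `|x| <= B -> `|y| <= B ->
  `|picard_limit (x, y) - picard_sum n (x, y)| <= C * 2^-1 ^+ n.
Proof.
move=> B0; have [C HC] := picard_term_bound B0.
exists (2 * C).
  have := HC 0%N 0 0; rewrite normr0 => /(_ B0 B0); rewrite expr0 mulr1 => h.
  by rewrite mulr_ge0//; apply: le_trans h.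
move=> n x y xB yB; apply: series_half_pow => m; exact: HC.
Qed.

Lemma picard_sum_continuous n : continuous (picard_sum n).
Proof.
elim: n => [|n IH].
  have -> : picard_sum 0 = cst 0 by apply/funext => u; rewrite /picard_sum /series/= big_geq.
  by move=> u; exact: cvg_cst.
have -> : picard_sum n.+1 = (fun u => picard_sum n u + picard_term n u).
  by apply/funext => u; rewrite /picard_sum seriesSr.
by apply: continuousD_fun => //; exact: picard_term_continuous.
Qed.

Lemma picard_limit_continuous : continuous picard_limit.
Proof.
move=> [x0 y0]; apply/cvgrPdist_lt => /= e e0.
have ax := normr_ge0 x0; have ay := normr_ge0 y0.
have B0 : 0 <= `|x0| + `|y0| + 1 by lra.
have [C C0 HC] := picard_limit_bound B0.
have e3 : 0 < e / 3 by lra.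
have [n hn] := half_pow_small e3 C0.
have h1 : \forall z \near (x0, y0), `|x0 - z.1| < 1 /\ `|y0 - z.2| < 1.
  exists ([set x | `|x0 - x| < 1], [set y | `|y0 - y| < 1]) => //=.
  split; first by apply: (@cvgr_dist_lt _ _ _ (nbhs x0) _ id x0) => //; exact: cvg_id.
  by apply: (@cvgr_dist_lt _ _ _ (nbhs y0) _ id y0) => //; exact: cvg_id.
have /cvgr_dist_lt /(_ _ e3) h2 := @picard_sum_continuous n (x0, y0).
apply: filterS2 h1 h2 => -[x y]/= [x1 y1] h.
have xB : `|x| <= `|x0| + `|y0| + 1.
  have -> : x = x0 - (x0 - x) by ring.
  by apply: le_trans (ler_normB _ _) _; lra.
have yB : `|y| <= `|x0| + `|y0| + 1.
  have -> : y = y0 - (y0 - y) by ring.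
  by apply: le_trans (ler_normB _ _) _; lra.
have k1 := HC n x y xB yB.
have k0 : `|picard_limit (x0, y0) - picard_sum n (x0, y0)| <= C * 2^-1 ^+ n.
  by apply: HC; lra.
have -> : picard_limit (x0, y0) - picard_limit (x, y) =
  (picard_limit (x0, y0) - picard_sum n (x0, y0)) - (picard_limit (x, y) - picard_sum n (x, y))
  + (picard_sum n (x0, y0) - picard_sum n (x, y)) by ring.
apply: le_lt_trans (ler_normD _ _) _.
have := ler_normB (picard_limit (x0, y0) - picard_sum n (x0, y0)) (picard_limit (x, y) - picard_sum n (x, y)).
lra.
Qed.

Lemma picard_sumS n u : picard_sum n.+1 u = w0 u + picard_step (picard_sum n) u.
Proof.
elim: n u => [|n IH] u.
  rewrite /picard_sum /series/= big_nat1.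
  have -> : picard_step (picard_sum 0) u = 0.
    have c0 : continuous (cst 0 : R * R -> R) by move=> v; exact: cvg_cst.
    have h0 : (fun u => q u * picard_sum 0 u) =1 (fun u => cst 0 u - cst 0 u).
      by move=> v; rewrite /picard_sum /series/= big_geq// mulr0 subrr.
    rewrite /picard_step (eq_I1 (eq_I2 h0)).
    have h1 : I2 (fun u => cst 0 u - cst 0 u) =1 (fun u => I2 (cst 0) u - I2 (cst 0) u).
      by move=> v; rewrite I2B.
    rewrite (eq_I1 h1) I1B ?subrr//; exact: I2_continuous.
  by rewrite addr0.
rewrite {1}/picard_sum seriesSr -/(picard_sum n.+1 u) IH -addrA; congr (_ + _).
have cS := @picard_sum_continuous n; have cT := @picard_term_continuous n.
have h0 : (fun u => q u * picard_sum n.+1 u) =1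
    (fun u => q u * picard_sum n u + q u * picard_term n u).
  by move=> v; rewrite {1}/picard_sum seriesSr mulrDr.
have h1 : I2 (fun u => q u * picard_sum n u + q u * picard_term n u) =1
    (fun u => I2 (fun u => q u * picard_sum n u) u + I2 (fun u => q u * picard_term n u) u).
  by move=> v; rewrite I2D//; exact: continuousM_fun.
rewrite [RHS]/picard_step (eq_I1 (eq_I2 h0)) (eq_I1 h1) I1D//;
  by apply: I2_continuous; exact: continuousM_fun.
Qed.

(** The partial sums satisfy the fixed-point equation with index shifted by one, so the defect of
    the limit is made of two tails: that of sum [n + 1], bounded through [C], and the image of that
    of sum [n], bounded through [Q * C * B * B]. Both decay like [2^-1 ^+ n]. *)
Lemma picard_limitE u : picard_limit u = w0 u + picard_step picard_limit u.
Proof.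
apply/eqP; rewrite -subr_eq0; apply/eqP.
case: u => x y; set B := `|x| + `|y|.
have ax := normr_ge0 x; have ay := normr_ge0 y.
have B0 : 0 <= B by rewrite /B; lra.
have [C C0 HC] := picard_limit_bound B0.
have [Q Q0 qQ] := box_bounded B cq.
apply: (@eq0_half_pow _ (C + Q * C * B * B)) => n.
have xB : `|x| <= B by rewrite /B; lra.
have yB : `|y| <= B by rewrite /B; lra.
have k1 := HC n.+1 x y xB yB.
have -> : picard_limit (x, y) - (w0 (x, y) + picard_step picard_limit (x, y)) =
  (picard_limit (x, y) - picard_sum n.+1 (x, y)) -
  (picard_step picard_limit (x, y) - picard_step (picard_sum n) (x, y)).
  rewrite picard_sumS; move: (picard_limit _) (w0 _) (picard_step _ _) (picard_step _ _).
  by move=> a b c d; ring.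
apply: le_trans (ler_normB _ _) _; rewrite mulrDl; apply: lerD.
  apply: le_trans k1 _; rewrite ler_wpM2l// exprS ger_pMl ?exprn_gt0// ?invr_gt0//; lra.
have cS := @picard_sum_continuous n; have cl := picard_limit_continuous.
pose D u := picard_limit u - picard_sum n u.
have cqD : continuous (fun u => q u * D u).
  by apply: continuousM_fun => //; exact: continuousB_fun.
have -> : picard_step picard_limit (x, y) - picard_step (picard_sum n) (x, y) = picard_step D (x, y).
  have h0 : (fun u => q u * D u) =1 (fun u => q u * picard_limit u - q u * picard_sum n u).
    by move=> v; rewrite mulrBr.
  have h1 : I2 (fun u => q u * picard_limit u - q u * picard_sum n u) =1
    (fun u => I2 (fun u => q u * picard_limit u) u - I2 (fun u => q u * picard_sum n u) u).
    by move=> v; rewrite I2B//; exact: continuousM_fun.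
  rewrite [RHS]/picard_step (eq_I1 (eq_I2 h0)) (eq_I1 h1) I1B//;
    by apply: I2_continuous; exact: continuousM_fun.
set e := 2^-1 ^+ n; have e0 : 0 <= e by rewrite /e exprn_ge0// invr_ge0.
have := @norm_prim_le _ (fun s => I2 (fun u => q u * D u) (s, y)) x (Q * (C * e) * B).
move=> /(_ _ _)/le_trans; apply.
- by apply: continuous_slice1; exact: I2_continuous.
- move=> s sx; have sB := le_trans sx xB.
  have := @norm_prim_le _ (fun t => q (s, t) * D (s, t)) y (Q * (C * e)).
  move=> /(_ _ _)/le_trans; apply.
  + exact: (@continuous_slice2 _ _ (fun u => q u * D u)).
  + move=> t ty; have tB := le_trans ty yB.
    by rewrite normrM ler_pM// ?qQ// HC.
  + by rewrite ler_wpM2l// !mulr_ge0.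
- have -> : Q * C * B * B * e = Q * (C * e) * B * B by ring.
  by rewrite ler_wpM2l// !mulr_ge0.
Qed.

End Iteration.

(** * Smooth functions on the whole plane, the Goursat problem and potentials *)

Definition smooth2 F := forall n, Cn_on n setT F.

Lemma smooth2_continuous F : smooth2 F -> continuous F.
Proof. by move=> sF; exact: Cn_setT_continuous (sF 0%N). Qed.

Lemma smooth2_partial1 F : smooth2 F -> smooth2 (partial1 F).
Proof. by move=> sF n; have [_ []] := sF n.+1. Qed.

Lemma smooth2_partial2 F : smooth2 F -> smooth2 (partial2 F).
Proof. by move=> sF n; have [_ []] := sF n.+1. Qed.

Lemma smooth2_derive1 F u : smooth2 F ->
  is_derive u.1 1 (fun s => F (s, u.2)) (partial1 F u).
Proof. by move=> sF; apply: Cn_on_partial1 (sF 1%N) _. Qed.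

Lemma smooth2_derive2 F u : smooth2 F ->
  is_derive u.2 1 (fun t => F (u.1, t)) (partial2 F u).
Proof. by move=> sF; apply: Cn_on_partial2 (sF 1%N) _. Qed.

Lemma smooth2_of_partials F F1 F2 : continuous F -> smooth2 F1 -> smooth2 F2 ->
  (forall u, is_derive u.1 1 (fun s => F (s, u.2)) (F1 u)) ->
  (forall u, is_derive u.2 1 (fun t => F (u.1, t)) (F2 u)) ->
  smooth2 F.
Proof.
move=> cF s1 s2 d1 d2 n; apply: Cn_on_pred.
apply: (@Cn_on_S _ _ n setT F F1 F2) => //; first exact: openT.
by move=> u _; exact: cF.
Qed.

Lemma smooth2_fst (a : R -> R) : smooth1 a -> smooth2 (fun u => a u.1).
Proof. by move=> sa n; apply: Cn_on_fst => //; exact: openT. Qed.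

Lemma smooth2_snd (a : R -> R) : smooth1 a -> smooth2 (fun u => a u.2).
Proof. by move=> sa n; apply: Cn_on_snd => //; exact: openT. Qed.

Lemma smooth2D F G : smooth2 F -> smooth2 G -> smooth2 (fun u => F u + G u).
Proof. by move=> sF sG n; apply: Cn_onD => //; exact: openT. Qed.

Lemma smooth2B F G : smooth2 F -> smooth2 G -> smooth2 (fun u => F u - G u).
Proof. by move=> sF sG n; apply: Cn_onB => //; exact: openT. Qed.

Lemma smooth2M F G : smooth2 F -> smooth2 G -> smooth2 (fun u => F u * G u).
Proof. by move=> sF sG n; apply: Cn_onM => //; exact: openT. Qed.

Lemma smooth2_cst (c : R) : smooth2 (cst c).
Proof. by move=> n; apply: Cn_on_cst; exact: openT. Qed.

Theorem goursat_exists q (a b : R -> R) :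
  smooth2 q -> smooth1 a -> smooth1 b -> a 0 = b 0 ->
  exists th : R * R -> R,
    [/\ smooth2 th, forall x, th (x, 0) = a x, forall y, th (0, y) = b y &
     forall u, partial1 (partial2 th) u = q u * th u /\
               partial2 (partial1 th) u = q u * th u].
Proof.
move=> sq sa sb ab.
(* The solution for [q = 0] with the prescribed axis values. *)
pose w0 u := a u.1 + b u.2 - a 0.
have sw0 : smooth2 w0.
  apply: smooth2B; last exact: (smooth2_cst (a 0)).
  by apply: smooth2D; [exact: smooth2_fst|exact: smooth2_snd].
have cq := smooth2_continuous sq; have cw0 := smooth2_continuous sw0.
pose th := picard_limit q w0.
have cth : continuous th by exact: picard_limit_continuous.
have thE u : th u = w0 u + picard_step q th u by exact: picard_limitE.
have cqth : continuous (fun u => q u * th u) by exact: continuousM_fun.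
have d1 u : is_derive u.1 1 (fun s => th (s, u.2))
    (derive1 a u.1 + I2 (fun u => q u * th u) u).
  have -> : (fun s => th (s, u.2)) =
      (fun s => a s + b u.2 - a 0 + I1 (I2 (fun u => q u * th u)) (s, u.2)).
    by apply/funext => s; rewrite thE.
  have ? := @is_derive_I1 _ (I2 (fun u => q u * th u)) u (I2_continuous cqth).
  have ? := smooth1_is_derive u.1 sa.
  by apply: is_derive_eq; rewrite subr0 addr0.
have d2 u : is_derive u.2 1 (fun t => th (u.1, t))
    (derive1 b u.2 + I1 (fun u => q u * th u) u).
  have -> : (fun t => th (u.1, t)) =
      (fun t => a u.1 + b t - a 0 + I1 (I2 (fun u => q u * th u)) (u.1, t)).
    by apply/funext => s; rewrite thE.
  have ? := @is_derive_I1_2 _ (I2 (fun u => q u * th u)) _ u (I2_continuous cqth) cqth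
    (fun v => is_derive_I2 v cqth).
  have ? := smooth1_is_derive u.2 sb.
  by apply: is_derive_eq; rewrite subr0 add0r mul1r.
(* Bootstrap: by [d1] and [d2] the first derivatives of [th] are axis data plus partial primitives
   of [q * th], so class C^n of [th] gives class C^(n+1). *)
have sth : smooth2 th.
  elim=> [|n IH]; first by split=> // u _; exact: cth.
  have Cq : Cn_on n setT (fun u => q u * th u) by apply: Cn_onM => //; exact: openT.
  apply: (@Cn_on_S _ _ n setT th _ _ openT (fun u _ => cth u) (fun u _ => d1 u) (fun u _ => d2 u)).
    apply: Cn_onD; [exact: openT| |exact: Cn_on_I2].
    by apply: Cn_on_fst; [exact: openT|exact: smooth1_derive1].
  apply: Cn_onD; [exact: openT| |exact: Cn_on_I1].
  by apply: Cn_on_snd; [exact: openT|exact: smooth1_derive1].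
exists th; split => //.
- move=> x; rewrite thE /w0 /= -ab /picard_step /I1/=.
  suff -> : (fun s => I2 (fun u => q u * th u) (s, 0)) = (fun s => 0).
    by rewrite prim_cst0; ring.
  by apply/funext => s; rewrite /I2/= prim0.
- move=> y; rewrite thE /w0 /= /picard_step /I1/= prim0; ring.
- move=> u; split.
  + have e2 : partial2 th = (fun u => derive1 b u.2 + I1 (fun u => q u * th u) u).
      by apply/funext => v; apply: is_derive_derive1 (d2 v).
    rewrite e2.
    apply: (@is_derive_derive1 _ R (fun s => derive1 b u.2 + I1 (fun u => q u * th u) (s, u.2))).
    have ? := is_derive_I1 u cqth.
    by apply: is_derive_eq; rewrite add0r ?mul1r.
  + have e1 : partial1 th = (fun u => derive1 a u.1 + I2 (fun u => q u * th u) u).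
      by apply/funext => v; apply: is_derive_derive1 (d1 v).
    rewrite e1.
    apply: (@is_derive_derive1 _ R (fun t => derive1 a u.1 + I2 (fun u => q u * th u) (u.1, t))).
    have ? := is_derive_I2 u cqth.
    by apply: is_derive_eq; rewrite add0r ?mul1r.
Qed.

(** Symmetry of mixed derivatives: write [F] as its value on the first axis plus the [y]-primitive
    of [partial2 F], differentiate under the integral in [x], then undo the primitive in [y]. *)
Lemma partials_commute F G : smooth2 F -> continuous G ->
  (forall u, partial1 (partial2 F) u = G u) ->
  forall u, partial2 (partial1 F) u = G u.
Proof.
move=> sF cG FG.
have c2 := smooth2_continuous (smooth2_partial2 sF).
have FE s t : F (s, t) = F (s, 0) + I2 (partial2 F) (s, t).
  have := @derive_unique _ (fun t => F (s, t)) (fun t => F (s, 0) + I2 (partial2 F) (s, t))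
    (fun t => partial2 F (s, t)) 0.
  apply.
  - by rewrite /I2/= prim0 addr0.
  - by move=> x; exact: (@smooth2_derive2 F (s, x)).
  - move=> x; have ? := @is_derive_I2 _ (partial2 F) (s, x) c2.
    by apply: is_derive_eq; rewrite add0r ?mul1r.
have e1 : partial1 F = (fun u => partial1 F (u.1, 0) + I2 G u).
  apply/funext => u; apply: is_derive_derive1.
  rewrite (funext (fun s => FE s u.2)).
  have ? := @smooth2_derive1 F (u.1, 0) sF.
  have ? : is_derive u.1 1 (fun s => I2 (partial2 F) (s, u.2)) (I2 G u).
    apply: is_derive_I2_1 => // v; rewrite -FG.
    exact: smooth2_derive1 (smooth2_partial2 sF).
  exact: is_deriveD.
move=> u; rewrite e1.
apply: (@is_derive_derive1 _ R (fun t => partial1 F (u.1, 0) + I2 G (u.1, t))).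
have := is_deriveD (is_derive_cst (partial1 F (u.1, 0)) u.2 1) (is_derive_I2 u cG).
by rewrite add0r.
Qed.

(** Poincare lemma: integrate [al] along the first axis and then [be] upwards. By closedness [al] is
    the [y]-primitive of [partial1 be] plus its axis values, which identifies [partial1 h]. *)
Lemma potential_exists (al be : R * R -> R) (c : R) : smooth2 al -> smooth2 be ->
  (forall u, partial2 al u = partial1 be u) ->
  exists h : R * R -> R, [/\ smooth2 h, h (0, 0) = c,
    forall u, partial1 h u = al u & forall u, partial2 h u = be u].
Proof.
move=> sal sbe E.
have cal := smooth2_continuous sal; have cbe := smooth2_continuous sbe.
pose h u := c + prim (fun s => al (s, 0)) u.1 + I2 be u.
have cs : continuous (fun s => al (s, 0)) by exact: continuous_slice1.
have alE s t : al (s, t) = al (s, 0) + I2 (partial1 be) (s, t).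
  have := @derive_unique _ (fun t => al (s, t)) (fun t => al (s, 0) + I2 (partial1 be) (s, t))
    (fun t => partial2 al (s, t)) 0.
  apply.
  - by rewrite /I2/= prim0 addr0.
  - by move=> x; exact: (@smooth2_derive2 al (s, x)).
  - move=> x; rewrite E.
    have ? := @is_derive_I2 _ (partial1 be) (s, x) (smooth2_continuous (smooth2_partial1 sbe)).
    by apply: is_derive_eq; rewrite add0r ?mul1r.
have d1 u : is_derive u.1 1 (fun s => h (s, u.2)) (al u).
  have ? := is_derive_prim u.1 cs.
  have ? : is_derive u.1 1 (fun s => I2 be (s, u.2)) (I2 (partial1 be) u).
    apply: is_derive_I2_1 => // [|v]; last exact: smooth2_derive1.
    exact: smooth2_continuous (smooth2_partial1 sbe).
  apply: is_derive_eq; rewrite add0r mul1r.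
  by rewrite [in RHS](surjective_pairing u) alE -surjective_pairing.
have d2 u : is_derive u.2 1 (fun t => h (u.1, t)) (be u).
  have := is_deriveD (is_derive_cst (c + prim (fun s => al (s, 0)) u.1) u.2 1)
    (is_derive_I2 u cbe).
  by rewrite add0r.
exists h; split.
- apply: smooth2_of_partials sal sbe d1 d2.
  apply: continuousD_fun; last exact: I2_continuous.
  move=> u; apply: cvgD; first exact: cvg_cst.
  apply: (@continuous_comp _ _ _ fst (prim (fun s => al (s, 0)))); first exact: cvg_fst.
  by have [? _] := is_derive_prim u.1 cs; exact: derivable_continuous.
- by rewrite /h /I2/= !prim0 !addr0.
- by move=> u; apply: is_derive_derive1.
- by move=> u; apply: is_derive_derive1.
Qed.

End Picard.

(** * Lattice families *)

Section Lattice.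
Variable R : realType.

(* One lattice function per mesh size; [G eps i j] is the value at (eps i, eps j),
   and only the quadrant is needed. *)
Definition family := R -> nat -> nat -> R.

Implicit Types (A B E F G : family) (p k : nat) (eps r : R).

Definition t1 F : family := fun eps i j => F eps i.+1 j.
Definition t2 F : family := fun eps i j => F eps i j.+1.
Definition d1 F : family := fun eps i j => (F eps i.+1 j - F eps i j) / eps.
Definition d2 F : family := fun eps i j => (F eps i j.+1 - F eps i j) / eps.
(** Axis values are kept as families constant in the other index, so that [CB] also expresses bounds
    on initial data. *)
Definition ax1 F : family := fun eps i _ => F eps i 0%N.
Definition ax2 F : family := fun eps _ j => F eps 0%N j.
Definition transpose F : family := fun eps i j => F eps j i.
Definition addf F G : family := fun eps i j => F eps i j + G eps i j.
Definition subf F G : family := fun eps i j => F eps i j - G eps i j.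
Definition mulf F G : family := fun eps i j => F eps i j * G eps i j.
Definition invf F : family := fun eps i j => (F eps i j)^-1.
Definition cstf (c : R) : family := fun _ _ _ => c.
Definition epsf : family := fun eps _ _ => eps.

Variable r0 : R.

(* The squares [0, r]^2 with r < r0 exhaust a set that is stable under lattice
   shifts once eps is small, so that no edges have to be tracked. *)
Definition evt (P : R -> nat -> nat -> Prop) : Prop :=
  forall r, r < r0 -> \forall eps \near 0^'+, forall i j,
    eps * i%:R <= r -> eps * j%:R <= r -> P eps i j.

Definition bd p F : Prop := forall r, r < r0 -> exists c,
  \forall eps \near 0^'+, forall i j, eps * i%:R <= r -> eps * j%:R <= r ->
    `|F eps i j| <= c * eps ^+ p.

(* F and its difference quotients of order at most k are O(eps^p). *)
Fixpoint CB p k F : Prop :=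
  bd p F /\ if k is m.+1 then CB p m (d1 F) /\ CB p m (d2 F) else True.

Definition eqf F G := evt (fun eps i j => F eps i j = G eps i j).

Lemma near0_lt (e : R) : 0 < e -> \forall eps \near (0 : R)^'+, eps < e.
Proof. by move=> e0; exact: nbhs_right_lt. Qed.

Lemma near0_gt : \forall eps \near (0 : R)^'+, 0 < eps.
Proof. exact: nbhs_right_gt. Qed.

Lemma evt_pos (P : R -> nat -> nat -> Prop) :
  (forall eps i j, 0 < eps -> P eps i j) -> evt P.
Proof. by move=> H r _; apply: filterS near0_gt => eps e0 i j _ _; exact: H. Qed.

Lemma evt_shift1 (P : R -> nat -> nat -> Prop) :
  evt P -> evt (fun eps i j => P eps i.+1 j).
Proof.
move=> H r rr0.
(* A shifted point leaves the square of side [r] by at most [eps]; for [eps] below [(r0 - r) / 2] it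
   stays in the square of the midpoint side, which is still admissible. *)
have h1 : (r + r0) / 2 < r0 by lra.
have h2 : 0 < (r0 - r) / 2 by lra.
apply: filterS3 (H _ h1) (near0_lt h2) near0_gt => eps He e1 e0 i j hi hj.
by apply: He; last lra; rewrite -natr1 mulrDr mulr1; lra.
Qed.

Lemma evt_transpose (P : R -> nat -> nat -> Prop) :
  evt P -> evt (fun eps i j => P eps j i).
Proof.
by move=> H r rr0; apply: filterS (H r rr0) => eps He i j hi hj; exact: He.
Qed.

Lemma evt_shift2 (P : R -> nat -> nat -> Prop) :
  evt P -> evt (fun eps i j => P eps i j.+1).
Proof. by move=> /evt_transpose /evt_shift1 /evt_transpose. Qed.

Lemma evt_and (P Q S : R -> nat -> nat -> Prop) :
  (forall eps i j, P eps i j -> Q eps i j -> S eps i j) ->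
  evt P -> evt Q -> evt S.
Proof.
move=> PQS HP HQ r rr0; apply: filterS2 (HP r rr0) (HQ r rr0) => eps h1 h2 i j hi hj.
by apply: PQS; [exact: h1|exact: h2].
Qed.

Lemma eqf_sym F G : eqf F G -> eqf G F.
Proof. by move=> H r /H; apply: filterS => eps h i j hi hj; rewrite h. Qed.

Lemma eqf_d1 F G : eqf F G -> eqf (d1 F) (d1 G).
Proof.
move=> H; have H' := evt_shift1 H.
by apply: evt_and H H' => eps i j h1 h2; rewrite /d1 h1 h2.
Qed.

Lemma eqf_d2 F G : eqf F G -> eqf (d2 F) (d2 G).
Proof.
move=> H; have H' := evt_shift2 H.
by apply: evt_and H H' => eps i j h1 h2; rewrite /d2 h1 h2.
Qed.

Lemma bd_eq p F G : eqf F G -> bd p F -> bd p G.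
Proof.
move=> H bF r rr0; have [c hc] := bF r rr0; exists c.
by apply: filterS2 hc (H r rr0) => eps h1 h2 i j hi hj; rewrite -h2//; exact: h1.
Qed.

Lemma CB_eq p k F G : eqf F G -> CB p k F -> CB p k G.
Proof.
elim: k F G => [|k IH] F G FG [bF H]; split => //; try exact: bd_eq bF.
by case: H => H1 H2; split; [apply: IH H1; exact: eqf_d1|apply: IH H2; exact: eqf_d2].
Qed.

Lemma CB_bd p k F : CB p k F -> bd p F.
Proof. by case: k => [|k] []. Qed.

Lemma CB_pred p k F : CB p k.+1 F -> CB p k F.
Proof.
elim: k F => [|k IH] F [bF [H1 H2]]; first by split.
by split=> //; split; exact: IH.
Qed.

Lemma bd_t1 p F : bd p F -> bd p (t1 F).
Proof.
move=> H r rr0.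
have h1 : (r + r0) / 2 < r0 by lra.
have h2 : 0 < (r0 - r) / 2 by lra.
have [c Hc] := H _ h1; exists c.
apply: filterS3 Hc (near0_lt h2) near0_gt => eps He e1 e0 i j hi hj.
by apply: He; last lra; rewrite -natr1 mulrDr mulr1; lra.
Qed.

Lemma bd_transpose p F : bd p F -> bd p (transpose F).
Proof.
move=> H r rr0; have [c Hc] := H r rr0; exists c.
by apply: filterS Hc => eps h i j hi hj; exact: h.
Qed.

Lemma CB_transpose p k F : CB p k F -> CB p k (transpose F).
Proof.
elim: k F => [|k IH] F [bF H]; split => //; try exact: bd_transpose.
by case: H => H1 H2; split; [exact: (IH (d2 F))|exact: (IH (d1 F))].
Qed.

Lemma CB_t1 p k F : CB p k F -> CB p k (t1 F).
Proof.
elim: k F => [|k IH] F [bF H]; split => //; try exact: bd_t1.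
by case: H => H1 H2; split; [exact: (IH (d1 F))|exact: (IH (d2 F))].
Qed.

Lemma CB_t2 p k F : CB p k F -> CB p k (t2 F).
Proof. by move=> H; exact: CB_transpose (CB_t1 (CB_transpose H)). Qed.

Lemma bd_nonneg p F r : r < r0 -> bd p F -> exists2 c, 0 <= c &
  \forall eps \near 0^'+, forall i j, eps * i%:R <= r -> eps * j%:R <= r ->
    `|F eps i j| <= c * eps ^+ p.
Proof.
move=> rr0 /(_ r rr0)[c hc]; exists `|c| => //.
apply: filterS2 hc near0_gt => eps h e0 i j hi hj.
apply: le_trans (h i j hi hj) _; rewrite ler_wpM2r ?exprn_ge0 ?ler_norm//; exact: ltW.
Qed.

Lemma bdD p F G : bd p F -> bd p G -> bd p (addf F G).
Proof.
move=> bF bG r rr0; have [c hc] := bF r rr0; have [d hd] := bG r rr0; exists (c + d).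
apply: filterS2 hc hd => eps h1 h2 i j hi hj.
by rewrite mulrDl; apply: le_trans (ler_normD _ _) _; rewrite lerD ?h1 ?h2.
Qed.

Lemma bdM p p' F G : bd p F -> bd p' G -> bd (p + p') (mulf F G).
Proof.
move=> bF bG r rr0; have [c c0 hc] := bd_nonneg rr0 bF; have [d d0 hd] := bd_nonneg rr0 bG.
exists (c * d); apply: filterS2 hc hd => eps h1 h2 i j hi hj.
by rewrite normrM exprD mulrACA ler_pM ?h1 ?h2.
Qed.

Lemma CBD p k F G : CB p k F -> CB p k G -> CB p k (addf F G).
Proof.
elim: k F G => [|k IH] F G [bF HF] [bG HG]; split => //; try exact: bdD.
have [F1 F2] := HF; have [G1 G2] := HG; split.
- apply: CB_eq (IH _ _ F1 G1); apply: evt_pos => eps i j _.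
  by rewrite /addf /d1; ring.
- apply: CB_eq (IH _ _ F2 G2); apply: evt_pos => eps i j _.
  by rewrite /addf /d2; ring.
Qed.

(** Discrete Leibniz rule [d1 (F G) = d1 F * t1 G + F * d1 G]; the shift is harmless because [CB] is
    stable under it. *)
Lemma CBM p p' k F G : CB p k F -> CB p' k G -> CB (p + p') k (mulf F G).
Proof.
elim: k F G => [|k IH] F G HF HG.
  by split => //; apply: bdM; [exact: CB_bd HF|exact: CB_bd HG].
have HF' := CB_pred HF; have HG' := CB_pred HG.
split; first by apply: bdM; [exact: CB_bd HF|exact: CB_bd HG].
have [_ [F1 F2]] := HF; have [_ [G1 G2]] := HG; split.
- apply: CB_eq (CBD (IH _ _ F1 (CB_t1 HG')) (IH _ _ HF' G1)).
  apply: evt_pos => eps i j _; by rewrite /addf /mulf /d1 /t1; ring.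
- apply: CB_eq (CBD (IH _ _ F2 (CB_t2 HG')) (IH _ _ HF' G2)).
  apply: evt_pos => eps i j _; by rewrite /addf /mulf /d2 /t2; ring.
Qed.

Lemma CB_zero p k F : eqf F (cstf 0) -> CB p k F.
Proof.
move=> F0; apply: CB_eq (eqf_sym F0) _; elim: k {F F0} => [|k IH].
  split => // r _; exists 0; apply: filterS near0_gt => eps _ i j _ _.
  by rewrite normr0 mul0r.
split; first exact: CB_bd IH.
have e eps : (0 - 0) / eps = 0 :> R by rewrite subrr mul0r.
by split; apply: CB_eq IH; apply: evt_pos => eps i j _; rewrite /d1 /d2 /cstf e.
Qed.

Lemma CB_cst k (c : R) : CB 0 k (cstf c).
Proof.
have b : bd 0 (cstf c).
  move=> r _; exists `|c|; apply: filterS near0_gt => eps _ i j _ _.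
  by rewrite expr0 mulr1.
case: k => [|k]; split => //.
by split; apply: CB_zero; apply: evt_pos => eps i j _; rewrite /d1 /d2 /cstf subrr mul0r.
Qed.

Lemma CB_eps k : CB 1 k epsf.
Proof.
have b : bd 1 epsf.
  move=> r _; exists 1; apply: filterS near0_gt => eps e0 i j _ _.
  by rewrite expr1 mul1r ger0_norm// ltW.
case: k => [|k]; split => //.
by split; apply: CB_zero; apply: evt_pos => eps i j _; rewrite /d1 /d2 /epsf subrr mul0r.
Qed.

Lemma CB_cstM p k (c : R) F : CB p k F -> CB p k (mulf (cstf c) F).
Proof. by move=> H; exact: (CBM (CB_cst k c) H). Qed.

Lemma CBB p k F G : CB p k F -> CB p k G -> CB p k (subf F G).
Proof.
move=> HF HG; apply: CB_eq (CBD HF (CB_cstM (-1) HG)).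
by apply: evt_pos => eps i j _; rewrite /addf /subf /mulf /cstf mulN1r.
Qed.

Lemma CB_epsM k F : CB 0 k F -> CB 1 k (mulf epsf F).
Proof. by move=> H; exact: (CBM (CB_eps k) H). Qed.

Lemma CB_weaken k F : CB 1 k F -> CB 0 k F.
Proof.
elim: k F => [|k IH] F [bF H].
  split => // r rr0; have [c c0 hc] := bd_nonneg rr0 bF; exists c.
  apply: filterS3 hc near0_gt (near0_lt ltr01) => eps h e0 e1 i j hi hj.
  apply: le_trans (h i j hi hj) _; rewrite expr0 ler_wpM2l// expr1; exact: ltW.
have [H1 H2] := H; split; last by split; exact: IH.
move=> r rr0; have [c c0 hc] := bd_nonneg rr0 bF; exists c.
apply: filterS3 hc near0_gt (near0_lt ltr01) => eps h e0 e1 i j hi hj.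
by apply: le_trans (h i j hi hj) _; rewrite expr0 ler_wpM2l// expr1; exact: ltW.
Qed.

Lemma CBV k F : evt (fun eps i j => F eps i j != 0) -> bd 0 (invf F) ->
  CB 0 k F -> CB 0 k (invf F).
Proof.
move=> F0 bV; elim: k => [|k IH] HF; first by split.
have {}IH := IH (CB_pred HF); have [_ [H1 H2]] := HF.
split => //; split.
- apply: CB_eq (CB_cstM (-1) (CBM H1 (CBM IH (CB_t1 IH)))).
  apply: evt_and F0 (evt_shift1 F0) => eps i j n0 n1.
  (* The sign of [eps] is not at hand here; at [eps = 0] both sides vanish because [0^-1 = 0]. *)
  have [->|e0] := eqVneq eps 0; first by rewrite /mulf /d1 !invr0; ring.
  by rewrite /mulf /invf /cstf /d1 /t1; field; rewrite ?n0 ?n1 ?e0.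
- apply: CB_eq (CB_cstM (-1) (CBM H2 (CBM IH (CB_t2 IH)))).
  apply: evt_and F0 (evt_shift2 F0) => eps i j n0 n1.
  have [->|e0] := eqVneq eps 0; first by rewrite /mulf /d2 !invr0; ring.
  by rewrite /mulf /invf /cstf /d2 /t2; field; rewrite ?n0 ?n1 ?e0.
Qed.

(** * Discrete integration and Gronwall estimates *)

Lemma bd_int2 p G : bd p (d2 G) -> bd p (ax1 G) -> bd p G.
Proof.
move=> b2 b1 r rr0; have [c c0 hc] := bd_nonneg rr0 b2; have [d d0 hd] := bd_nonneg rr0 b1.
exists (d + c * r); apply: filterS3 hc hd near0_gt => eps h1 h2 e0 i j hi hj.
have H n : (n <= j)%N -> `|G eps i n| <= (d + c * (eps * n%:R)) * eps ^+ p.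
  elim: n => [|n IH] nj; first by rewrite !mulr0 addr0; exact: (h2 i j hi hj).
  have hn : eps * n%:R <= r.
    by apply: le_trans hj; rewrite ler_pM2l// ler_nat ltnW.
  have -> : G eps i n.+1 = G eps i n + eps * d2 G eps i n.
    by rewrite /d2; field; rewrite gt_eqF.
  apply: le_trans (ler_normD _ _) _.
  rewrite normrM (gtr0_norm e0) -natr1.
  have := IH (ltnW nj).
  have : eps * `|d2 G eps i n| <= eps * (c * eps ^+ p) by rewrite ler_pM2l// h1.
  by move: (eps ^+ p) => ep; lra.
apply: le_trans (H j (leqnn j)) _.
apply: ler_wpM2r; first by rewrite exprn_ge0 ?(ltW e0).
by rewrite lerD2l ler_wpM2l.
Qed.

(** Differences in the two directions commute, so [d1 G] is again integrated up the columns from its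
    axis values; differences in the second direction are given. *)
Lemma CB_int2 p k G : CB p k (d2 G) -> CB p k (ax1 G) -> CB p k G.
Proof.
elim: k G => [|k IH] G H2 H1; split => //; try (apply: bd_int2; [exact: CB_bd H2|exact: CB_bd H1]).
split; last exact: CB_pred.
have [_ [H21 _]] := H2; have [_ [H11 _]] := H1.
apply: IH; last exact: H11.
by apply: CB_eq H21; apply: evt_pos => eps i j _; rewrite /d1 /d2; ring.
Qed.

Lemma CB_int1 p k G : CB p k (d1 G) -> CB p k (ax2 G) -> CB p k G.
Proof.
move=> H1 H2; apply: (@CB_transpose _ _ (transpose G)).
apply: CB_int2; [exact: CB_transpose H1|exact: CB_transpose H2].
Qed.

Lemma CB_ax1 p k G : 0 < r0 -> CB p k G -> CB p k (ax1 G).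
Proof.
move=> r00; elim: k G => [|k IH] G [bG H]; have b : bd p (ax1 G).
- move=> r rr0; have [c c0 hc] := bd_nonneg rr0 bG; exists c.
  apply: filterS2 hc near0_gt => eps h e0 i j hi hj; apply: h => //.
  by rewrite mulr0; apply: le_trans hj; rewrite mulr_ge0// ltW.
- by split.
- move=> r rr0; have [c c0 hc] := bd_nonneg rr0 bG; exists c.
  apply: filterS2 hc near0_gt => eps h e0 i j hi hj; apply: h => //.
  by rewrite mulr0; apply: le_trans hj; rewrite mulr_ge0// ltW.
split => //; case: H => H1 H2; split; first exact: (IH (d1 G)).
by apply: CB_zero; apply: evt_pos => eps i j _; rewrite /d2 /ax1 subrr mul0r.
Qed.

Lemma pow_le_expR (x : R) n : 0 <= x -> (1 + x) ^+ n <= expR (n%:R * x).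
Proof.
move=> x0; rewrite expRM_natl lerXn2r ?nnegrE ?expR_ge0 ?expR_ge1Dx//.
by rewrite addr_ge0.
Qed.

Lemma bd_ode E A B : eqf (d1 E) (addf (mulf A E) B) ->
  (forall eps j, 0 < eps -> E eps 0%N j = 0) -> bd 0 A -> bd 1 B -> bd 1 E.
Proof.
move=> HE E0 bA bB r rr0.
have [a a0 ha] := bd_nonneg rr0 bA; have [b b0 hb] := bd_nonneg rr0 bB.
exists (b * expR (r * (a + 1))).
apply: filterS2 (filterI ha hb) (filterI (HE r rr0) near0_gt).
move=> eps [{}ha {}hb] [{}HE e0] i j hi hj; rewrite expr1.
(* [a] pays for the coefficient [A]; the extra [1] absorbs the source, since [b * eps] never exceeds
   the running bound. With [eps * i <= r] the power of [rho] is at most [expR (r * (a + 1))]. *)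
set rho := 1 + eps * (a + 1).
have rho1 : 1 <= rho by rewrite /rho lerDl mulr_ge0// ?(ltW e0)// addr_ge0.
have H n : (n <= i)%N -> `|E eps n j| <= b * eps * rho ^+ n.
  elim: n => [|n IH] ni; first by rewrite E0// normr0 expr0 mulr1 mulr_ge0// ltW.
  have hn : eps * n%:R <= r.
    by apply: le_trans hi; rewrite ler_pM2l// ler_nat ltnW.
  have -> : E eps n.+1 j = E eps n j + eps * d1 E eps n j.
    by rewrite /d1; field; rewrite gt_eqF.
  rewrite HE// /addf /mulf.
  have h1 := IH (ltnW ni); have := ha n j hn hj; have := hb n j hn hj.
  rewrite expr0 expr1 mulr1 => hB hA.
  have m0 : b * eps <= b * eps * rho ^+ n.
    by rewrite ler_peMr ?exprn_ege1// mulr_ge0// ltW.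
  apply: le_trans (ler_normD _ _) _; rewrite normrM (gtr0_norm e0).
  have : `|A eps n j * E eps n j + B eps n j| <= a * (b * eps * rho ^+ n) + b * eps.
    apply: le_trans (ler_normD _ _) _; rewrite normrM lerD// ler_pM//.
  rewrite exprS; set m := b * eps * rho ^+ n in h1 m0 * => hh.
  have -> : b * eps * (rho * rho ^+ n) = m + eps * (a * m + m) by rewrite /m /rho; ring.
  by apply: lerD => //; rewrite ler_pM2l//; apply: le_trans hh _; rewrite lerD2l.
apply: le_trans (H i (leqnn i)) _; rewrite mulrAC ler_wpM2r ?(ltW e0)// ler_wpM2l//.
have ea : 0 <= eps * (a + 1) by rewrite mulr_ge0// ?(ltW e0)// addr_ge0.
apply: le_trans (pow_le_expR i ea) _.
rewrite ler_expR mulrA ler_wpM2r ?addr_ge0// mulrC//.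
Qed.

(** Only the undifferentiated bound needs Gronwall: higher difference quotients are read off from
    the equation, and [E] is constant in the second index. *)
Lemma CB_ode k E A B : eqf (d1 E) (addf (mulf A E) B) ->
  (forall eps j, 0 < eps -> E eps 0%N j = 0) -> (forall eps i j, E eps i j.+1 = E eps i j) ->
  CB 0 k A -> CB 1 k B -> CB 1 k E.
Proof.
move=> HE E0 EJ; elim: k => [|k IH] HA HB;
  (split; first exact: bd_ode HE E0 (CB_bd HA) (CB_bd HB)) => //.
have {}IH := IH (CB_pred HA) (CB_pred HB); split.
- exact: CB_eq (eqf_sym HE) (CBD (CBM (CB_pred HA) IH) (CB_pred HB)).
- by apply: CB_zero; apply: evt_pos => eps i j _; rewrite /d2 EJ subrr mul0r.
Qed.

(** Here [V] and [W] stand for the two difference quotients of [E] at a point. The factor [4 * a]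
    comes from the two shifted values, each at most [2 * m] as [eps <= 1], and the [1] from the
    source. *)
Lemma goursat_step eps (a b m V E W A B : R) : 0 < eps <= 1 -> 0 <= a ->
  `|E| <= m -> `|V| <= m -> `|W| <= m -> `|A| <= a -> `|B| <= m ->
  `|V + eps * (A * ((E + eps * V) + (E + eps * W)) + B)| <= (1 + eps * (4 * a + 1)) * m.
Proof.
move=> /andP[e0 e1] a0 hE hV hW hA hB.
have m0 : 0 <= m by apply: le_trans hE.
have ev (X : R) : `|X| <= m -> `|E + eps * X| <= 2 * m.
  move=> hX; apply: le_trans (ler_normD _ _) _; rewrite normrM (gtr0_norm e0).
  have : eps * `|X| <= 1 * m by rewrite ler_pM// ltW.
  lra.
have h1 : `|A * ((E + eps * V) + (E + eps * W))| <= a * (4 * m).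
  rewrite normrM ler_pM//; apply: le_trans (ler_normD _ _) _.
  by have := ev _ hV; have := ev _ hW; lra.
have h2 : `|A * ((E + eps * V) + (E + eps * W)) + B| <= a * (4 * m) + m.
  by apply: le_trans (ler_normD _ _) _; lra.
apply: le_trans (ler_normD _ _) _; rewrite normrM (gtr0_norm e0).
have : eps * `|A * ((E + eps * V) + (E + eps * W)) + B| <= eps * (a * (4 * m) + m).
  by rewrite ler_pM2l.
lra.
Qed.

(** Gronwall for a second-order equation: [E], [d1 E] and [d2 E] are bounded together by a quantity
    growing geometrically in [i + j]. The equation carries [d1 E] upwards and [d2 E] to the right,
    each starting from its axis. *)
Lemma bd_goursat E A B :
  eqf (d2 (d1 E)) (addf (mulf A (addf (t1 E) (t2 E))) B) ->
  bd 0 A -> bd 1 B -> bd 1 (ax1 E) -> bd 1 (d1 (ax1 E)) -> bd 1 (d2 (ax2 E)) ->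
  bd 1 E.
Proof.
move=> HE bA bB bE bV bW r rr0.
have [a a0 ha] := bd_nonneg rr0 bA; have [b b0 hb] := bd_nonneg rr0 bB.
have [c c0 hc] := bd_nonneg rr0 bE; have [v v0 hv] := bd_nonneg rr0 bV.
have [w w0 hw] := bd_nonneg rr0 bW.
(* One constant above the source and all the axis data; in the exponent below, [2 * r] bounds
   [eps * (i + j)]. *)
set K := b + c + v + w.
exists (K * expR (2 * r * (4 * a + 1))).
apply: filterS3 (filterI ha hb) (filterI hc (filterI hv hw))
  (filterI (HE r rr0) (filterI near0_gt (near0_lt ltr01))).
move=> eps [{}ha {}hb] [{}hc [{}hv {}hw]] [{}HE [e0 e1]] i j hi hj.
set rho := 1 + eps * (4 * a + 1).
have rho1 : 1 <= rho by rewrite /rho lerDl mulr_ge0// ?(ltW e0)//; lra.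
have K0 : 0 <= K by rewrite /K; lra.
pose m n := K * eps * rho ^+ n.
have mK n x : 0 <= x <= K -> x * eps <= m n.
  move=> /andP[x0 xK]; rewrite /m; apply: (@le_trans _ _ (K * eps)).
    by rewrite ler_pM2r.
  by rewrite ler_peMr ?exprn_ege1// mulr_ge0// ltW.
have mS n : m n.+1 = rho * m n by rewrite /m exprS; ring.
have mle n : (1 + eps) * m n <= m n.+1.
  rewrite mS ler_wpM2r//; first by rewrite /m !mulr_ge0// ?(ltW e0)// exprn_ge0//; lra.
  by rewrite /rho lerD2l ler_peMr//; [exact: ltW|lra].
pose P i j := [/\ `|E eps i j| <= m (i + j)%N, `|d1 E eps i j| <= m (i + j)%N
                & `|d2 E eps i j| <= m (i + j)%N].
have e01 : 0 < eps <= 1 by rewrite e0 ltW.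
have E1 i' j' : E eps i'.+1 j' = E eps i' j' + eps * d1 E eps i' j'.
  by rewrite /d1; field; rewrite gt_eqF.
have E2 i' j' : E eps i' j'.+1 = E eps i' j' + eps * d2 E eps i' j'.
  by rewrite /d2; field; rewrite gt_eqF.
have stE i' j' : P i' j' -> `|E eps i'.+1 j'| <= m (i' + j').+1.
  move=> [h1 h2 _]; rewrite E1; apply: le_trans (mle _).
  apply: le_trans (ler_normD _ _) _; rewrite normrM (gtr0_norm e0) mulrDl mul1r.
  by rewrite lerD// ler_pM2l.
have stE' i' j' : P i' j' -> `|E eps i' j'.+1| <= m (i' + j').+1.
  move=> [h1 _ h2]; rewrite E2; apply: le_trans (mle _).
  apply: le_trans (ler_normD _ _) _; rewrite normrM (gtr0_norm e0) mulrDl mul1r.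
  by rewrite lerD// ler_pM2l.
have bK n i' j' : eps * i'%:R <= r -> eps * j'%:R <= r -> `|B eps i' j'| <= m n.
  move=> h1 h2; have := hb i' j' h1 h2; rewrite expr1 => h; apply: le_trans h _.
  by apply: mK; rewrite b0/= /K; lra.
have stV i' j' : eps * i'%:R <= r -> eps * j'%:R <= r -> P i' j' ->
    `|d1 E eps i' j'.+1| <= m (i' + j').+1.
  move=> h1 h2 [p1 p2 p3].
  have -> : d1 E eps i' j'.+1 = d1 E eps i' j' + eps * d2 (d1 E) eps i' j'.
    by rewrite [d2 (d1 E) _ _ _]/d2; field; rewrite gt_eqF.
  rewrite HE// /addf /mulf /t1 /t2 E1 E2 mS; apply: (@goursat_step _ _ 0) => //.
    by have := ha i' j' h1 h2; rewrite expr0 mulr1.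
  exact: bK.
have stW i' j' : eps * i'%:R <= r -> eps * j'%:R <= r -> P i' j' ->
    `|d2 E eps i'.+1 j'| <= m (i' + j').+1.
  move=> h1 h2 [p1 p2 p3].
  have -> : d2 E eps i'.+1 j' = d2 E eps i' j' + eps * d2 (d1 E) eps i' j'.
    by rewrite /d2 /d1; field; rewrite gt_eqF.
  rewrite HE// /addf /mulf /t1 /t2 E1 E2 mS addrC (addrC (E eps i' j' + _)) addrC.
  apply: (@goursat_step _ _ 0) => //.
    by have := ha i' j' h1 h2; rewrite expr0 mulr1.
  exact: bK.
have r00 : 0 <= r by apply: le_trans hi; rewrite mulr_ge0// ltW.
have v1 i' n : eps * i'%:R <= r -> `|d1 E eps i' 0%N| <= m n.
  move=> h; have := hv i' 0%N h; rewrite mulr0 expr1 => /(_ r00) h'.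
  by apply: le_trans h' (mK _ _ _); rewrite v0/= /K; lra.
have w1 j' n : eps * j'%:R <= r -> `|d2 E eps 0%N j'| <= m n.
  move=> h; have := hw 0%N j'; rewrite mulr0 expr1 => /(_ r00 h) h'.
  by apply: le_trans h' (mK _ _ _); rewrite w0/= /K; lra.
have dS n x : eps * n.+1%:R <= x -> eps * n%:R <= x.
  by apply: le_trans; rewrite ler_pM2l// ler_nat.
have H : P i j.
  elim: j i hi hj => [|j IHj]; elim=> [|i IHi] hi hj.
  - split; [|exact: v1|exact: w1].
    have := hc 0%N 0%N; rewrite mulr0 expr1 => /(_ r00 r00) h.
    by apply: le_trans h (mK _ _ _); rewrite c0/= /K; lra.
  - have Pi := IHi (dS _ _ hi) hj; split; [|exact: v1|]; rewrite addSn.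
      exact: stE.
    by apply: stW => //; exact: dS.
  - have Pj := IHj 0%N hi (dS _ _ hj); split; [| |exact: w1]; rewrite addnS.
      exact: stE'.
    by apply: stV => //; exact: dS.
  - have Pi := IHi (dS _ _ hi) hj; have Pj := IHj i.+1 hi (dS _ _ hj); split.
    + by rewrite addSn; exact: stE.
    + by rewrite addnS; apply: stV => //; exact: dS.
    + by rewrite addSn; apply: stW => //; exact: dS.
case: H => H _ _; apply: le_trans H _; rewrite expr1 /m mulrAC ler_pM2r//.
rewrite ler_wpM2l//.
have ea : 0 <= eps * (4 * a + 1) by rewrite mulr_ge0// ?(ltW e0)//; lra.
apply: le_trans (pow_le_expR (i + j) ea) _.
rewrite ler_expR mulrA ler_wpM2r//; first by lra.
by rewrite natrD; lra.
Qed.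

(** Each round gains one order: the equation expresses [d2 (d1 E)] through values of [E], so it
    inherits order [k]; one integration from either axis then gives [d1 E] and [d2 E] at order [k],
    that is, [E] at order [k + 1]. *)
Lemma CB_goursat E A B : (forall k, CB 0 k A) -> (forall k, CB 1 k B) ->
  (forall k, CB 1 k (ax1 E)) -> (forall k, CB 1 k (ax2 E)) ->
  eqf (d2 (d1 E)) (addf (mulf A (addf (t1 E) (t2 E))) B) ->
  forall k, CB 1 k E.
Proof.
move=> HA HB H1 H2 HE; elim=> [|k IH].
  split => //; apply: bd_goursat HE (CB_bd (HA 0%N)) (CB_bd (HB 0%N)) (CB_bd (H1 0%N)) _ _.
  - by have [_ [[h _] _]] := H1 1%N.
  - by have [_ [_ [h _]]] := H2 1%N.
have HR : CB 1 k (d2 (d1 E)).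
  by apply: CB_eq (eqf_sym HE) (CBD (CBM (HA k) (CBD (CB_t1 IH) (CB_t2 IH))) (HB k)).
split; first exact: CB_bd IH; split.
- by apply: CB_int2 => //; have [_ [h _]] := H1 k.+1.
- apply: CB_int1; last by have [_ [_ h]] := H2 k.+1.
  by apply: CB_eq HR; apply: evt_pos => eps i j _; rewrite /d1 /d2; ring.
Qed.

End Lattice.

(** * Restriction of smooth functions to the lattice *)

Section Sampling.
Variable R : realType.
Implicit Types (Phi Psi : R -> R * R -> R) (p k : nat) (F : R * R -> R) (u : R * R) (eps : R).

(* [UB p k Phi]: the functions [Phi eps] and their partial derivatives of order
   at most k are O(eps^p), uniformly on every box. *)
Definition ubd p Phi : Prop := forall B : R, exists c,
  \forall eps \near 0^'+, forall x y, `|x| <= B -> `|y| <= B ->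
    `|Phi eps (x, y)| <= c * eps ^+ p.

Fixpoint UB p k Phi : Prop :=
  ubd p Phi /\ if k is m.+1 then exists Phi1 Phi2,
    [/\ forall eps u, is_derive u.1 1 (fun s => Phi eps (s, u.2)) (Phi1 eps u),
        forall eps u, is_derive u.2 1 (fun t => Phi eps (u.1, t)) (Phi2 eps u),
        UB p m Phi1 & UB p m Phi2] else True.

Definition sample Phi : family R := fun eps i j => Phi eps (eps * i%:R, eps * j%:R).

(** The quotient is formed on the whole plane before sampling, so that it can be differentiated and
    the passage from derivatives to differences iterated. *)
Definition quot1 Phi eps u : R := (Phi eps (u.1 + eps, u.2) - Phi eps u) / eps.

Lemma UB_ubd p k Phi : UB p k Phi -> ubd p Phi.
Proof. by case: k => [|k] []. Qed.

Lemma UB_flip p k Phi : UB p k Phi -> UB p k (fun eps u => Phi eps (flip u)).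
Proof.
elim: k Phi => [|k IH] Phi [bP H]; split => //.
- by move=> B; have [c hc] := bP B; exists c; apply: filterS hc => eps h x y hx hy; apply: h.
- by move=> B; have [c hc] := bP B; exists c; apply: filterS hc => eps h x y hx hy; apply: h.
have [P1 [P2 [h1 h2 U1 U2]]] := H.
exists (fun eps u => P2 eps (flip u)), (fun eps u => P1 eps (flip u)); split.
- by move=> eps u; exact: (h2 eps (flip u)).
- by move=> eps u; exact: (h1 eps (flip u)).
- exact: IH.
- exact: IH.
Qed.

Lemma is_derive_shift (f : R -> R) (e x d : R) :
  is_derive (x + e) 1 f d -> is_derive x 1 (fun s => f (s + e)) d.
Proof.
move=> h; have := @is_derive1_comp R f (fun s => s + e) x d 1 h _.
rewrite mulr1; apply.
by apply: is_derive_eq; rewrite addr0.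
Qed.

Lemma is_derive_quot (f g : R -> R) (e x df dg : R) :
  is_derive x 1 f df -> is_derive x 1 g dg ->
  is_derive x 1 (fun s => (f s - g s) / e) ((df - dg) / e).
Proof.
move=> hf hg; apply: is_derive_eq.
by rewrite /GRing.scale/= ?mulr0 ?add0r mulrC.
Qed.

Lemma ubd_quot1 p Phi Phi1 : ubd p Phi1 ->
  (forall eps u, is_derive u.1 1 (fun s => Phi eps (s, u.2)) (Phi1 eps u)) ->
  ubd p (quot1 Phi).
Proof.
move=> bP dP B; have [c hc] := bP (B + 1); exists c.
apply: filterS3 hc (near0_gt R) (near0_lt (@ltr01 R)) => eps h e0 e1 x y hx hy.
rewrite /quot1/= normrM normfV (gtr0_norm e0) ler_pdivrMr//.
have xe : x <= x + eps by rewrite lerDl ltW.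
have := @derive_norm_leM R (fun s => Phi eps (s, y)) (fun s => Phi1 eps (s, y)) (c * eps ^+ p) _ _ xe.
have -> : x + eps - x = eps by ring.
apply; first by move=> t _; exact: (dP eps (t, y)).
move=> t /andP[t1 t2]; apply: h; last by lra.
by have := hx; rewrite !ler_norml => /andP[? ?]; apply/andP; split; lra.
Qed.

Lemma UB_quot1 p k Phi : UB p k.+1 Phi -> UB p k (quot1 Phi).
Proof.
elim: k Phi => [|k IH] Phi [bP [P1 [P2 [h1 h2 U1 U2]]]].
  by split => //; apply: ubd_quot1 h1; exact: (U1.1).
split; first by apply: ubd_quot1 h1; exact: (U1.1).
exists (quot1 P1), (quot1 P2); split; [| |exact: IH|exact: IH].
- move=> eps u.
  apply: (@is_derive_quot (fun s => Phi eps (s + eps, u.2)) (fun s => Phi eps (s, u.2))).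
  apply: (@is_derive_shift (fun s => Phi eps (s, u.2))); exact: (h1 eps (_, _)).
- move=> eps u.
  apply: (@is_derive_quot (fun t => Phi eps (u.1 + eps, t)) (fun t => Phi eps (u.1, t))).
  exact: (h2 eps (u.1 + eps, u.2)).
Qed.

(** A difference quotient of samples is the sample of [quot1], which by the mean value inequality
    costs one derivative. *)
Lemma CB_sample r0 p k Phi : UB p k Phi -> CB r0 p k (sample Phi).
Proof.
elim: k Phi => [|k IH] Phi H; have b : bd r0 p (sample Phi).
- move=> r rr0; have [c hc] := UB_ubd H r; exists c.
  apply: filterS2 hc (near0_gt R) => eps h e0 i j hi hj.
  by apply: h; rewrite ger0_norm// mulr_ge0// ltW.
- by split.
- move=> r rr0; have [c hc] := UB_ubd H r; exists c.
  apply: filterS2 hc (near0_gt R) => eps h e0 i j hi hj.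
  by apply: h; rewrite ger0_norm// mulr_ge0// ltW.
have e (G : R -> R * R -> R) : d1 (sample G) = sample (quot1 G).
  apply/funext => eps; apply/funext => i; apply/funext => j.
  by rewrite /d1 /sample /quot1/= -natr1 mulrDr mulr1.
split => //; split; first by rewrite e; exact: IH (UB_quot1 H).
have := CB_transpose (IH _ (UB_quot1 (UB_flip H))); rewrite -e.
exact.
Qed.

Lemma ubd_smooth F : continuous F -> ubd 0 (fun _ => F).
Proof.
move=> cF B; have [K K0 FK] := box_bounded B cF; exists K.
by apply: filterS (near0_gt R) => eps _ x y hx hy; rewrite expr0 mulr1 FK.
Qed.

Lemma UB_smooth k F : smooth2 F -> UB 0 k (fun _ => F).
Proof.
elim: k F => [|k IH] F sF; split => //; try exact: ubd_smooth (smooth2_continuous sF).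
exists (fun _ => partial1 F), (fun _ => partial2 F); split.
- by move=> _ u; exact: smooth2_derive1.
- by move=> _ u; exact: smooth2_derive2.
- exact: IH (smooth2_partial1 sF).
- exact: IH (smooth2_partial2 sF).
Qed.

(** * Consistency error of forward differences *)

Definition rem1 F eps u : R := quot1 (fun _ => F) eps u - partial1 F u.

(** Mean value inequality twice: a bound on the second derivative controls the variation of
    [partial1 F] over one step, and this controls the deviation of [F] from its tangent. *)
Lemma ubd_rem1 F : smooth2 F -> ubd 1 (rem1 F).
Proof.
move=> sF B.
have [K K0 FK] := box_bounded (B + 1) (smooth2_continuous (smooth2_partial1 (smooth2_partial1 sF))).
exists K; apply: filterS2 (near0_gt R) (near0_lt (@ltr01 R)) => eps e0 e1 x y hx hy.
have bx t : x <= t <= x + eps -> `|t| <= B + 1.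
  by have := hx; rewrite !ler_norml => /andP[? ?] /andP[? ?]; apply/andP; split; lra.
have xe : x <= x + eps by rewrite lerDl ltW.
have yB : `|y| <= B + 1 by lra.
have e : x + eps - x = eps by ring.
have h1 t : x <= t <= x + eps -> `|partial1 F (t, y) - partial1 F (x, y)| <= K * eps.
  move=> /andP[xt te].
  have := @derive_norm_leM R (fun s => partial1 F (s, y)) (fun s => partial1 (partial1 F) (s, y)) K _ _ xt.
  move=> /(_ _ _)/le_trans; apply.
  - by move=> s _; exact: (@smooth2_derive1 _ _ (s, y) (smooth2_partial1 sF)).
  - by move=> s /andP[s1 s2]; apply: FK => //; apply: bx; rewrite s1; exact: le_trans te.
  - by rewrite ler_wpM2l//; lra.
have := @derive_norm_leM R (fun s => F (s, y) - s * partial1 F (x, y))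
   (fun s => partial1 F (s, y) - partial1 F (x, y)) (K * eps) _ _ xe _ h1.
rewrite e => h2.
have E : rem1 F eps (x, y) * eps = F (x + eps, y) - (x + eps) * partial1 F (x, y) -
    (F (x, y) - x * partial1 F (x, y)).
  by rewrite /rem1 /quot1/=; field; rewrite gt_eqF.
rewrite expr1 -(ler_pM2r e0).
have -> : `|rem1 F eps (x, y)| * eps = `|rem1 F eps (x, y) * eps|.
  by rewrite normrM (gtr0_norm e0).
rewrite E; apply: h2 => t _.
have ? := @smooth2_derive1 _ F (t, y) sF.
by apply: is_derive_eq; rewrite /GRing.scale/= mulr1 mulr0 add0r.
Qed.

(** [rem1] commutes with both partial derivatives, in the second variable by symmetry of mixed
    derivatives; so derivatives of remainders are remainders again. *)
Lemma UB_rem1 k F : smooth2 F -> UB 1 k (rem1 F).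
Proof.
elim: k F => [|k IH] F sF; split => //; try exact: ubd_rem1.
have dB (f g : R -> R) (x df dg : R) : is_derive x 1 f df -> is_derive x 1 g dg ->
  is_derive x 1 (fun s => f s - g s) (df - dg) by move=> ? ?; exact: is_deriveB.
exists (rem1 (partial1 F)), (rem1 (partial2 F)); split.
- move=> eps u.
  apply: (dB (fun s => quot1 (fun _ => F) eps (s, u.2)) (fun s => partial1 F (s, u.2)));
    last exact: smooth2_derive1 (smooth2_partial1 sF).
  apply: (@is_derive_quot (fun s => F (s + eps, u.2)) (fun s => F (s, u.2)));
    last exact: smooth2_derive1.
  apply: (@is_derive_shift (fun s => F (s, u.2))).
  exact: (@smooth2_derive1 _ F (_, _)).
- move=> eps u.
  apply: (dB (fun t => quot1 (fun _ => F) eps (u.1, t)) (fun t => partial1 F (u.1, t))); last first.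
    have c12 := smooth2_continuous (smooth2_partial1 (smooth2_partial2 sF)).
    have <- := partials_commute sF c12 (fun=> erefl) u.
    exact: smooth2_derive2 (smooth2_partial1 sF).
  apply: (@is_derive_quot (fun t => F (u.1 + eps, t)) (fun t => F (u.1, t)));
    last exact: smooth2_derive2.
  exact: (@smooth2_derive2 _ F (u.1 + eps, u.2)).
- exact: IH (smooth2_partial1 sF).
- exact: IH (smooth2_partial2 sF).
Qed.

Definition restr F : family R := fun eps i j => F (eps * i%:R, eps * j%:R).

Lemma CB_restr r0 k F : smooth2 F -> CB r0 0 k (restr F).
Proof. by move=> sF; exact: CB_sample (UB_smooth k sF). Qed.

Lemma CB_restr_d1 r0 k F : smooth2 F ->
  CB r0 1 k (subf (d1 (restr F)) (restr (partial1 F))).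
Proof.
move=> sF; apply: CB_eq (CB_sample r0 (UB_rem1 k sF)); apply: evt_pos => eps i j _.
by rewrite /subf /d1 /restr /sample /rem1 /quot1/= -natr1 mulrDr mulr1.
Qed.

Lemma partial_flip F : partial1 (F \o @flip R) = partial2 F \o @flip R.
Proof. by []. Qed.

Lemma partial_flip2 F : partial2 (F \o @flip R) = partial1 F \o @flip R.
Proof. by []. Qed.

Lemma smooth2_flip F : smooth2 F -> smooth2 (F \o @flip R).
Proof.
move=> sF n; elim: n F sF => [|n IH] F sF.
  by split=> // u _; exact: (continuous_flip (smooth2_continuous sF)).
split; first by move=> u _; exact: (continuous_flip (smooth2_continuous sF)).
split.
- move=> u _; split.
    by have [] := smooth2_derive2 (flip u) sF.
  by have [] := smooth2_derive1 (flip u) sF.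
- by rewrite partial_flip; apply: IH; exact: smooth2_partial2.
- by rewrite partial_flip2; apply: IH; exact: smooth2_partial1.
Qed.

Lemma CB_restr_d2 r0 k F : smooth2 F ->
  CB r0 1 k (subf (d2 (restr F)) (restr (partial2 F))).
Proof. by move=> sF; exact: (CB_transpose (CB_restr_d1 r0 k (smooth2_flip sF))). Qed.

(* The discrete equation reads
   [d2 (d1 T) = q / 2 * (t1 T + t2 T)], and the continuous solution satisfies
   it up to a smooth error of order eps. *)
Lemma net_converges r0 (q F : R * R -> R) (T : family R) :
  smooth2 q -> smooth2 F -> (forall u, partial1 (partial2 F) u = q u * F u) ->
  (forall eps i j, 0 < eps -> T eps i.+1 j.+1 + T eps i j =
    (1 + 2^-1 * eps ^+ 2 * q (eps * i%:R, eps * j%:R)) * (T eps i.+1 j + T eps i j.+1)) ->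
  (forall k, CB r0 1 k (ax1 (subf T (restr F)))) ->
  (forall k, CB r0 1 k (ax2 (subf T (restr F)))) ->
  forall k, CB r0 1 k (subf T (restr F)).
Proof.
move=> sq sF FE TE H1 H2.
set A := mulf (cstf (2^-1)) (restr q).
set X := restr F.
set B := subf (mulf A (addf (t1 X) (t2 X))) (d2 (d1 X)).
have HA k : CB r0 0 k A by apply: CB_cstM; exact: CB_restr.
apply: (@CB_goursat _ r0 _ A B) => // [k|].
(* Since [t1 X + t2 X = 2 X + eps (d1 X + d2 X)], the mean over neighbours leaves [c1]. Replacing
   first [d2], then [d1] in [d2 (d1 X)] by derivatives leaves [c2] and [c3]. What remains cancels by
   [FE]. *)
- have c1 : CB r0 1 k (mulf (@epsf R) (mulf A (addf (d1 X) (d2 X)))).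
    apply: CB_epsM; apply: (@CBM _ r0 0 0); first exact: HA.
    have [_ [h1 h2]] := CB_restr r0 k.+1 sF; exact: CBD h1 h2.
  have c2 : CB r0 1 k (d1 (subf (d2 X) (restr (partial2 F)))).
    by have [_ [h _]] := CB_restr_d2 r0 k.+1 sF.
  have c3 := CB_restr_d1 r0 k (smooth2_partial2 sF).
  apply: CB_eq (CBB (CBB c1 c2) c3); apply: evt_pos => eps i j e0.
  rewrite /B /addf /subf /mulf /d1 /d2 /t1 /t2 /X /A /epsf /cstf /mulf /restr FE.
  by field; rewrite gt_eqF.
- apply: evt_pos => eps i j e0.
  have := TE eps i j e0.
  rewrite /B /A /X /addf /subf /mulf /d1 /d2 /t1 /t2 /cstf /restr.
  have E (a b : R) : a * eps ^+ 2 = b * eps ^+ 2 -> a = b.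
    by move=> /mulIf; apply; rewrite expf_eq0/= gt_eqF.
  move=> h; apply: E.
  have -> : T eps i.+1 j.+1 = (1 + 2^-1 * eps ^+ 2 * q (eps * i%:R, eps * j%:R)) *
    (T eps i.+1 j + T eps i j.+1) - T eps i j by rewrite -h; ring.
  by field; rewrite gt_eqF.
Qed.

End Sampling.

(** * The smooth Moutard transform *)

Section Potential.
Variable R : realType.
Implicit Types (u : R * R) (p : R -> R) (r : R).

Lemma smooth_on_setT (V : normedModType R) (F : R * R -> V) :
  smooth_on setT F -> forall n, Cn_on n setT F.
Proof. by move=> [U [oU TU CF]] n; exact: Cn_on_sub TU (CF n). Qed.

(** Lets the calculus of [Cn_on] in the plane establish smoothness on the line. *)
Lemma smooth1_of_smooth2 (a : R -> R) : smooth2 (fun u : R * R => a u.1) -> smooth1 a.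
Proof.
have H n (b : R -> R) : smooth2 (fun u : R * R => b u.1) ->
    smooth2 (fun u : R * R => derive1n n b u.1).
  elim: n => [//|n IH] /IH sb.
  have -> : (fun u : R * R => derive1n n.+1 b u.1) = partial1 (fun u : R * R => derive1n n b u.1).
    by apply/funext => u; rewrite derive1nS.
  exact: smooth2_partial1.
move=> /H sa n x.
by have [] := @smooth2_derive1 _ _ (x, 0) (sa n).
Qed.

(** Axis values of [th]: the solution of [a' = - p a] with [a 0 = 1]. *)
Definition exp_prim p (x : R) : R := expR (- prim p x).

Lemma is_derive_exp_prim p (x : R) : continuous p ->
  is_derive x 1 (exp_prim p) (- p x * exp_prim p x).
Proof.
move=> cp; have ? := is_derive_prim x cp.
by apply: is_derive_eq; rewrite /exp_prim mulrC.
Qed.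

Lemma smooth1_exp_prim p : smooth1 p -> smooth1 (exp_prim p).
Proof.
move=> sp; have cp := smooth1_continuous sp.
have ca : continuous (exp_prim p).
  by move=> x; apply: derivable_continuous; have [] := is_derive_exp_prim x cp.
have cA : continuous (fun u : R * R => exp_prim p u.1).
  by move=> u; apply: (@continuous_comp _ _ _ fst (exp_prim p)); [exact: cvg_fst|exact: ca].
apply: smooth1_of_smooth2; elim=> [|n IH]; first by split => // u _; exact: cA.
apply: (@Cn_on_S _ _ n setT _ (fun u => - p u.1 * exp_prim p u.1) (cst 0)) => //.
- exact: openT.
- by move=> u _; exact: cA.
- by move=> u _; exact: is_derive_exp_prim.
- by move=> u _; exact: (is_derive_cst (exp_prim p u.1)).
- apply: Cn_onM => //; first exact: openT.
  by apply: Cn_onN; [exact: openT|exact: (smooth2_fst sp)].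
- by apply: Cn_on_cst; exact: openT.
Qed.

Lemma exp_prim0 p : exp_prim p 0 = 1.
Proof. by rewrite /exp_prim prim0 oppr0 expR0. Qed.

(** This box decides the size of the final square. The margin [1 / 2], rather than mere positivity,
    also keeps the discrete solution away from zero. *)
Lemma half_box (th : R * R -> R) : continuous th -> th (0, 0) = 1 ->
  exists2 r1, 0 < r1 & forall x y, `|x| < r1 -> `|y| < r1 -> 1 / 2 < th (x, y).
Proof.
move=> cth th0.
have h2 : 0 < (1 / 2 : R) by lra.
have /cvgr_dist_lt/(_ _ h2) [[X Y] /= [nX nY] XY] := cth (0, 0).
have /nbhs_ballP[d1 d10 h1] := nX; have /nbhs_ballP[d2 d20 {}h2] := nY.
exists (Num.min d1 d2); first by rewrite lt_min; apply/andP.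
move=> x y; rewrite !lt_min => /andP[x1 _] /andP[_ y2].
have := XY (x, y); rewrite /= th0.
have bX : X x by apply: h1; rewrite /ball/= sub0r normrN.
have bY : Y y by apply: h2; rewrite /ball/= sub0r normrN.
by move=> /(_ (conj bX bY)); rewrite ltr_norml => /andP[]; lra.
Qed.

Definition obox r : set (R * R) := [set u | `|u.1| < r /\ `|u.2| < r].

Lemma open_obox r : open (obox r).
Proof.
have on : open [set x : R | x < r] by exact: open_lt.
apply: openI.
- have h : continuous (fun u : R * R => `|u.1|).
    by move=> u; apply: cvg_norm; exact: cvg_fst.
  exact: (open_comp (fun u _ => h u) on).
- have h : continuous (fun u : R * R => `|u.2|).
    by move=> u; apply: cvg_norm; exact: cvg_snd.
  exact: (open_comp (fun u _ => h u) on).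
Qed.

Lemma square_obox r r1 : r < r1 -> square r `<=` obox r1.
Proof.
move=> rr1 u [/andP[x0 xr] /andP[y0 yr]].
by split; rewrite ger0_norm//; exact: le_lt_trans rr1.
Qed.

End Potential.

Section Transform.
Variables (R : realType) (N : nat).
Variables (q : R * R -> R) (f : R * R -> 'rV[R]_N) (fp0 : 'rV[R]_N).
Variables (p10 p20 : R -> R) (th : R * R -> R) (h : 'I_N -> R * R -> R) (r1 : R).
Implicit Types (u : R * R) (k : 'I_N).
Local Notation F k := (fun u : R * R => f u 0 k).

Hypothesis sq : smooth2 q.
Hypothesis sf : forall n, Cn_on n setT f.
Hypothesis f12 : forall u, partial1 (partial2 f) u = q u *: f u.
Hypothesis sth : smooth2 th.
Hypothesis th12 : forall u, partial1 (partial2 th) u = q u * th u /\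
               partial2 (partial1 th) u = q u * th u.
Hypothesis thx : forall x, th (x, 0) = exp_prim p10 x.
Hypothesis thy : forall y, th (0, y) = exp_prim p20 y.
Hypotheses (sp10 : smooth1 p10) (sp20 : smooth1 p20).
Hypothesis sh : forall k, smooth2 (h k).
Hypothesis h0 : forall k, h k (0, 0) = fp0 0 k.
Hypothesis h_1 : forall k u, partial1 (h k) u =
  partial1 th u * F k u - th u * partial1 (F k) u.
Hypothesis h_2 : forall k u, partial2 (h k) u =
  th u * partial2 (F k) u - partial2 th u * F k u.
Hypothesis th_gt : forall x y, `|x| < r1 -> `|y| < r1 -> 1 / 2 < th (x, y).

Let U := obox r1.
Let oU : open U := @open_obox R r1.

Lemma smooth2_coord (g : R * R -> 'rV[R]_N) k :
  (forall n, Cn_on n setT g) -> smooth2 (fun u => g u 0 k).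
Proof. by move=> sg n; apply: Cn_on_coord => //; exact: openT. Qed.

Lemma smooth2_Cn_on (G : R * R -> R) n (W : set (R * R)) : smooth2 G -> Cn_on n W G.
Proof. by move=> sG; exact: (@Cn_on_sub _ _ n setT) (sG n). Qed.

Lemma th_neq0 u : U u -> th u != 0.
Proof.
by case: u => x y [/= hx hy]; have := th_gt hx hy => hh; rewrite gt_eqF//; lra.
Qed.

Definition moutard_fp u : 'rV[R]_N := \row_k (h k u / th u).
Definition moutard_p1 u : R := - partial1 th u / th u.
Definition moutard_p2 u : R := - partial2 th u / th u.

Lemma Cn_on_thV n : Cn_on n U (fun u => (th u)^-1).
Proof. by apply: Cn_onV => //; [exact: th_neq0|exact: smooth2_Cn_on]. Qed.

Lemma Cn_on_fp n : Cn_on n U moutard_fp.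
Proof.
apply: Cn_on_row => // k.
apply: (@Cn_on_eq _ _ n U (fun u => h k u * (th u)^-1)) => //.
  by move=> u _; rewrite mxE.
by apply: Cn_onM => //; [exact: smooth2_Cn_on|exact: Cn_on_thV].
Qed.

Lemma Cn_on_p1 n : Cn_on n U moutard_p1.
Proof.
apply: Cn_onM => //; last exact: Cn_on_thV.
by apply: Cn_onN => //; exact: smooth2_Cn_on (smooth2_partial1 sth).
Qed.

Lemma Cn_on_p2 n : Cn_on n U moutard_p2.
Proof.
apply: Cn_onM => //; last exact: Cn_on_thV.
by apply: Cn_onN => //; exact: smooth2_Cn_on (smooth2_partial2 sth).
Qed.

Lemma is_derive_div (a b : R -> R) (x da db : R) : b x != 0 ->
  is_derive x 1 a da -> is_derive x 1 b db ->
  is_derive x 1 (fun s => a s / b s) (da / b x - a x * db / b x ^+ 2).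
Proof.
move=> bx ha hb.
have := is_deriveM ha (@is_deriveV R b x db 1 bx hb).
move=> /is_derive_eq; apply.
by rewrite /GRing.scale/=; field.
Qed.

Lemma partial1_div (a b : R * R -> R) u : b u != 0 -> smooth2 a -> smooth2 b ->
  partial1 (fun u => a u / b u) u = partial1 a u / b u - a u * partial1 b u / b u ^+ 2.
Proof.
case: u => x y bu sa sb; apply: is_derive_derive1.
exact: (is_derive_div bu (@smooth2_derive1 _ a (x, y) sa) (@smooth2_derive1 _ b (x, y) sb)).
Qed.

Lemma partial2_div (a b : R * R -> R) u : b u != 0 -> smooth2 a -> smooth2 b ->
  partial2 (fun u => a u / b u) u = partial2 a u / b u - a u * partial2 b u / b u ^+ 2.
Proof.
case: u => x y bu sa sb; apply: is_derive_derive1.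
exact: (is_derive_div bu (@smooth2_derive2 _ a (x, y) sa) (@smooth2_derive2 _ b (x, y) sb)).
Qed.

Lemma partial1_coord (g : R * R -> 'rV[R]_N) u k (W : set (R * R)) :
  W u -> Cn_on 1 W g -> partial1 g u 0 k = partial1 (fun u => g u 0 k) u.
Proof.
move=> Wu sg; symmetry; apply: is_derive_derive1.
exact: (is_derive_coord k (Cn_on_partial1 sg Wu)).
Qed.

Lemma partial2_coord (g : R * R -> 'rV[R]_N) u k (W : set (R * R)) :
  W u -> Cn_on 1 W g -> partial2 g u 0 k = partial2 (fun u => g u 0 k) u.
Proof.
move=> Wu sg; symmetry; apply: is_derive_derive1.
exact: (is_derive_coord k (Cn_on_partial2 sg Wu)).
Qed.

Lemma moutard_eqs u : U u ->
  partial1 moutard_fp u + partial1 f u = moutard_p1 u *: (moutard_fp u - f u) /\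
  partial2 moutard_fp u - partial2 f u = moutard_p2 u *: (moutard_fp u + f u).
Proof.
move=> Uu; have tu := th_neq0 Uu; split; apply/rowP => k; rewrite !mxE.
- rewrite (partial1_coord k Uu (Cn_on_fp 1)) (partial1_coord k (I : setT u) (sf 1)).
  have -> : (fun u => moutard_fp u 0 k) = (fun u => h k u / th u).
    by apply/funext => v; rewrite mxE.
  by rewrite partial1_div// h_1 /moutard_p1; field.
- rewrite (partial2_coord k Uu (Cn_on_fp 1)) (partial2_coord k (I : setT u) (sf 1)).
  have -> : (fun u => moutard_fp u 0 k) = (fun u => h k u / th u).
    by apply/funext => v; rewrite mxE.
  by rewrite partial2_div// h_2 /moutard_p2; field.
Qed.

Lemma moutard_p_eqs u : U u ->
  partial1 moutard_p2 u = partial2 moutard_p1 u /\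
  partial2 moutard_p1 u = - q u + moutard_p1 u * moutard_p2 u.
Proof.
move=> Uu; have tu := th_neq0 Uu.
have sN (G : R * R -> R) : smooth2 G -> smooth2 (fun u => - G u).
  by move=> sG n; apply: Cn_onN => //; exact: openT.
have N1 (G : R * R -> R) : smooth2 G -> partial1 (fun u => - G u) u = - partial1 G u.
  move=> sG; apply: is_derive_derive1; have ? := smooth2_derive1 u sG.
  exact: is_deriveN.
have N2 (G : R * R -> R) : smooth2 G -> partial2 (fun u => - G u) u = - partial2 G u.
  move=> sG; apply: is_derive_derive1; have ? := smooth2_derive2 u sG.
  exact: is_deriveN.
have s1 := smooth2_partial1 sth; have s2 := smooth2_partial2 sth.
have [e1 e2] := th12 u.
rewrite /moutard_p1 /moutard_p2 !(partial1_div, partial2_div) ?N1 ?N2 ?e1 ?e2//; try exact: sN.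
by split; field.
Qed.

(** The relation for [partial2 moutard_fp] holds on an open set, so it may be differentiated in the
    first direction; inserting the other relations yields the transformed potential. *)
Lemma moutard_net u : U u -> partial1 (partial2 moutard_fp) u =
  (- q u + 2 * moutard_p1 u * moutard_p2 u) *: moutard_fp u.
Proof.
move=> Uu; apply: is_derive_derive1; apply: is_derive_row => k.
set G := fun v => moutard_p2 v * (moutard_fp v 0 k + f v 0 k) + partial2 f v 0 k.
have GE v : U v -> partial2 moutard_fp v 0 k = G v.
  move=> /moutard_eqs[_] /(congr1 (fun M : 'rV[R]_N => M 0 k)); rewrite !mxE /G [moutard_fp v 0 k]mxE => <-.
  ring.
have [e1 _] := moutard_eqs Uu; have [e3 e4] := moutard_p_eqs Uu.
have d1 := Cn_on_partial1 (Cn_on_p2 1) Uu.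
have d2 := is_derive_coord k (Cn_on_partial1 (Cn_on_fp 1) Uu).
have d3 := is_derive_coord k (Cn_on_partial1 (sf 1) (I : setT u)).
have sf2 : Cn_on 1 setT (partial2 f) by have [_ []] := sf 2.
have d4 := is_derive_coord k (Cn_on_partial1 sf2 (I : setT u)).
have dG := is_deriveD (is_deriveM d1 (is_deriveD d2 d3)) d4.
have nG : \forall s \near u.1, partial2 moutard_fp (s, u.2) 0 k = G (s, u.2).
  by apply: filterS (open_slice1 oU Uu) => s /GE.
apply: (near_eq_is_derive (f := fun s => G (s, u.2))).
  by apply: filterS nG => s ->.
move: dG => /is_derive_eq; apply.
have {}e1 := congr1 (fun M : 'rV[R]_N => M 0 k) e1; rewrite !mxE in e1.
have -> : partial1 moutard_fp u 0 k =
   moutard_p1 u * (moutard_fp u 0 k - f u 0 k) - partial1 f u 0 k.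
  by rewrite [moutard_fp u 0 k]mxE -e1; ring.
rewrite f12 e3 e4 /GRing.scale/= fctE -!surjective_pairing !mxE /GRing.scale/=.
ring.
Qed.

Lemma moutard_exists r : 0 < r -> r < r1 ->
  Moutard_transform_with_data r q f fp0 p10 p20 moutard_fp.
Proof.
move=> r0 rr1; have SU := square_obox rr1.
have s0 x : 0 <= x <= r -> square r (x, 0).
  by move=> hx; split => //=; rewrite lexx ltW.
have cp10 := smooth1_continuous sp10; have cp20 := smooth1_continuous sp20.
exists moutard_p1, moutard_p2; split; first split.
- exists (fun u => - q u + 2 * moutard_p1 u * moutard_p2 u); split.
    by exists U; split => // n; exact: Cn_on_fp.
  by move=> u /SU; exact: moutard_net.
- split; first by exists U; split => // n; exact: Cn_on_p1.
  by exists U; split => // n; exact: Cn_on_p2.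
- by move=> u /SU /moutard_eqs.
- by move=> u /SU /moutard_p_eqs.
- by apply/rowP => k; rewrite mxE h0 thx exp_prim0 divr1.
- move=> x /SU Ux; have := th_neq0 Ux; rewrite /moutard_p1.
  have -> : partial1 th (x, 0) = - p10 x * exp_prim p10 x.
    apply: is_derive_derive1; rewrite (funext thx : (fun s => th (s, 0)) = _).
    exact: is_derive_exp_prim.
  by rewrite thx => t0; field.
- move=> y /SU Uy; have := th_neq0 Uy; rewrite /moutard_p2.
  have -> : partial2 th (0, y) = - p20 y * exp_prim p20 y.
    apply: is_derive_derive1; rewrite (funext thy : (fun s => th (0, s)) = _).
    exact: is_derive_exp_prim.
  by rewrite thy => t0; field.
Qed.

(** * Uniqueness of the smooth transform *)

Lemma square_bounded r (G : R * R -> R) : 0 <= r ->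
  (forall u, square r u -> {for u, continuous G}) ->
  exists2 K, 0 <= K & forall u, square r u -> `|G u| <= K.
Proof.
move=> r0 cG.
pose A : set (R * R) := `[0, r] `*` `[0, r].
have AE u : A u <-> square r u by rewrite /A /square /= !in_itv.
have cA : compact A by apply: compact_setX; exact: segment_compact.
have [||c _ cmax] := @compact_EVT_max _ R (fun u => `|G u|) A _ cA _.
- by exists (0, 0); apply/AE; split; rewrite /= lexx r0.
- apply: continuous_in_subspaceT => u /set_mem /AE /cG cu.
  exact: (@continuous_comp _ _ _ G (fun z : R => `|z|) u cu (@norm_continuous _ _ _)).
exists `|G c| => // u /AE Au; apply: cmax; exact/mem_set.
Qed.

(* Linear Goursat problem with zero data: the weighted sup norm is halved by
   one round of integration. *)
Lemma goursat_zero r (P1 P2 w1 w2 : R * R -> R) : 0 < r ->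
  (forall u, square r u -> [/\ {for u, continuous P1}, {for u, continuous P2},
    {for u, continuous w1} & {for u, continuous w2}]) ->
  (forall u, square r u -> is_derive u.2 1 (fun t => w1 (u.1, t)) (P1 u * w2 u)) ->
  (forall u, square r u -> is_derive u.1 1 (fun s => w2 (s, u.2)) (P2 u * w1 u)) ->
  (forall x, square r (x, 0) -> w1 (x, 0) = 0) ->
  (forall y, square r (0, y) -> w2 (0, y) = 0) ->
  forall u, square r u -> w1 u = 0 /\ w2 u = 0.
Proof.
move=> r0 cc dw1 dw2 w10 w20.
have [B1 B10 hB1] := square_bounded (ltW r0) (fun u hu => let: And4 a b c d := cc u hu in a).
have [B2 B20 hB2] := square_bounded (ltW r0) (fun u hu => let: And4 a b c d := cc u hu in b).
have [M1 M10 hM1] := square_bounded (ltW r0) (fun u hu => let: And4 a b c d := cc u hu in c).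
have [M2 M20 hM2] := square_bounded (ltW r0) (fun u hu => let: And4 a b c d := cc u hu in d).
(* [B] is positive and bounds both coefficients; against a weight of rate [2 * B], integration with
   coefficient [B] gives the factor [1 / 2]. *)
set B := B1 + B2 + 1; set M := M1 + M2.
have B0 : 0 < B by rewrite /B; lra.
have M0 : 0 <= M by rewrite /M; lra.
have L0 : 0 < 2 * B by lra.
have e1 (z : R) : 0 <= z -> 1 <= expR (2 * B * z).
  by move=> z0; rewrite -{1}expR0 ler_expR mulr_ge0// ltW.
have H n u : square r u ->
   `|w1 u| <= M * 2^-1 ^+ n * expR (2 * B * (u.1 + u.2)) /\
   `|w2 u| <= M * 2^-1 ^+ n * expR (2 * B * (u.1 + u.2)).
  elim: n u => [|n IH] u hu.
    have [/andP[x0 _] /andP[y0 _]] := hu.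
    have h1 : M <= M * 2^-1 ^+ 0 * expR (2 * B * (u.1 + u.2)).
      by rewrite expr0 mulr1 ler_peMr// e1// addr_ge0.
    split; apply: le_trans h1.
      by apply: le_trans (hM1 u hu) _; rewrite /M lerDl.
    by apply: le_trans (hM2 u hu) _; rewrite /M lerDr.
  case: u hu => x y hu; have [/= /andP[x0 xr] /andP[y0 yr]] := hu.
  set Mn := M * 2^-1 ^+ n in IH.
  have Mn0 : 0 <= Mn by rewrite /Mn mulr_ge0// exprn_ge0// invr_ge0.
  have MnS : M * 2^-1 ^+ n.+1 = Mn / 2 by rewrite exprS /Mn; field.
  rewrite MnS; split.
  - have -> : w1 (x, y) = w1 (x, y) - w1 (x, 0).
      by rewrite w10 ?subr0//; split; rewrite /= ?x0 ?xr ?lexx ?ltW.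
    have := @exp_weight_le R (fun t => w1 (x, t)) (fun t => P1 (x, t) * w2 (x, t))
      (B * Mn * expR (2 * B * x)) (2 * B) 0 y y0 _ L0 _ _.
    have -> : B * Mn * expR (2 * B * x) / (2 * B) * expR (2 * B * y) =
      Mn / 2 * expR (2 * B * (x + y)).
      by rewrite [2 * B * (x + y)]mulrDr expRD; field; rewrite gt_eqF.
    apply.
    + by rewrite !mulr_ge0// ?expR_ge0// ltW.
    + move=> t /andP[t0 ty]; have ht : square r (x, t).
        by split; rewrite /= ?x0 ?xr ?t0//=; exact: le_trans yr.
      exact: (dw1 (x, t) ht).
    + move=> t /andP[t0 ty]; have ht : square r (x, t).
        by split; rewrite /= ?x0 ?xr ?t0//=; exact: le_trans yr.
      have [_ /= k2] := IH _ ht; rewrite mulrDr expRD in k2; rewrite normrM.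
      have -> : B * Mn * expR (2 * B * x) * expR (2 * B * t) =
        B * (Mn * (expR (2 * B * x) * expR (2 * B * t))) by ring.
      rewrite ler_pM//; apply: le_trans (hB1 _ ht) _; rewrite /B; lra.
  - have -> : w2 (x, y) = w2 (x, y) - w2 (0, y).
      by rewrite w20 ?subr0//; split; rewrite /= ?y0 ?yr ?lexx ?ltW.
    have := @exp_weight_le R (fun s => w2 (s, y)) (fun s => P2 (s, y) * w1 (s, y))
      (B * Mn * expR (2 * B * y)) (2 * B) 0 x x0 _ L0 _ _.
    have -> : B * Mn * expR (2 * B * y) / (2 * B) * expR (2 * B * x) =
      Mn / 2 * expR (2 * B * (x + y)).
      by rewrite [2 * B * (x + y)]mulrDr expRD; field; rewrite gt_eqF.
    apply.
    + by rewrite !mulr_ge0// ?expR_ge0// ltW.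
    + move=> t /andP[t0 ty]; have ht : square r (t, y).
        by split; rewrite /= ?y0 ?yr ?t0//=; exact: le_trans xr.
      exact: (dw2 (t, y) ht).
    + move=> t /andP[t0 ty]; have ht : square r (t, y).
        by split; rewrite /= ?y0 ?yr ?t0//=; exact: le_trans xr.
      have [/= k2 _] := IH _ ht; rewrite mulrDr expRD in k2; rewrite normrM.
      have -> : B * Mn * expR (2 * B * y) * expR (2 * B * t) =
        B * (Mn * (expR (2 * B * t) * expR (2 * B * y))) by ring.
      rewrite ler_pM//; apply: le_trans (hB2 _ ht) _; rewrite /B; lra.
move=> u hu; split; apply: (@eq0_half_pow _ _ (M * expR (2 * B * (u.1 + u.2)))) => n;
  by have [h1' h2'] := H n u hu; rewrite mulrAC.
Qed.

(** The defects [w1], [w2] of a competing pair from the logarithmic derivatives of [th] solve a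
    linear homogeneous Goursat system whose coefficients are the competitors themselves, with zero
    axis data. Once they vanish, [th * g] and [h k] have the same partial derivatives and agree at
    the origin. *)
Lemma moutard_unique r (g : R * R -> 'rV[R]_N) : 0 < r -> r < r1 ->
  Moutard_transform_with_data r q f fp0 p10 p20 g ->
  forall u, square r u -> g u = moutard_fp u.
Proof.
move=> r0 rr1 [P1 [P2 [[[qp [[Ug [_ SUg Cg]] _]] [[U1 [_ SU1 C1]] [U2 [_ SU2 C2]]] eqg eqp]]]].
move=> g0 P10 P20.
have SU := square_obox rr1.
have cp10 := smooth1_continuous sp10; have cp20 := smooth1_continuous sp20.
pose w1 u := th u * P1 u + partial1 th u.
pose w2 u := th u * P2 u + partial2 th u.
have s1 := smooth2_partial1 sth; have s2 := smooth2_partial2 sth.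
have w0 : forall u, square r u -> w1 u = 0 /\ w2 u = 0.
  apply: (@goursat_zero r P1 P2 w1 w2 r0).
  - move=> u hu; have k1 := Cn_on_continuous (C1 0%N) (SU1 _ hu).
    have k2 := Cn_on_continuous (C2 0%N) (SU2 _ hu); split => //.
    + apply: cvgD; last exact: smooth2_continuous s1 u.
      by apply: cvgM => //; exact: smooth2_continuous sth u.
    + apply: cvgD; last exact: smooth2_continuous s2 u.
      by apply: cvgM => //; exact: smooth2_continuous sth u.
  - move=> u hu; have [e1 e2] := eqp _ hu; have [e3 e4] := th12 u.
    have := is_deriveD (is_deriveM (smooth2_derive2 u sth) (Cn_on_partial2 (C1 1%N) (SU1 _ hu)))
      (smooth2_derive2 u s1).
    move=> /is_derive_eq; apply; rewrite -surjective_pairing e2 e4 /w2 /GRing.scale/=.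
    ring.
  - move=> u hu; have [e1 e2] := eqp _ hu; have [e3 e4] := th12 u.
    have := is_deriveD (is_deriveM (smooth2_derive1 u sth) (Cn_on_partial1 (C2 1%N) (SU2 _ hu)))
      (smooth2_derive1 u s2).
    move=> /is_derive_eq; apply; rewrite -surjective_pairing e1 e2 e3 /w1 /GRing.scale/=.
    ring.
  - move=> x hx; rewrite /w1 P10// thx.
    have -> : partial1 th (x, 0) = - p10 x * exp_prim p10 x.
      apply: is_derive_derive1; rewrite (funext thx : (fun s => th (s, 0)) = _).
      exact: is_derive_exp_prim.
    ring.
  - move=> y hy; rewrite /w2 P20// thy.
    have -> : partial2 th (0, y) = - p20 y * exp_prim p20 y.
      apply: is_derive_derive1; rewrite (funext thy : (fun s => th (0, s)) = _).
      exact: is_derive_exp_prim.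
    ring.
(* The derivative equals [w1 * (g - f)] in coordinate [k], and [w1] is zero; [dg2] does the same
   with [w2 * (g + f)]. *)
have dg1 k u : square r u ->
    is_derive u.1 1 (fun s => th (s, u.2) * g (s, u.2) 0 k - h k (s, u.2)) 0.
  move=> hu; have [/(congr1 (fun M : 'rV[R]_N => M 0 k)) e _] := eqg _ hu.
  rewrite !mxE in e; have [z1 _] := w0 _ hu.
  have d := is_derive_coord k (Cn_on_partial1 (Cg 1%N) (SUg _ hu)).
  have := is_deriveB (is_deriveM (smooth2_derive1 u sth) d) (smooth2_derive1 u (sh k)).
  move=> /is_derive_eq; apply; rewrite -surjective_pairing h_1 /GRing.scale/=.
  have -> : partial1 g u 0 k = P1 u * (g u 0 k - f u 0 k) - partial1 f u 0 k by rewrite -e; ring.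
  rewrite (partial1_coord k (I : setT u) (sf 1)).
  transitivity (w1 u * (g u 0 k - f u 0 k)); last by rewrite z1 mul0r.
  by rewrite /w1; ring.
have dg2 k u : square r u ->
    is_derive u.2 1 (fun t => th (u.1, t) * g (u.1, t) 0 k - h k (u.1, t)) 0.
  move=> hu; have [_ /(congr1 (fun M : 'rV[R]_N => M 0 k)) e] := eqg _ hu.
  rewrite !mxE in e; have [_ z1] := w0 _ hu.
  have d := is_derive_coord k (Cn_on_partial2 (Cg 1%N) (SUg _ hu)).
  have := is_deriveB (is_deriveM (smooth2_derive2 u sth) d) (smooth2_derive2 u (sh k)).
  move=> /is_derive_eq; apply; rewrite -surjective_pairing h_2 /GRing.scale/=.
  have -> : partial2 g u 0 k = P2 u * (g u 0 k + f u 0 k) + partial2 f u 0 k by rewrite -e; ring.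
  rewrite (partial2_coord k (I : setT u) (sf 1)).
  transitivity (w2 u * (g u 0 k + f u 0 k)); last by rewrite z1 mul0r.
  by rewrite /w2; ring.
move=> [x y] hu; have tu := th_neq0 (SU _ hu); have [/= /andP[x0 xr] /andP[y0 yr]] := hu.
apply/rowP => k; rewrite mxE.
have E2 := @derive0_eq R (fun t => th (x, t) * g (x, t) 0 k - h k (x, t)) 0 y y0.
have E1 := @derive0_eq R (fun s => th (s, 0) * g (s, 0) 0 k - h k (s, 0)) 0 x x0.
have {}E2 : th (x, y) * g (x, y) 0 k - h k (x, y) = th (x, 0) * g (x, 0) 0 k - h k (x, 0).
  apply: E2 => t /andP[t0 ty]; apply: (dg2 k (x, t)).
  by split; rewrite /= ?x0 ?xr ?t0//=; exact: le_trans yr.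
have {}E1 : th (x, 0) * g (x, 0) 0 k - h k (x, 0) = th (0, 0) * g (0, 0) 0 k - h k (0, 0).
  apply: E1 => t /andP[t0 tx]; apply: (dg1 k (t, 0)).
  by split; rewrite /= ?t0 ?lexx ?(ltW r0)//=; exact: le_trans xr.
rewrite E1 thx exp_prim0 g0 h0 mul1r subrr in E2.
by move/eqP: E2; rewrite subr_eq0 => /eqP <-; field.
Qed.

End Transform.

(** * The discrete Moutard transform *)

Section DiscreteNets.
Variable R : realType.
Implicit Types (a T F : nat -> nat -> R) (x y : nat -> R).

(** Structural recursion along a row inside a recursion over rows, hence the index order [j], [i] in
    [dnet]. *)
Fixpoint dnet_row (c prev : nat -> R) (z : R) i : R :=
  if i is i'.+1 then c i' * (prev i + dnet_row c prev z i') - prev i' else z.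

Fixpoint dnet a x y j i : R :=
  if j is j'.+1 then dnet_row (a ^~ j') (dnet a x y j') (y j) i else x i.

Lemma dnet_axis2 a x y j : x 0%N = y 0%N -> dnet a x y j 0%N = y j.
Proof. by case: j. Qed.

Lemma dnetE a x y i j : dnet a x y j.+1 i.+1 + dnet a x y j i =
  a i j * (dnet a x y j i.+1 + dnet a x y j.+1 i).
Proof. by rewrite /= subrK. Qed.

(** Discrete potential, summed along the first axis and then up a column. As
    [T' F - T F' = (T' - T) F - T (F' - F)], its increments are those of the smooth potential with
    differences for derivatives. *)
Definition path_sum T F (c : R) i j : R :=
  c + \sum_(l < i) (T l.+1 0%N * F l 0%N - T l 0%N * F l.+1 0%N)
    + \sum_(m < j) (T i m * F i m.+1 - T i m.+1 * F i m).

Lemma path_sum0 T F c : path_sum T F c 0 0 = c.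
Proof. by rewrite /path_sum !big_ord0 !addr0. Qed.

Lemma path_sum_step2 T F c i j :
  path_sum T F c i j.+1 = path_sum T F c i j + (T i j * F i j.+1 - T i j.+1 * F i j).
Proof. by rewrite /path_sum big_ord_recr/= !addrA. Qed.

(* Closedness of the discrete one-form follows from both nets having the same
   coefficient a. *)
Lemma path_sum_step1 a T F c i j :
  (forall i j, T i.+1 j.+1 + T i j = a i j * (T i.+1 j + T i j.+1)) ->
  (forall i j, F i.+1 j.+1 + F i j = a i j * (F i.+1 j + F i j.+1)) ->
  path_sum T F c i.+1 j = path_sum T F c i j + (T i.+1 j * F i j - T i j * F i.+1 j).
Proof.
move=> TE FE; elim: j => [|j IH].
  by rewrite /path_sum !big_ord0 big_ord_recr/= !addr0 !addrA.
rewrite !path_sum_step2 IH.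
have -> : T i.+1 j.+1 = a i j * (T i.+1 j + T i j.+1) - T i j by rewrite -TE; ring.
have -> : F i.+1 j.+1 = a i j * (F i.+1 j + F i j.+1) - F i j by rewrite -FE; ring.
ring.
Qed.

End DiscreteNets.

Section DiscreteTransform.
Variables (R : realType) (N : nat) (eps r : R).
Hypothesis e0 : 0 < eps.

(** Negative indices receive mirrored values; lattice squares contain nonnegative indices only. *)
Definition zext (V : Type) (G : nat -> nat -> V) (u : int * int) : V :=
  G `|u.1|%N `|u.2|%N.

Lemma lsquareE (i j : nat) :
  lsquare eps r (i%:Z, j%:Z) <-> eps * i%:R <= r /\ eps * j%:R <= r.
Proof.
rewrite /lsquare /square /lpoint/= !mulr_ge0 ?(ltW e0) ?ler0z//=.
Qed.

Lemma lsquare_nat u : lsquare eps r u -> exists i j : nat, u = (i%:Z, j%:Z).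
Proof.
case: u => x y [/= /andP[x0 _] /andP[y0 _]].
move: x0 y0; rewrite !pmulr_rge0// !ler0z.
by case: x => // i _; case: y => // j _; exists i, j.
Qed.

Lemma PoszS (i : nat) : (i%:Z + 1 = i.+1%:Z)%R.
Proof. by rewrite -PoszD addn1. Qed.

Lemma tau1_nat (V : Type) (g : int * int -> V) (i j : nat) :
  tau1 g (i%:Z, j%:Z) = g (i.+1%:Z, j%:Z).
Proof. by rewrite /tau1/= PoszS. Qed.

Lemma tau2_nat (V : Type) (g : int * int -> V) (i j : nat) :
  tau2 g (i%:Z, j%:Z) = g (i%:Z, j.+1%:Z).
Proof. by rewrite /tau2/= PoszS. Qed.

Lemma dom_pred (i : nat) : eps * i.+1%:R <= r -> eps * i%:R <= r.
Proof. by apply: le_trans; rewrite ler_pM2l// ler_nat. Qed.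

Lemma face_lsquareE (i j : nat) :
  face (lsquare eps r) (i%:Z, j%:Z) <-> eps * i.+1%:R <= r /\ eps * j.+1%:R <= r.
Proof.
rewrite /face/= !PoszS; split.
  by move=> [_ _ _] /lsquareE.
move=> [hi hj]; have hi' := dom_pred hi; have hj' := dom_pred hj.
by split; apply/lsquareE.
Qed.

Lemma face_lsquare_nat u : face (lsquare eps r) u -> exists i j : nat,
  [/\ u = (i%:Z, j%:Z), eps * i.+1%:R <= r & eps * j.+1%:R <= r].
Proof.
move=> hf; have [/lsquare_nat[i [j e]] _ _ _] := hf; exists i, j.
by move: hf; rewrite e => /face_lsquareE[].
Qed.

Section Existence.
Variables (q : R * R -> R) (g : int * int -> 'rV[R]_N) (fp0 : 'rV[R]_N) (p10 p20 : R -> R).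
Variable T : nat -> nat -> R.
Local Notation a i j := (canonical_a eps q (Posz i, Posz j)).
Local Notation G k := (fun i j : nat => g (Posz i, Posz j) 0 k).

Hypothesis TE : forall i j : nat, T i.+1 j.+1 + T i j = a i j * (T i.+1 j + T i j.+1).
Hypothesis gE : forall i j : nat, g (Posz i.+1, Posz j.+1) + g (Posz i, Posz j) =
  a i j *: (g (Posz i.+1, Posz j) + g (Posz i, Posz j.+1)).
Hypothesis T00 : T 0%N 0%N = 1.
Hypothesis T1 : forall i, T i.+1 0%N = T i 0%N / (1 + eps * p10 (eps * i%:R)).
Hypothesis T2 : forall j, T 0%N j.+1 = T 0%N j / (1 + eps * p20 (eps * j%:R)).
Hypothesis T_neq0 : forall i j, eps * i%:R <= r -> eps * j%:R <= r -> T i j != 0.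
Hypothesis a_neq0 : forall i j : nat, eps * i%:R <= r -> eps * j%:R <= r -> a i j != 0.

Definition dtransform_nat i j : 'rV[R]_N :=
  \row_k (path_sum T (G k) (fp0 0 k) i j / T i j).

Definition dtransform := zext dtransform_nat.

Lemma dtransform_canonical :
  canonical_dMoutard_transform (lsquare eps r) eps q g fp0 p10 p20 dtransform.
Proof.
have GE k i j : G k i.+1 j.+1 + G k i j = a i j * (G k i.+1 j + G k i j.+1).
  by have := congr1 (fun M : 'rV[R]_N => M 0 k) (gE i j); rewrite !mxE.
(* By the equation of [T] the denominator [(b1 + b2) a - b1 b2] equals [T i j * T i.+1 j.+1 / (T
   i.+1 j * T i j.+1)], whence the form of [ap]. *)
pose b1 := zext (fun i j => T i j / T i.+1 j).
pose b2 := zext (fun i j => T i j / T i j.+1).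
pose ap := zext (fun i j => a i j * (T i.+1 j * T i j.+1) / (T i j * T i.+1 j.+1)).
(* [c = 0] is allowed: at the last point of an axis inside the square, [1 + eps * p] might vanish,
   and the convention [0^-1 = 0] still returns the prescribed value. *)
have divK (x c : R) : x != 0 -> x / (x / c) = c.
  by move=> x0; rewrite invfM invrK mulrA mulfV// mul1r.
exists b1, b2; split; first exists ap; first split.
- move=> u /face_lsquare_nat[i [j [-> hi hj]]].
  have hi' := dom_pred hi; have hj' := dom_pred hj.
  rewrite /tau1 /tau2/= !PoszS; apply/rowP => k.
  rewrite /dtransform /zext /ap /zext /= ?absz_nat !mxE.
  rewrite !path_sum_step2 !(path_sum_step1 _ i j TE (GE k)).
  have t00 := T_neq0 hi' hj'; have t10 := T_neq0 hi hj'.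
  have t01 := T_neq0 hi' hj; have t11 := T_neq0 hi hj.
  have -> : g (i.+1%:Z, j.+1%:Z) 0 k = a i j * (G k i.+1 j + G k i j.+1) - G k i j.
    by rewrite -GE; ring.
  have e11 : T i.+1 j.+1 = a i j * (T i.+1 j + T i j.+1) - T i j by rewrite -TE; ring.
  move: t11; rewrite e11 => t11.
  by field; rewrite t00 t10 t01 t11.
- move=> u [hu]; have [i [j e]] := lsquare_nat hu; rewrite e in hu *.
  rewrite /= PoszS => /lsquareE[hi hj]; have hi' := dom_pred hi.
  rewrite tau1_nat tau1_nat; apply/rowP => k.
  rewrite /dtransform /b1 /zext /= ?absz_nat !mxE (path_sum_step1 _ i j TE (GE k)).
  have t00 := T_neq0 hi' hj; have t10 := T_neq0 hi hj.
  by field; rewrite t00 t10.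
- move=> u [hu]; have [i [j e]] := lsquare_nat hu; rewrite e in hu *.
  rewrite /= PoszS => /lsquareE[hi hj]; have hj' := dom_pred hj.
  rewrite tau2_nat tau2_nat; apply/rowP => k.
  rewrite /dtransform /b2 /zext /= ?absz_nat !mxE path_sum_step2.
  have t00 := T_neq0 hi hj'; have t10 := T_neq0 hi hj.
  by field; rewrite t00 t10.
- move=> u /face_lsquare_nat[i [j [-> hi hj]]].
  have hi' := dom_pred hi; have hj' := dom_pred hj.
  have t00 := T_neq0 hi' hj'; have t10 := T_neq0 hi hj'.
  have t01 := T_neq0 hi' hj; have t11 := T_neq0 hi hj.
  have a0 := a_neq0 hi' hj'.
  have E : (T i j / T i.+1 j + T i j / T i j.+1) * a i j -
      T i j / T i.+1 j * (T i j / T i j.+1) =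
      T i j * T i.+1 j.+1 / (T i.+1 j * T i j.+1).
    have -> : T i.+1 j.+1 = a i j * (T i.+1 j + T i j.+1) - T i j by rewrite -TE; ring.
    by field; rewrite t10 t01.
  rewrite !tau1_nat !tau2_nat /b1 /b2 /ap /zext /= ?absz_nat E; split.
    by split; rewrite ?a0// ?mulf_neq0 ?invr_neq0// mulf_neq0.
  by split; field; rewrite ?t00 ?t10 ?t01 ?t11 ?a0.
- by rewrite /dtransform /zext/=; apply/rowP => k; rewrite mxE path_sum0 T00 divr1.
- move=> i hi; have [i' [j' [ei ej]]] := lsquare_nat hi; rewrite ei.
  rewrite ei -[0]/(Posz 0) in hi; have [h1 h2] := (lsquareE _ _).1 hi.
  by rewrite /b1 /zext/= ?absz_nat T1 divK// T_neq0.
- move=> j hj; have [i' [j' [ei ej]]] := lsquare_nat hj; rewrite ej.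
  rewrite ej -[0]/(Posz 0) in hj; have [h1 h2] := (lsquareE _ _).1 hj.
  by rewrite /b2 /zext/= ?absz_nat T2 divK// T_neq0.
Qed.

End Existence.

(** The face relations determine [tau2 b1] and [tau1 b2] from the values of [b1] and [b2] at the
    lower left corner, so the axis data fix the coefficients; then the edge relations propagate the
    net from the origin. *)
Lemma dtransform_unique (q : R * R -> R) (g : int * int -> 'rV[R]_N) (fp0 : 'rV[R]_N)
    (p10 p20 : R -> R) (gp gp' : int * int -> 'rV[R]_N) :
  canonical_dMoutard_transform (lsquare eps r) eps q g fp0 p10 p20 gp ->
  canonical_dMoutard_transform (lsquare eps r) eps q g fp0 p10 p20 gp' ->
  forall u, lsquare eps r u -> gp u = gp' u.
Proof.
move=> [b1 [b2 [[ap [_ E1 E2 Ef]] g0 A1 A2]]] [c1 [c2 [[cp [_ E1' E2' Ef']] g0' A1' A2']]].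
have step (d1 d2 : int * int -> R) (dp : int * int -> R) (i j : nat) :
    [/\ d1 (i%:Z, j%:Z) != 0, d2 (i%:Z, j%:Z) != 0, canonical_a eps q (i%:Z, j%:Z) != 0
      & (d1 (i%:Z, j%:Z) + d2 (i%:Z, j%:Z)) * canonical_a eps q (i%:Z, j%:Z) - d1 (i%:Z, j%:Z) * d2 (i%:Z, j%:Z) != 0] /\
    [/\ tau2 d1 (i%:Z, j%:Z) / d1 (i%:Z, j%:Z) = tau1 d2 (i%:Z, j%:Z) / d2 (i%:Z, j%:Z),
      tau1 d2 (i%:Z, j%:Z) / d2 (i%:Z, j%:Z) = dp (i%:Z, j%:Z) / canonical_a eps q (i%:Z, j%:Z)
    & dp (i%:Z, j%:Z) / canonical_a eps q (i%:Z, j%:Z) = ((d1 (i%:Z, j%:Z) + d2 (i%:Z, j%:Z)) * canonical_a eps q (i%:Z, j%:Z) - d1 (i%:Z, j%:Z) * d2 (i%:Z, j%:Z))^-1] ->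
    d1 (i%:Z, j.+1%:Z) = d1 (i%:Z, j%:Z) / ((d1 (i%:Z, j%:Z) + d2 (i%:Z, j%:Z)) * canonical_a eps q (i%:Z, j%:Z) - d1 (i%:Z, j%:Z) * d2 (i%:Z, j%:Z)) /\
    d2 (i.+1%:Z, j%:Z) = d2 (i%:Z, j%:Z) / ((d1 (i%:Z, j%:Z) + d2 (i%:Z, j%:Z)) * canonical_a eps q (i%:Z, j%:Z) - d1 (i%:Z, j%:Z) * d2 (i%:Z, j%:Z)).
  rewrite tau1_nat tau2_nat => -[[n1 n2 _ _] [k1 k2 k3]].
  by rewrite -k3 -k2 -{1}k1; split; field.
(* [b1] is compared only where its horizontal edge lies in the square and [b2] only where its
   vertical edge does: the face relations reach no further. *)
have H (i j : nat) : eps * i%:R <= r -> eps * j%:R <= r ->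
    (eps * i.+1%:R <= r -> b1 (i%:Z, j%:Z) = c1 (i%:Z, j%:Z)) /\
    (eps * j.+1%:R <= r -> b2 (i%:Z, j%:Z) = c2 (i%:Z, j%:Z)).
  have X1 (i' : nat) : eps * i'%:R <= r -> 0 <= r -> b1 (i'%:Z, 0) = c1 (i'%:Z, 0).
    move=> h h0; have D : lsquare eps r (i'%:Z, 0%N%:Z) by apply/lsquareE; rewrite mulr0.
    by rewrite A1// A1'.
  have X2 (j' : nat) : eps * j'%:R <= r -> 0 <= r -> b2 (0, j'%:Z) = c2 (0, j'%:Z).
    move=> h h0; have D : lsquare eps r (0%N%:Z, j'%:Z) by apply/lsquareE; rewrite mulr0.
    by rewrite A2// A2'.
  have S (i' j' : nat) : eps * i'.+1%:R <= r -> eps * j'.+1%:R <= r ->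
      b1 (i'%:Z, j'%:Z) = c1 (i'%:Z, j'%:Z) -> b2 (i'%:Z, j'%:Z) = c2 (i'%:Z, j'%:Z) ->
      b1 (i'%:Z, j'.+1%:Z) = c1 (i'%:Z, j'.+1%:Z) /\ b2 (i'.+1%:Z, j'%:Z) = c2 (i'.+1%:Z, j'%:Z).
    move=> h1 h2 k1 k2; have Hf : face (lsquare eps r) (i'%:Z, j'%:Z) by apply/face_lsquareE.
    have [-> ->] := step _ _ _ _ _ (Ef _ Hf); have [-> ->] := step _ _ _ _ _ (Ef' _ Hf).
    by rewrite k1 k2.
  elim: j i => [|j IHj]; elim=> [|i IHi] hi hj.
  - by split=> h; [apply: X1|apply: X2] => //; rewrite mulr0 in hi.
  - have r00 : 0 <= r by rewrite mulr0 in hj.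
    have [I1 I2] := IHi (dom_pred hi) hj; split=> h; first exact: X1.
    by have [] := S i 0%N hi h (I1 hi) (I2 h).
  - have r00 : 0 <= r by rewrite mulr0 in hi.
    have [I1 I2] := IHj 0%N hi (dom_pred hj); split=> h; last exact: X2.
    by have [] := S 0%N j h hj (I1 h) (I2 hj).
  - have [I1 I2] := IHi (dom_pred hi) hj; have [J1 J2] := IHj i.+1 hi (dom_pred hj).
    split=> h.
      by have [] := S i.+1 j h hj (J1 h) (J2 hj).
    by have [] := S i j.+1 hi h (I1 hi) (I2 h).
have K1 (i j : nat) : eps * i.+1%:R <= r -> eps * j%:R <= r ->
    gp (i%:Z, j%:Z) = gp' (i%:Z, j%:Z) -> gp (i.+1%:Z, j%:Z) = gp' (i.+1%:Z, j%:Z).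
  move=> hi hj e; have hi' := dom_pred hi.
  have D : edge1 (lsquare eps r) (i%:Z, j%:Z).
    by split; rewrite /= ?PoszS; apply/lsquareE.
  have := E1 _ D; have := E1' _ D; rewrite !tau1_nat.
  have [-> // _] := H i j hi' hj; rewrite e => <- /eqP.
  by rewrite (inj_eq (addIr _)) => /eqP.
have K2 (i j : nat) : eps * i%:R <= r -> eps * j.+1%:R <= r ->
    gp (i%:Z, j%:Z) = gp' (i%:Z, j%:Z) -> gp (i%:Z, j.+1%:Z) = gp' (i%:Z, j.+1%:Z).
  move=> hi hj e; have hj' := dom_pred hj.
  have D : edge2 (lsquare eps r) (i%:Z, j%:Z).
    by split; rewrite /= ?PoszS; apply/lsquareE.
  have := E2 _ D; have := E2' _ D; rewrite !tau2_nat.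
  have [_ -> //] := H i j hi hj'; rewrite e => <- /eqP.
  by rewrite (inj_eq (addIr _)) => /eqP.
move=> u hu; have [i [j e]] := lsquare_nat hu; move: hu; rewrite {u}e => /lsquareE[].
elim: j i => [|j IHj] i hi hj; last by apply: K2 => //; apply: IHj => //; exact: dom_pred.
elim: i hi => [|i IHi] hi; first by rewrite g0 g0'.
by apply: K1 => //; apply: IHi; exact: dom_pred.
Qed.

End DiscreteTransform.

(** * Convergence *)

Section Convergence.
Variable R : realType.
Implicit Types (F G H P T : family R) (p : R -> R) (eps : R) (k : nat).

Lemma evt_small r0 (m : R) F : 0 < m -> bd r0 1 F -> evt r0 (fun eps i j => `|F eps i j| <= m).
Proof.
move=> m0 bF r rr0; have [c c0 hc] := bd_nonneg rr0 bF.
have h : 0 < m / (c + 1) by rewrite divr_gt0// ltr_wpDl.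
apply: filterS3 hc (near0_lt h) (near0_gt R) => eps hc' e1 e0 i j hi hj.
apply: le_trans (hc' i j hi hj) _; rewrite expr1.
move: e1; rewrite ltr_pdivlMr ?ltr_wpDl// => e1.
by apply: le_trans (ltW e1); rewrite mulrC ler_pM2l// lerDl.
Qed.

Lemma evt_lower_neq0 r0 (m : R) F : 0 < m -> evt r0 (fun eps i j => m <= `|F eps i j|) ->
  evt r0 (fun eps i j => F eps i j != 0).
Proof.
move=> m0 H r /H; apply: filterS => eps h i j hi hj.
by rewrite -normr_gt0; apply: lt_le_trans (h i j hi hj).
Qed.

Lemma CB_inv_lower r0 (m : R) k F : 0 < m -> evt r0 (fun eps i j => m <= `|F eps i j|) ->
  CB r0 0 k F -> CB r0 0 k (invf F).
Proof.
move=> m0 H HF; apply: CBV => //; first exact: evt_lower_neq0 H.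
move=> r /H h; exists m^-1; apply: filterS h => eps h i j hi hj.
rewrite expr0 mulr1 /invf normfV lef_pV2 ?posrE ?h//.
by apply: lt_le_trans (h i j hi hj).
Qed.

Lemma evt_1D_lower r0 F : bd r0 1 F -> evt r0 (fun eps i j => 1 / 2 <= `|1 + F eps i j|).
Proof.
move=> bF; have h2 : 0 < (1 / 2 : R) by lra.
move=> r /(evt_small h2 bF); apply: filterS => eps h i j hi hj.
have := h i j hi hj; rewrite ler_norml => /andP[h3 _].
by apply: le_trans (ler_norm _); lra.
Qed.

Lemma CB_int r0 (p k : nat) G : 0 < r0 -> CB r0 p k (d1 G) -> CB r0 p k (d2 G) ->
  (forall eps, 0 < eps -> G eps 0%N 0%N = 0) -> CB r0 p k G.
Proof.
move=> r00 H1 H2 G0; apply: CB_int2 => //; apply: CB_int1.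
  exact: (@CB_ax1 _ _ p k (d1 G)).
by apply: CB_zero; apply: evt_pos => eps i j e0; rewrite /ax2 /ax1 G0.
Qed.

(** On an axis [T = b * tau T] with [b = 1 + eps * p], a one-step scheme for [a' = - p a]. *)
Fixpoint axis_prod p eps (i : nat) : R :=
  if i is i'.+1 then axis_prod p eps i' / (1 + eps * p (eps * i'%:R)) else 1.

Definition axis_error p : family R :=
  fun eps i _ => axis_prod p eps i - exp_prim p (eps * i%:R).

Lemma CB_axis r0 k p : smooth1 p -> CB r0 1 k (axis_error p).
Proof.
move=> sp; have cp := smooth1_continuous sp.
have sa := smooth2_fst (smooth1_exp_prim sp); have sP := smooth2_fst sp.
set a := fun u : R * R => exp_prim p u.1 in sa.
pose P := restr (fun u : R * R => p u.1).
pose D := addf (@cstf R 1) (mulf (@epsf R) P).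
have HP n : CB r0 0 n P by exact: CB_restr.
have lD : evt r0 (fun eps i j => 1 / 2 <= `|D eps i j|).
  by apply: evt_1D_lower; exact: (CB_epsM (HP 0%N)).1.
have h2 : 0 < (1 / 2 : R) by lra.
have D0 := evt_lower_neq0 h2 lD.
have HI n : CB r0 0 n (invf D).
  apply: CB_inv_lower h2 lD _.
  by apply: CBD; [exact: CB_cst|exact: CB_weaken (CB_epsM (HP n))].
have M0 n (X Y : family R) : CB r0 0 n X -> CB r0 0 n Y -> CB r0 0 n (mulf X Y).
  by move=> hX hY; exact: (CBM hX hY).
(* The scheme reads [d1 X = - (p / D) X]. The source of the error equation consists of the
   replacement of [p / D] by [p], worth [eps * p ^ 2 / D], and the difference-quotient error of
   [a]. *)
apply: (@CB_ode _ r0 _ _ (mulf (@cstf R (-1)) (mulf P (invf D)))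
  (subf (mulf (@epsf R) (mulf (mulf P (mulf P (invf D))) (restr a)))
        (subf (d1 (restr a)) (restr (partial1 a))))).
- have aE u : partial1 a u = - p u.1 * exp_prim p u.1.
    by apply: is_derive_derive1; exact: is_derive_exp_prim.
  move=> r /D0; apply: filterS2 (near0_gt R) => eps e0 h i j hi hj.
  have := h i j hi hj.
  rewrite /axis_error /addf /subf /mulf /d1 /cstf /epsf /invf /restr aE /D /P /addf /mulf /cstf /epsf /restr /a /=.
  move: (axis_prod p eps i) (exp_prim p (eps * i%:R)) (exp_prim p (eps * i.+1%:R)) (p (eps * i%:R)).
  by move=> X a0 a1 p0 d0; field; rewrite d0 gt_eqF.
- by move=> eps j e0; rewrite /axis_error mulr0 exp_prim0 subrr.
- by [].
- by apply: CB_cstM; apply: M0.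
- apply: CBB; last exact: CB_restr_d1.
  exact: CB_epsM (M0 _ _ _ (M0 _ _ _ (HP k) (M0 _ _ _ (HP k) (HI k))) (CB_restr r0 k sa)).
Qed.

Lemma CB_iter2 r0 (p n k : nat) G : CB r0 p (n + k) G -> CB r0 p k (iter n (@d2 R) G).
Proof.
elim: n k => [//|n IH] k H; rewrite iterS.
by have [|_ [_ h]] := IH k.+1; first by rewrite addnS.
Qed.

Lemma CB_iter1 r0 (p n k : nat) G : CB r0 p (n + k) G -> CB r0 p k (iter n (@d1 R) G).
Proof.
elim: n k => [//|n IH] k H; rewrite iterS.
by have [|_ [h _]] := IH k.+1; first by rewrite addnS.
Qed.

Lemma CB_product_error r0 (X Y x y : family R) k :
  CB r0 1 k (subf X x) -> CB r0 1 k (subf Y y) -> CB r0 0 k Y -> CB r0 0 k x ->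
  CB r0 1 k (subf (mulf X Y) (mulf x y)).
Proof.
move=> hX hY cY cx.
apply: CB_eq (CBD (CBM hX cY) (CBM cx hY)); apply: evt_pos => eps i j _.
by rewrite /addf /subf /mulf; ring.
Qed.

Lemma CB_of_error r0 (X x : family R) k : CB r0 1 k (subf X x) -> CB r0 0 k x -> CB r0 0 k X.
Proof.
move=> h1 h2; apply: CB_eq (CBD (CB_weaken h1) h2); apply: evt_pos => eps i j _.
by rewrite /addf /subf; ring.
Qed.

Lemma CB_d1_error r0 (T : family R) (th : R * R -> R) k : smooth2 th ->
  (forall n, CB r0 1 n (subf T (restr th))) ->
  CB r0 1 k (subf (d1 T) (restr (partial1 th))).
Proof.
move=> sth hT; have [_ [h _]] := hT k.+1.
apply: CB_eq (CBD h (CB_restr_d1 r0 k sth)); apply: evt_pos => eps i j _.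
by rewrite /addf /subf /d1; ring.
Qed.

Lemma CB_d2_error r0 (T : family R) (th : R * R -> R) k : smooth2 th ->
  (forall n, CB r0 1 n (subf T (restr th))) ->
  CB r0 1 k (subf (d2 T) (restr (partial2 th))).
Proof.
move=> sth hT; have [_ [_ h]] := hT k.+1.
apply: CB_eq (CBD h (CB_restr_d2 r0 k sth)); apply: evt_pos => eps i j _.
by rewrite /addf /subf /d2; ring.
Qed.

Lemma potential_converges r0 T F H (th fc h : R * R -> R) : 0 < r0 ->
  smooth2 th -> smooth2 fc -> smooth2 h ->
  (forall k, CB r0 1 k (subf T (restr th))) -> (forall k, CB r0 1 k (subf F (restr fc))) ->
  (forall u, partial1 h u = partial1 th u * fc u - th u * partial1 fc u) ->
  (forall u, partial2 h u = th u * partial2 fc u - partial2 th u * fc u) ->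
  (forall eps i j, 0 < eps -> H eps i.+1 j =
     H eps i j + (T eps i.+1 j * F eps i j - T eps i j * F eps i.+1 j)) ->
  (forall eps i j, 0 < eps -> H eps i j.+1 =
     H eps i j + (T eps i j * F eps i j.+1 - T eps i j.+1 * F eps i j)) ->
  (forall eps, H eps 0%N 0%N = h (0, 0)) ->
  forall k, CB r0 1 k (subf H (restr h)).
Proof.
move=> r00 sth sfc sh hT hF h1 h2 H1 H2 H0 k.
have cT : CB r0 0 k T := CB_of_error (hT k) (CB_restr r0 k sth).
have cF : CB r0 0 k F := CB_of_error (hF k) (CB_restr r0 k sfc).
have eT1 := CB_d1_error k sth hT; have eT2 := CB_d2_error k sth hT.
have eF1 := CB_d1_error k sfc hF; have eF2 := CB_d2_error k sfc hF.
have c1 := CB_restr r0 k (smooth2_partial1 sth); have c2 := CB_restr r0 k (smooth2_partial2 sth).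
have c0 := CB_restr r0 k sth.
have cF1 := CB_of_error eF1 (CB_restr r0 k (smooth2_partial1 sfc)).
have cF2 := CB_of_error eF2 (CB_restr r0 k (smooth2_partial2 sfc)).
apply: CB_int => //.
- apply: CB_eq (CBB (CBB (CB_product_error eT1 (hF k) cF c1) (CB_product_error (hT k) eF1 cF1 c0))
    (CB_restr_d1 r0 k sh)).
  apply: evt_pos => eps i j e0; rewrite /subf /mulf /d1 H1// /restr h1.
  by field; rewrite gt_eqF.
- apply: CB_eq (CBB (CBB (CB_product_error (hT k) eF2 cF2 c0) (CB_product_error eT2 (hF k) cF c2))
    (CB_restr_d2 r0 k sh)).
  apply: evt_pos => eps i j e0; rewrite /subf /mulf /d2 H2// /restr h2.
  by field; rewrite gt_eqF.
- by move=> eps e0; rewrite /subf H0 /restr mulr0 subrr.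
Qed.

Lemma evt_lower_of_error r1 T (th : R * R -> R) :
  (forall x y, `|x| < r1 -> `|y| < r1 -> 1 / 2 < th (x, y)) ->
  bd r1 1 (subf T (restr th)) -> evt r1 (fun eps i j => 1 / 4 <= `|T eps i j|).
Proof.
(* Half of the margin [1 / 2] of [th] is spent on the error of [T]. *)
move=> hth hT r rr1; have h4 : 0 < (1 / 4 : R) by lra.
have := evt_small h4 hT rr1; apply: filterS2 (near0_gt R) => eps e0 h i j hi hj.
have := h i j hi hj; rewrite ler_norml /subf /restr => /andP[h3 _].
have k1 : `|eps * i%:R| < r1.
  by rewrite ger0_norm; [exact: le_lt_trans rr1|rewrite mulr_ge0// ltW].
have k2 : `|eps * j%:R| < r1.
  by rewrite ger0_norm; [exact: le_lt_trans rr1|rewrite mulr_ge0// ltW].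
by have k3 := hth _ _ k1 k2; apply: le_trans (ler_norm _); lra.
Qed.

(** [H / T - h / th = ((H - h) - (h / th) (T - th)) / T], where all factors besides the two errors
    are bounded. *)
Lemma quotient_converges r1 T H (th h : R * R -> R) :
  smooth2 th -> smooth2 h ->
  (forall x y, `|x| < r1 -> `|y| < r1 -> 1 / 2 < th (x, y)) ->
  (forall k, CB r1 1 k (subf T (restr th))) -> (forall k, CB r1 1 k (subf H (restr h))) ->
  forall k, CB r1 1 k (fun eps i j => H eps i j / T eps i j - restr h eps i j / restr th eps i j).
Proof.
move=> sth sh hth hT hH k.
have h4 : 0 < (1 / 4 : R) by lra.
have lT := evt_lower_of_error hth (CB_bd (hT 0%N)).
have lth : evt r1 (fun eps i j => 1 / 4 <= `|restr th eps i j|).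
  apply: evt_lower_of_error hth _.
  by apply: (@CB_bd _ _ 1 0); apply: CB_zero; apply: evt_pos => eps i j _; rewrite /subf subrr.
have cT := CB_inv_lower h4 lT (CB_of_error (hT k) (CB_restr r1 k sth)).
have cth := CB_inv_lower h4 lth (CB_restr r1 k sth).
apply: CB_eq (CBM (CBB (hH k) (CBM (@CBM _ _ 0 0 _ _ _ (CB_restr r1 k sh) cth) (hT k))) cT).
have n1 := evt_lower_neq0 h4 lT; have n2 := evt_lower_neq0 h4 lth.
apply: evt_and n1 n2 => eps i j m1 m2; rewrite /subf /mulf /invf.
by field; rewrite m1 m2.
Qed.

(** * From coordinates to vector-valued lattice functions *)

Section Coordinates.
Variable N : nat.

Lemma row_norm_le (v : 'rV[R]_N) (C : R) : 0 <= C -> (forall k : 'I_N, `|v 0 k| <= C) -> `|v| <= C.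
Proof.
move=> C0 H; rewrite /Num.norm/=.
have [->//|/mx_norm_neq0[[i k] /= ->]] := eqVneq (mx_norm v) 0.
by rewrite (ord1 i).
Qed.

Lemma delta1_coord eps (g : int * int -> 'rV[R]_N) (k : 'I_N) G :
  (forall i j : nat, g (i%:Z, j%:Z) 0 k = G eps i j) ->
  forall i j : nat, delta1 eps g (i%:Z, j%:Z) 0 k = d1 G eps i j.
Proof. by move=> E i j; rewrite /delta1 tau1_nat !mxE !E mulrC. Qed.

Lemma delta2_coord eps (g : int * int -> 'rV[R]_N) (k : 'I_N) G :
  (forall i j : nat, g (i%:Z, j%:Z) 0 k = G eps i j) ->
  forall i j : nat, delta2 eps g (i%:Z, j%:Z) 0 k = d2 G eps i j.
Proof. by move=> E i j; rewrite /delta2 tau2_nat !mxE !E mulrC. Qed.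

Lemma deltas_coord eps m n (g : int * int -> 'rV[R]_N) (k : 'I_N) G :
  (forall i j : nat, g (i%:Z, j%:Z) 0 k = G eps i j) -> forall i j : nat,
  iter m (delta1 eps) (iter n (delta2 eps) g) (i%:Z, j%:Z) 0 k =
  iter m (@d1 R) (iter n (@d2 R) G) eps i j.
Proof.
move=> E; have E2 : forall i j : nat,
    iter n (delta2 eps) g (i%:Z, j%:Z) 0 k = iter n (@d2 R) G eps i j.
  by elim: n => [//|n IH]; rewrite !iterS; exact: delta2_coord.
by elim: m => [//|m IH]; rewrite !iterS; exact: delta1_coord.
Qed.

Lemma CB_converges r0 r (geps : R -> int * int -> 'rV[R]_N) (g : R * R -> 'rV[R]_N)
    (G : 'I_N -> family R) : r < r0 ->
  (forall eps (k : 'I_N) (i j : nat), (geps eps (i%:Z, j%:Z) - g (lpoint eps (i%:Z, j%:Z))) 0 k = G k eps i j) ->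
  (forall (k : 'I_N) (n : nat), CB r0 1 n (G k)) -> Cinfty_converges_Oeps r geps g.
Proof.
move=> rr0 E HG m n.
have H (k : 'I_N) : exists c, 0 <= c /\ \forall eps \near (0 : R)^'+, forall i j : nat,
    eps * i%:R <= r -> eps * j%:R <= r ->
    `|iter m (@d1 R) (iter n (@d2 R) (G k)) eps i j| <= c * eps.
  have h : CB r0 1 (m + 0) (iter n (@d2 R) (G k)) by apply: CB_iter2; exact: HG.
  have [c c0 hc] := bd_nonneg rr0 (CB_bd (CB_iter1 h)).
  by exists c; split => //; apply: filterS hc => eps hc i j hi hj; have := hc i j hi hj; rewrite expr1.
have [c hc] := choice H.
(* A common bound for the finitely many coordinates, as the norm is the maximum norm. *)
exists (\sum_k c k).
have hn : \forall eps \near (0 : R)^'+, forall (k : 'I_N) (i j : nat),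
    eps * i%:R <= r -> eps * j%:R <= r ->
    `|iter m (@d1 R) (iter n (@d2 R) (G k)) eps i j| <= c k * eps.
  apply: (@filter_forall _ 'I_N (fun (k : 'I_N) eps => forall i j : nat,
    eps * i%:R <= r -> eps * j%:R <= r ->
    `|iter m (@d1 R) (iter n (@d2 R) (G k)) eps i j| <= c k * eps)) => k.
  by have [] := hc k.
apply: filterS2 hn (near0_gt R) => eps h e0 u hu _.
have c0 (k : 'I_N) : 0 <= c k by have [] := hc k.
have [i [j e]] := lsquare_nat e0 hu; move: hu; rewrite {u}e => /(lsquareE _ e0)[hi hj].
apply: row_norm_le => [|k]; first by rewrite mulr_ge0 ?sumr_ge0// ltW.
rewrite (@deltas_coord eps m n _ k (G k)); last by move=> i' j'; exact: E.
apply: le_trans (h k i j hi hj) _; rewrite ler_pM2r// (bigD1 k)//= lerDl.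
by rewrite sumr_ge0.
Qed.

End Coordinates.

End Convergence.

Unset Implicit Arguments.
Set Strict Implicit.
Set Printing Implicit Defensive.

(* The discrete M-nets feps eps live on any lattice domain Dom eps containing
   the closed positive quadrant: Dom eps = setT gives nets on all of
   (eps Z)^2.  On the quadrant the recursion is always solvable, whereas
   towards the mixed quadrants it divides by the coefficient a12, which may
   vanish at points far from the origin. *)
Theorem theorem3p13 (R : realType) (N : nat)
  (f1 f2 : R -> 'rV[R]_N) (q12 : R * R -> R) (f : R * R -> 'rV[R]_N)
  (fp0 : 'rV[R]_N) (p10 p20 : R -> R)
  (Dom : R -> set (int * int)) (feps : R -> int * int -> 'rV[R]_N)
  (smooth_f1 : smooth1 f1) (smooth_f2 : smooth1 f2) (f120 : f1 0 = f2 0)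
  (smooth_q12 : smooth_on setT q12)
  (Mnet_f : Mnet_with_data f1 f2 q12 f)
  (smooth_p10 : smooth1 p10) (smooth_p20 : smooth1 p20)
  (Dom_quadrant : forall eps : R, 0 < eps -> quadrant `<=` Dom eps)
  (dMnet_feps : forall eps : R, 0 < eps ->
     canonical_dMnet (Dom eps) eps f1 f2 q12 (feps eps)) :
  exists2 r : R, 0 < r &
  exists fp : R * R -> 'rV[R]_N,
  [/\ Moutard_transform_with_data r q12 f fp0 p10 p20 fp,
      forall g : R * R -> 'rV[R]_N,
        Moutard_transform_with_data r q12 f fp0 p10 p20 g ->
        forall u, square r u -> g u = fp u &
      exists fpeps : R -> int * int -> 'rV[R]_N,
      [/\ \forall eps \near (0 : R)^'+,
            canonical_dMoutard_transform (lsquare eps r) eps q12 (feps eps)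
              fp0 p10 p20 (fpeps eps),
          \forall eps \near (0 : R)^'+,
            forall g : int * int -> 'rV[R]_N,
              canonical_dMoutard_transform (lsquare eps r) eps q12 (feps eps)
                fp0 p10 p20 g ->
              forall u, lsquare eps r u -> g u = fpeps eps u &
          Cinfty_converges_Oeps r fpeps fp]].
Proof.
have sq : smooth2 q12 := smooth_on_setT smooth_q12.
have [[sf0 f12'] f1E f2E] := Mnet_f.
have f12 u : partial1 (partial2 f) u = q12 u *: f u := f12' u I.
have sf := smooth_on_setT sf0.
pose F (k : 'I_N) (u : R * R) : R := f u 0 k.
have sF k : smooth2 (F k) by exact: smooth2_coord.
have p2F k : partial2 (F k) = (fun u => partial2 f u 0 k).
  by apply/funext => u; rewrite (partial2_coord k (I : setT u) (sf 1%N)).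
have F12 k u : partial1 (partial2 (F k)) u = q12 u * F k u.
  have sf2 : Cn_on 1 setT (partial2 f) by have [_ []] := sf 2%N.
  by rewrite p2F -(partial1_coord k (I : setT u) sf2) f12 mxE.
have F21 k u : partial2 (partial1 (F k)) u = q12 u * F k u.
  apply: (@partials_commute _ (F k) (fun u => q12 u * F k u)) => //.
  exact: smooth2_continuous (smooth2M sq (sF k)).
have [th [sth thx thy th12]] := goursat_exists sq (smooth1_exp_prim smooth_p10)
  (smooth1_exp_prim smooth_p20) (etrans (exp_prim0 p10) (esym (exp_prim0 p20))).
have sth1 := smooth2_partial1 sth; have sth2 := smooth2_partial2 sth.
have hE (k : 'I_N) : exists h : R * R -> R, [/\ smooth2 h, h (0, 0) = fp0 0 k,
    forall u, partial1 h u = partial1 th u * F k u - th u * partial1 (F k) u &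
    forall u, partial2 h u = th u * partial2 (F k) u - partial2 th u * F k u].
  have sF1 := smooth2_partial1 (sF k); have sF2 := smooth2_partial2 (sF k).
  apply: potential_exists => [||u].
  - by apply: smooth2B; apply: smooth2M.
  - by apply: smooth2B; apply: smooth2M.
  (* Closedness: in both cross derivatives the terms [q * th * F] cancel, leaving
     [d1 th * d2 F - d2 th * d1 F]. *)
  have [e1 e2] := th12 u.
  have D2 := is_deriveB (is_deriveM (smooth2_derive2 u sth1) (smooth2_derive2 u (sF k)))
    (is_deriveM (smooth2_derive2 u sth) (smooth2_derive2 u sF1)).
  have D1 := is_deriveB (is_deriveM (smooth2_derive1 u sth) (smooth2_derive1 u sF2))
    (is_deriveM (smooth2_derive1 u sth2) (smooth2_derive1 u (sF k))).
  rewrite (is_derive_derive1 D1 : partial1 _ u = _) (is_derive_derive1 D2 : partial2 _ u = _).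
  rewrite -surjective_pairing e1 e2 F12 F21 /GRing.scale/=; ring.
have [h hP] := choice hE.
have th00 : th (0, 0) = 1 by rewrite thx exp_prim0.
have [r1 r10 hth] := half_box (smooth2_continuous sth) th00.
have r0 : 0 < r1 / 2 by rewrite divr_gt0.
have rr1 : r1 / 2 < r1 by lra.
have sh k : smooth2 (h k) by have [] := hP k.
have h00 k : h k (0, 0) = fp0 0 k by have [] := hP k.
have h_1 k u : partial1 (h k) u = partial1 th u * F k u - th u * partial1 (F k) u.
  by have [] := hP k.
have h_2 k u : partial2 (h k) u = th u * partial2 (F k) u - partial2 th u * F k u.
  by have [] := hP k.
pose T : family R := fun eps i j =>
  dnet (fun i j => canonical_a eps q12 (Posz i, Posz j))
    (axis_prod p10 eps) (axis_prod p20 eps) j i.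
pose FF (k : 'I_N) : family R := fun eps i j => feps eps (Posz i, Posz j) 0 k.
pose H (k : 'I_N) : family R := fun eps i j => path_sum (T eps) (FF k eps) (fp0 0 k) i j.
have TE eps i j : T eps i.+1 j.+1 + T eps i j =
    canonical_a eps q12 (Posz i, Posz j) * (T eps i.+1 j + T eps i j.+1).
  exact: dnetE.
have T0j eps j : T eps 0%N j = axis_prod p20 eps j by exact: dnet_axis2.
have fE eps (i j : nat) : 0 < eps -> feps eps (Posz i.+1, Posz j.+1) + feps eps (Posz i, Posz j) =
    canonical_a eps q12 (Posz i, Posz j) *:
      (feps eps (Posz i.+1, Posz j) + feps eps (Posz i, Posz j.+1)).
  move=> e0; have [+ _ _] := dMnet_feps eps e0.
  move=> /(_ (Posz i, Posz j)); rewrite tau1_nat tau2_nat /tau1 /tau2 /= !PoszS; apply.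
  (* All corners of a face with nonnegative indices lie in the quadrant, the part of [Dom eps] that
     is guaranteed. *)
  by split; apply: Dom_quadrant; rewrite // /quadrant /= ?PoszS.
have FE k eps (i j : nat) : 0 < eps -> FF k eps i.+1 j.+1 + FF k eps i j =
    canonical_a eps q12 (Posz i, Posz j) * (FF k eps i.+1 j + FF k eps i j.+1).
  by move=> e0; have := congr1 (fun M : 'rV[R]_N => M 0 k) (fE eps i j e0); rewrite !mxE.
have eT : forall k, CB r1 1 k (subf T (restr th)).
  apply: (net_converges sq sth) => [u|eps i j _|k|k].
  - by have [] := th12 u.
  - exact: TE.
  - apply: CB_eq (CB_axis r1 k smooth_p10); apply: evt_pos => eps i j _.
    by rewrite /axis_error /ax1 /subf /restr mulr0 thx.
  - apply: CB_eq (CB_transpose (CB_axis r1 k smooth_p20)); apply: evt_pos => eps i j _.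
    by rewrite /transpose /axis_error /ax2 /subf /restr mulr0 thy T0j.
have eF k : forall n, CB r1 1 n (subf (FF k) (restr (F k))).
  apply: (net_converges sq (sF k)) => [u|eps i j|n|n].
  - exact: F12.
  - exact: FE.
  (* The discrete nets interpolate [f] exactly on the axes, so the initial error is zero. *)
  - apply: CB_zero; apply: evt_pos => eps i j e0.
    have [_ + _] := dMnet_feps eps e0; move=> /(_ (Posz i)).
    rewrite /ax1 /subf /FF /restr /F mulr0 f1E /cstf => ->; first by rewrite subrr.
    exact: Dom_quadrant.
  - apply: CB_zero; apply: evt_pos => eps i j e0.
    have [_ _ +] := dMnet_feps eps e0; move=> /(_ (Posz j)).
    rewrite /ax2 /subf /FF /restr /F mulr0 f2E /cstf => ->; first by rewrite subrr.
    exact: Dom_quadrant.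
have eH k : forall n, CB r1 1 n (subf (H k) (restr (h k))).
  apply: (potential_converges r10 sth (sF k) (sh k) eT (eF k) (h_1 k) (h_2 k)).
  - by move=> eps i j e0; apply: path_sum_step1 => i' j'; [exact: TE|exact: FE].
  - by move=> eps i j _; exact: path_sum_step2.
  - by move=> eps; rewrite /H path_sum0 h00.
have eQ k := quotient_converges sth (sh k) hth eT (eH k).
exists (r1 / 2) => //; exists (moutard_fp th h); split.
- exact: (moutard_exists sf f12 sth th12 thx thy smooth_p10 smooth_p20 sh h00 h_1 h_2 hth).
- move=> g hg u hu.
  exact: (moutard_unique sf sth th12 thx thy smooth_p10 smooth_p20 sh h00 h_1 h_2 hth r0 rr1 hg).
have canon : \forall eps \near (0 : R)^'+, canonical_dMoutard_transform
    (lsquare eps (r1 / 2)) eps q12 (feps eps) fp0 p10 p20 (dtransform (feps eps) fp0 (T eps)).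
  have h4 : 0 < (1 / 4 : R) by lra.
  have h2 : 0 < (1 / 2 : R) by lra.
  have nT := evt_lower_neq0 h4 (evt_lower_of_error hth (CB_bd (eT 0%N))) rr1.
  (* This product is [canonical_a] minus [1]; being O(eps), it leaves [canonical_a] at least [1 / 2]
     in absolute value. *)
  have ba : bd r1 1 (mulf (@epsf R) (mulf (@epsf R) (mulf (cstf (2^-1)) (restr q12)))).
    apply: (@CB_bd _ _ 1 0); apply: CB_epsM; apply: CB_weaken; apply: CB_epsM.
    by apply: CB_cstM; exact: CB_restr.
  have na := evt_lower_neq0 h2 (evt_1D_lower ba) rr1.
  apply: filterS3 nT na (near0_gt R) => eps nT na e0.
  apply: (@dtransform_canonical R N eps (r1 / 2) e0 q12 (feps eps) fp0 p10 p20 (T eps) (TE eps)) => //.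
  - by move=> i j; exact: fE.
  - by move=> j; rewrite !T0j.
  - move=> i j hi hj; have := na i j hi hj.
    rewrite /mulf /epsf /cstf /restr /canonical_a /lpoint /=.
    by rewrite expr2 !mulrA (mulrC _ 2^-1) !mulrA.
exists (fun eps => dtransform (feps eps) fp0 (T eps)); split => //.
- apply: filterS2 canon (near0_gt R) => eps ceps e0 g hg.
  exact: (dtransform_unique e0 hg ceps).
- apply: (@CB_converges _ _ r1 _ _ _ (fun k eps i j => H k eps i j / T eps i j -
    restr (h k) eps i j / restr th eps i j)) => // eps k i j.
  by rewrite !mxE.
Qed.
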